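(* Let $W\in\{S_n,W^{\mathsf{BC}}_n,W^{\mathsf D}_n\}$ with $n\ge2$. Then $\Gamma^{\mathbf m}=(\mathcal G,\omega^{\mathbf m},\mathrm{Asc}^{\mathbf m})$ and $\Gamma^{\mathbf n}=(\mathcal G,\omega^{\mathbf n},\mathrm{Asc}^{\mathbf n})$ are quasi-admissible $W$-graphs, and the linear maps $Y_z\mapsto\underline M_z$ and $Y_z\mapsto\underline N_z$ are $\mathcal H$-module isomorphisms $\mathcal Y(\Gamma^{\mathbf m})\cong\mathcal M$ and $\mathcal Y(\Gamma^{\mathbf n})\cong\mathcal N$.
   Context: For $i>0$ let $s_i=(i,i+1)(-i,-i-1)$, $s_0=(-1,1)$, $s_{-1}=(1,-2)(-1,2)$. $W^{\mathsf{BC}}_N$: permutations $w$ of $\{\pm1,\dots,\pm N\}$ with $w(-i)=-w(i)$ (generators $s_0,\dots,s_{N-1}$); $W^{\mathsf D}_N$: subgroup with $|\{i\in[N]:w(i)<0\}|$ even (generators $s_{-1},s_1,\dots,s_{N-1}$); $S_N=\langle s_1,\dots,s_{N-1}\rangle$; $\ell$ is Coxeter length. $\mathcal F^{\mathsf A}_{n-1}=\{z\in S_{2n}:z=z^{-1},z(i)\ne i\ \forall i\in[2n]\}$; $\mathcal F^{\mathsf{BC}}_n=\{z\in W^{\mathsf{BC}}_{2n}:z=z^{-1},|z(i)|\ne i\ \forall i\in[2n]\}$; $\mathcal F^{\mathsf D}_n=\{z\in\mathcal F^{\mathsf{BC}}_n:|\{i\in[n]:z(i)<-i\}|\text{ even}\}$.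 $i>0$ is a visible descent of $z$ if $z(i+1)<\min\{i,z(i)\}$ or $z(i)<-i$. $\mathcal G=\mathcal G(W)$ is the subset of $\mathcal F^{\mathsf A}_{n-1}$, $\mathcal F^{\mathsf{BC}}_n$, $\mathcal F^{\mathsf D}_n$ (for $W=S_n,W^{\mathsf{BC}}_n,W^{\mathsf D}_n$) with no visible descent $>n$; $\ell(z)$ for $z\in\mathcal G$ is length in $S_{2n}$, $W^{\mathsf{BC}}_{2n}$, $W^{\mathsf D}_{2n}$ respectively. For $z\in\mathcal G$: $\mathrm{Des}^=(z)=\{s\in S:sz=zs\}$, $\mathrm{Asc}^=(z)=\{s\in S:zsz\in\{s_i:i>n\}\}$, $\mathrm{Des}^<(z)=\{s\in S:\ell(sz)<\ell(z)\}\setminus(\mathrm{Des}^=(z)\sqcup\mathrm{Asc}^=(z))$, $\mathrm{Asc}^<(z)=\{s\in S:\ell(sz)>\ell(z)\}\setminus(\mathrm{Des}^=(z)\sqcup\mathrm{Asc}^=(z))$. $\mathcal H$: Iwahori–Hecke algebra of $W$ over $\mathbb Z[x,x^{-1}]$ with basis $H_w$, $H_sH_w=H_{sw}$ if $\ell(sw)>\ell(w)$, else $H_{sw}+(x-x^{-1})H_w$; its bar operator is the antilinear ($x\mapsto x^{-1}$) ring involution with $\overline{H_w}=(H_{w^{-1}})^{-1}$. $\mathcal M$ (resp. $\mathcal N$) is the free $\mathbb Z[x,x^{-1}]$-module with basis $M_z$ (resp. $N_z$), $z\in\mathcal G$, with $\mathcal H$-action $H_sM_z=M_{szs}$, $M_{szs}+(x-x^{-1})M_z$,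 $-x^{-1}M_z$, $xM_z$ according as $s\in\mathrm{Asc}^<(z),\mathrm{Des}^<(z),\mathrm{Asc}^=(z),\mathrm{Des}^=(z)$, and $H_sN_z=N_{szs}$, $N_{szs}+(x-x^{-1})N_z$, $xN_z$, $-x^{-1}N_z$ in the same cases. Each carries the unique antilinear map $\overline{\cdot}$ with $\overline{HA}=\overline H\,\overline A$ fixing $M_z$ (resp. $N_z$) when $\mathrm{Des}^<(z)=\varnothing$; $\{\underline M_z\}$ (resp. $\{\underline N_z\}$) is the unique basis with $\overline{\underline M_z}=\underline M_z\in M_z+\sum_{\ell(y)<\ell(z)}x^{-1}\mathbb Z[x^{-1}]M_y$ (resp. same with $N$). Write $\underline M_z=\sum_y\mathbf m_{yz}M_y$, $\underline N_z=\sum_y\mathbf n_{yz}N_y$, and let $\mu^{\mathbf m}_{yz},\mu^{\mathbf n}_{yz}$ be the coefficients of $x^{-1}$ in $\mathbf m_{yz},\mathbf n_{yz}$. Let $\mathrm{Asc}^{\mathbf m}(z)=\mathrm{Asc}^<(z)\sqcup\mathrm{Asc}^=(z)$, $\mathrm{Asc}^{\mathbf n}(z)=\mathrm{Asc}^<(z)\sqcup\mathrm{Des}^=(z)$; $\omega^{\mathbf m}(y,z)=\mu^{\mathbf m}_{yz}+\mu^{\mathbf m}_{zy}$ if $\mathrm{Asc}^{\mathbf m}(y)\not\subset\mathrm{Asc}^{\mathbf m}(z)$ and $0$ otherwise; $\omega^{\mathbf n}$ likewise with $\mathbf n$. An $S$-labeled graph $\Gamma=(V,\omega,I)$ has maps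 $\omega:V\times V\to\mathbb Z[x,x^{-1}]$, $I:V\to\{\text{subsets of }S\}$ (edges $u\to v$ when $\omega(u,v)\neq0$). It is a $W$-graph if the free module $\mathcal Y(\Gamma)$ with basis $\{Y_v\}$ has an $\mathcal H$-module structure with $H_sY_u=xY_u$ if $s\notin I(u)$ and $H_sY_u=-x^{-1}Y_u+\sum_{v\in V,\ s\notin I(v)}\omega(u,v)Y_v$ if $s\in I(u)$. It is quasi-admissible if (1) its directed graph is bipartite, (2) all $\omega(u,v)\in\mathbb Z$, (3) $\omega(u,v)=0$ whenever $I(u)\subset I(v)$, (4) $\omega(u,v)=\omega(v,u)$ whenever $I(u)\not\subset I(v)\not\subset I(u)$. *)

(* Defs.v *)
From HB Require Import structures.
From mathcomp Require Import all_boot all_order all_algebra all_fingroup.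
From mathcomp Require Import fraction boolp.
From mathcomp Require Import ring.
From Stdlib Require Import ClassicalEpsilon.
Set Implicit Arguments. Unset Strict Implicit. Unset Printing Implicit Defensive.
Import Order.TTheory GRing.Theory Num.Theory.
Local Open Scope ring_scope.

Definition Kx := {fraction {poly int}}.
Local Notation "p %:F" := (@FracField.tofrac _ p).
Definition xK : Kx := ('X : {poly int})%:F.

Definition laurentb (f : Kx) : bool :=
  `[< exists kp : nat * {poly int}, f * xK ^+ kp.1 = (kp.2)%:F >].

Lemma laurent_closed : subring_closed laurentb.
Proof.
split.
- apply/asboolP; exists (0%N, 1); by rewrite expr0 mulr1 tofrac1.
- move=> f g /asboolP [[k p] /= Hf] /asboolP [[m q] /= Hg]; apply/asboolP.
  exists ((k + m)%N, p * 'X^m - q * 'X^k) => /=.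
  rewrite tofracB !tofracM !tofracXn -/xK -Hf -Hg exprD; ring.
- move=> f g /asboolP [[k p] /= Hf] /asboolP [[m q] /= Hg]; apply/asboolP.
  exists ((k + m)%N, p * q) => /=.
  rewrite tofracM -Hf -Hg exprD; ring.
Qed.

HB.instance Definition _ := GRing.isSubringClosed.Build Kx laurentb laurent_closed.

Record laurent := Laurent { lval : Kx; _ : laurentb lval }.
HB.instance Definition _ := [isSub for lval].
HB.instance Definition _ := [Choice of laurent by <:].
HB.instance Definition _ := [SubChoice_isSubComNzRing of laurent by <:].


Lemma xK_neq0 : xK != 0.
Proof. by rewrite /xK tofrac_eq0 polyX_eq0. Qed.

Lemma xL_subproof : laurentb xK.
Proof. apply/asboolP; exists (0%N, 'X) => /=; by rewrite expr0 mulr1. Qed.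
Lemma xLi_subproof : laurentb xK^-1.
Proof. apply/asboolP; exists (1%N, 1) => /=; by rewrite expr1 mulVf ?xK_neq0 // tofrac1. Qed.

Definition xL : laurent := Laurent xL_subproof.
Definition xLi : laurent := Laurent xLi_subproof.
Definition xz (k : int) : laurent := if (0 <= k) then xL ^+ `|k|%N else xLi ^+ `|k|%N.

Lemma laurent_rep (f : laurent) : exists kp : nat * {poly int}, lval f * xK ^+ kp.1 == (kp.2)%:F.
Proof. by case: f => g /= /asboolP [kp H]; exists kp; apply/eqP. Qed.

Definition lrep (f : laurent) : nat * {poly int} := xchoose (laurent_rep f).

Definition lcoef (f : laurent) (j : int) : int :=
  let e := (j + (lrep f).1%:Z)%R in if (0 <= e) then (lrep f).2`_(`|e|%N) else 0.

Definition lbar (f : laurent) : laurent :=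
  \sum_(i < size (lrep f).2) ((lrep f).2`_i)%:~R * xz ((lrep f).1%:Z - i%:Z).

(** Signed permutations of {+-1,...,+-N}: the point (b,k) stands for
    -(k+1) if b and k+1 otherwise. *)
Definition pt (N : nat) := (bool * 'I_N)%type.
Definition sval {N} (p : pt N) : int := if p.1 then - (p.2.+1)%:Z else (p.2.+1)%:Z.
Definition ptof N (i : int) : option (pt N) := [pick p : pt N | sval p == i].
Definition sapp {N} (w : {perm pt N}) (i : int) : int :=
  if ptof N i is Some p then sval (w p) else 0.
Definition stp N (a b : int) : {perm pt N} :=
  if (ptof N a, ptof N b) is (Some p, Some q) then tperm p q else 1%g.
Definition sgen N (i : nat) : {perm pt N} := (stp N i i.+1 * stp N (- i%:Z) (- i.+1%:Z))%g.
Definition s0 N : {perm pt N} := stp N (-1) 1.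
Definition sm1 N : {perm pt N} := (stp N 1 (-2) * stp N (-1) 2)%g.

Inductive ctype := TA | TBC | TD.

Definition gens (t : ctype) N (r : nat) : seq {perm pt N} :=
  let a := [seq sgen N i | i <- iota 1 r.-1] in
  match t with TA => a | TBC => s0 N :: a | TD => sm1 N :: a end.

Fixpoint reach {T : finType} (gs : seq {perm T}) (k : nat) : {set {perm T}} :=
  match k with
  | 0 => [set 1%g]
  | k'.+1 => reach gs k' :|: [set (a * s)%g | a in reach gs k', s in [set:: gs]]
  end.
Definition len {T : finType} (gs : seq {perm T}) (w : {perm T}) : nat :=
  find (fun k => w \in reach gs k) (iota 0 #|{perm T}|.+1).

(** product "s w" in the paper's convention (apply w first, then s) *)
Definition lmul {T : finType} (s w : {perm T}) : {perm T} := (w * s)%g.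

Unset Implicit Arguments.
Section Setting.
Variables (t : ctype) (n : nat).
Local Notation N := (n.*2).
Local Notation P := {perm pt N}.

Definition negp (p : pt N) : pt N := (~~ p.1, p.2).
Definition inS (w : P) : bool := w \in <<[set:: gens TA N N]>>%g.
Definition isBC (w : P) : bool := [forall p, w (negp p) == negp (w p)].

Definition FA (z : P) : bool :=
  [&& inS z, (z^-1)%g == z & [forall i : 'I_N, sapp z (i.+1)%:Z != (i.+1)%:Z]].
Definition FBC (z : P) : bool :=
  [&& isBC z, (z^-1)%g == z & [forall i : 'I_N, `|sapp z (i.+1)%:Z| != (i.+1)%:Z]].
Definition FD (z : P) : bool :=
  FBC z && ~~ odd #|[set i : 'I_n | sapp z (i.+1)%:Z < - (i.+1)%:Z]|.

Definition vdes (z : P) (i : nat) : bool :=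
  ((i < N)%N && ((sapp z i.+1 < sapp z i) && (sapp z i.+1 < i%:Z))) || (sapp z i < - i%:Z).

Definition Gset : {set P} :=
  [set z | [&& (match t with TA => FA z | TBC => FBC z | TD => FD z end)
             & [forall i : 'I_N, (n < i.+1)%N ==> ~~ vdes z i.+1]]].

Definition Gty := {z : P | z \in Gset}.
Local Notation V := {ffun Gty -> laurent^o}.
HB.instance Definition _ := Finite.copy Gty {z : P | z \in Gset}.

Definition Sset : {set P} := [set:: gens t N n].
Definition bigGens : seq P := gens t N N.
Definition lenG (z : P) : nat := len bigGens z.

Definition DesEq (z : P) : {set P} := [set s in Sset | (lmul s z == lmul z s)].
Definition AscEq (z : P) : {set P} :=
  [set s in Sset | lmul z (lmul s z) \in [set:: [seq sgen N i | i <- iota n.+1 n.-1]]].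
Definition DesLt (z : P) : {set P} :=
  [set s in Sset | (lenG (lmul s z) < lenG z)%N] :\: (DesEq z :|: AscEq z).
Definition AscLt (z : P) : {set P} :=
  [set s in Sset | (lenG z < lenG (lmul s z))%N] :\: (DesEq z :|: AscEq z).

(** basis vector indexed by a permutation (zero if not in G) *)
Definition bvec (w : P) : V := [ffun y : Gty => ((val y == w)%:R : laurent)].
Definition evec (y : Gty) : V := bvec (val y).

Definition conjs (s z : P) : P := lmul s (lmul z s).

(** H_s M_z (b = true) and H_s N_z (b = false) *)
Definition actB (b : bool) (s : P) (y : Gty) : V :=
  let z := val y in
  if s \in AscLt z then bvec (conjs s z)
  else if s \in DesLt z then bvec (conjs s z) + (xL - xLi) *: evec y
  else if s \in AscEq z then (if b then - xLi else xL) *: evec y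
  else if s \in DesEq z then (if b then xL else - xLi) *: evec y
  else 0.
Definition actMN (b : bool) (s : P) (v : V) : V := \sum_y v y *: actB b s y.

(** the operators A_s (s in S) satisfy the defining relations of the
    Iwahori-Hecke algebra of W: (H_s - x)(H_s + x^-1) = 0 and braid relations *)
Fixpoint alt (A : P -> V -> V) (s u : P) (k : nat) (v : V) : V :=
  if k is k'.+1 then A s (alt A u s k' v) else v.
Definition HeckeRel (A : P -> V -> V) : Prop :=
  (forall s, s \in Sset -> forall v, A s (A s v) = (xL - xLi) *: A s v + v) /\
  (forall s u, s \in Sset -> u \in Sset -> s != u ->
     forall v, alt A s u #[(s * u)%g]%g v = alt A u s #[(s * u)%g]%g v).

(** bar operator on the module: antilinear, bar(H_s A) = bar(H_s) bar(A) with
    bar(H_s) = H_s^-1 = H_s - (x - x^-1), fixing basis elements with empty Des^< *)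
Definition isBar (A : P -> V -> V) (beta : V -> V) : Prop :=
  [/\ (forall u v, beta (u + v) = beta u + beta v),
      (forall (c : laurent) v, beta (c *: v) = lbar c *: beta v),
      (forall s, s \in Sset -> forall v, beta (A s v) = A s (beta v) - (xL - xLi) *: beta v)
    & (forall y : Gty, DesLt (val y) = set0 -> beta (evec y) = evec y)].

Definition barOp (A : P -> V -> V) : V -> V :=
  epsilon (inhabits id) (isBar A).

Definition isCanon (A : P -> V -> V) (c : Gty -> V) : Prop :=
  forall z : Gty,
    [/\ barOp A (c z) = c z, c z z = 1 &
        forall y, y != z ->
          (c z y != 0 -> (lenG (val y) < lenG (val z))%N) /\
          (forall j : int, 0 <= j -> lcoef (c z y) j = 0)].

Definition canon (A : P -> V -> V) : Gty -> V := epsilon (inhabits evec) (isCanon A).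

Definition mu (A : P -> V -> V) (y z : Gty) : int := lcoef (canon A z y) (-1).

Definition AscM (z : P) : {set P} := AscLt z :|: AscEq z.
Definition AscN (z : P) : {set P} := AscLt z :|: DesEq z.

Definition omega (A : P -> V -> V) (I : P -> {set P}) (y z : Gty) : laurent :=
  if ~~ (I (val y) \subset I (val z)) then (mu A y z + mu A z y)%:~R else 0.

Definition actYb (om : Gty -> Gty -> laurent) (I : Gty -> {set P}) (s : P) (u : Gty) : V :=
  if s \notin I u then xL *: evec u
  else - xLi *: evec u + \sum_(v | s \notin I v) om u v *: evec v.
Definition actY om I (s : P) (v : V) : V := \sum_u v u *: actYb om I s u.

Definition isWgraph om I : Prop := HeckeRel (actY om I).

Definition quasiAdmissible (om : Gty -> Gty -> laurent) (I : Gty -> {set P}) : Prop :=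
  [/\ (exists c : Gty -> bool, forall u v, om u v != 0 -> c u != c v),
      (forall u v, exists k : int, om u v = k%:~R),
      (forall u v, I u \subset I v -> om u v = 0)
    & (forall u v, ~~ (I u \subset I v) -> ~~ (I v \subset I u) -> om u v = om v u)].

Definition isoCanon om I (A : P -> V -> V) : Prop :=
  let phi := fun v : V => \sum_z v z *: canon A z in
  bijective phi /\ (forall s, s \in Sset -> forall v, phi (actY om I s v) = A s (phi v)).

End Setting.

(* Main.v *)
Require Import Defs.
From HB Require Import structures.
From mathcomp Require Import all_boot all_order all_algebra all_fingroup.
From mathcomp Require Import fraction boolp cyclic ring zify.
From Stdlib Require Import ClassicalEpsilon.
Set Implicit Arguments. Unset Strict Implicit. Unset Printing Implicit Defensive.
Import Order.TTheory GRing.Theory Num.Theory.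
Local Open Scope ring_scope.

(** The obstacle is that the action on the basis of G is not visibly an action of the Hecke algebra:
    its braid relations must be proved, and at an equality ascent conjugation leaves G. Over all the
    fixed-point-free involutions an equality ascent becomes an ordinary move inside the orbit summed
    over, and the weights make the sum an eigenvector. The operators stand for the inverses of the
    [H_s], since [H_s^-1] is the bar of [H_s].

    An entry of the bar matrix pairs [T z] with the function attached to [z']. A generator inserted
    between the two can be absorbed on either side, by conjugating [z] or by acting on [z'];
    equating the results gives the compatibility of the bar with [H_s]. On a function vanishing at
    shorter elements, the value of [T z] at [z] reduces, by conjugating down in the big group, to
    [n] commuting generators acting by one scalar, whence the normalising power [n]. G may have
    several minimal elements; the set of points beyond [n] matched with points up to [n] tells them
    apart, and entries between elements with different sets are put to zero. *)

(* The Hecke module on G is realised inside the functions on all fixed-point-free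
   (signed) involutions of the big group: a basis element of G is sent to the sum, with
   weights a power of x or of -1/x, over its conjugates by the permutations of the points
   beyond n that it matches with points up to n. On functions the generators act by
   operators [Dop], whose braid relations reduce to the orbits of rank two subgroups, and
   composing these operators along a reduced word of z gives an operator [T z] which
   commutes with the generators up to conjugation by z. Evaluating [T z] at z therefore
   gives a matrix that has all the properties of the bar operator. With the bar operator
   at hand, the canonical basis is built by induction on the length as usual, together
   with the parity of its coefficients; the action of a generator on it follows because
   a bar invariant element with coefficients in x^-1 Z[x^-1] is zero. *)

(** * Laurent polynomials *)

Local Notation "p %:F" := (@FracField.tofrac _ p).

(* [lval] is a record projection, hence matched by [rewrite] up to canonical
   structure inference; the alias [lv] keeps rewriting syntactic. *)
Definition lv (f : laurent) : Kx := lval f.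

(** [lrep] returns an arbitrary choice of numerator and exponent, so facts are proved for every
    representation and then applied to the chosen one. *)
Definition lrepr (f : laurent) (k : nat) (p : {poly int}) : Prop :=
  lv f * xK ^+ k = p%:F.

Lemma lrepr_lrep f : lrepr f (lrep f).1 (lrep f).2.
Proof. by rewrite /lrepr /lrep; apply/eqP; exact: (xchooseP (laurent_rep f)). Qed.

Lemma lreprW f k p m : lrepr f k p -> lrepr f (k + m) (p * 'X^m).
Proof. by rewrite /lrepr exprD mulrA => ->; rewrite tofracM tofracXn. Qed.

Lemma lrepr_ex2 f g : exists k p q, lrepr f k p /\ lrepr g k q.
Proof.
exists ((lrep f).1 + (lrep g).1)%N, ((lrep f).2 * 'X^((lrep g).1)),
  ((lrep g).2 * 'X^((lrep f).1)); split; first by apply: lreprW; apply: lrepr_lrep.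
by rewrite addnC; apply: lreprW; apply: lrepr_lrep.
Qed.

Lemma lrepr_uniq f k p k' p' : lrepr f k p -> lrepr f k' p' ->
  p * 'X^k' = p' * 'X^k.
Proof.
move=> /(lreprW k') H1 /(lreprW k) H2; apply/eqP.
by rewrite -tofrac_eq -H1 -H2 addnC.
Qed.

Lemma lcoef_repr f k p j : lrepr f k p ->
  lcoef f j = if 0 <= j + k%:Z then p`_(absz (j + k%:Z)) else 0.
Proof.
move=> H; have := lrepr_uniq H (lrepr_lrep f); rewrite /lcoef.
move: (lrep f) => [k0 p0] /= E.
have Ec i : (if (i < k0)%N then 0 else p`_(i - k0)) = (if (i < k)%N then 0 else p0`_(i - k)).
  by rewrite -!coefMXn E.
case: ifP => h0; case: ifP => h1.
- have := Ec (absz (j + k0%:Z)%R + k)%N.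
  rewrite !ifF; try lia.
  rewrite addnK => <-; congr (nth 0 p _); lia.
- have := Ec (absz (j + k0%:Z)%R + k)%N.
  rewrite ifT; last lia.
  rewrite ifF ?addnK; try lia.
  by move=> <-.
- have := Ec (absz (j + k%:Z)%R + k0)%N.
  rewrite ifF; last lia.
  rewrite ifT; last lia.
  by rewrite addnK.
- by [].
Qed.

(* [lcoef] and, below, [lbar] are sealed because a failing conversion test
   between two of their instances would unfold the whole structure of [laurent]. *)
Lemma lcoef_sealed : {c : laurent -> int -> int | c = lcoef}.
Proof. by exists lcoef. Qed.
Definition lc := proj1_sig lcoef_sealed.
Lemma lcE : lc = lcoef. Proof. exact: proj2_sig lcoef_sealed. Qed.

Lemma lc_repr f k p j : lrepr f k p ->
  lc f j = if 0 <= j + k%:Z then p`_(absz (j + k%:Z)) else 0.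
Proof. by rewrite lcE; exact: lcoef_repr. Qed.

Lemma lreprD f g k p q : lrepr f k p -> lrepr g k q -> lrepr (f + g) k (p + q).
Proof. by rewrite /lrepr => Hf Hg; rewrite tofracD -Hf -Hg /= -mulrDl. Qed.

Lemma lreprM f g k m p q : lrepr f k p -> lrepr g m q ->
  lrepr (f * g) (k + m) (p * q).
Proof. by rewrite /lrepr => Hf Hg; rewrite tofracM -Hf -Hg /= exprD mulrACA. Qed.

Lemma lrepr_int (m : int) : lrepr (m%:~R) 0 m%:~R.
Proof.
by rewrite /lrepr expr0 mulr1 -[lv _]/(val _) !rmorph_int.
Qed.

Lemma lrepr_xL : lrepr xL 0 'X. Proof. by rewrite /lrepr expr0 mulr1. Qed.
Lemma lrepr_xLi : lrepr xLi 1 1.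
Proof. by rewrite /lrepr /= expr1 mulVf ?xK_neq0 // tofrac1. Qed.

Lemma laurent_eq (f g : laurent) : lv f = lv g -> f = g.
Proof. exact: val_inj. Qed.

Lemma lvD f g : lv (f + g) = lv f + lv g. Proof. by []. Qed.
Lemma lvM f g : lv (f * g) = lv f * lv g. Proof. by []. Qed.

Lemma xLxLi : xL * xLi = 1.
Proof. by apply: laurent_eq; rewrite /= mulfV // xK_neq0. Qed.

Lemma lcD f g j : lc (f + g) j = lc f j + lc g j.
Proof.
have [k [p [q [Hf Hg]]]] := lrepr_ex2 f g.
rewrite (lc_repr _ Hf) (lc_repr _ Hg) (lc_repr _ (lreprD Hf Hg)).
by case: ifP; rewrite ?addr0 // coefD.
Qed.

Lemma lc_int (m : int) j : lc m%:~R j = if j == 0 then m else 0.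
Proof.
rewrite (lc_repr _ (lrepr_int m)) addr0 -(rmorph_int (@polyC int)) coefC.
rewrite absz_eq0; case: (j == 0) / eqP => [->|_] //=; first by rewrite intz.
by case: ifP.
Qed.

Lemma lc0 j : lc 0 j = 0.
Proof. by rewrite -[0]/(0%:~R) lc_int if_same. Qed.

Lemma lc1 j : lc 1 j = (j == 0)%:R.
Proof. by rewrite -[1]/(1%:~R) lc_int; case: eqP. Qed.

Lemma lcN f j : lc (- f) j = - lc f j.
Proof. by apply/eqP; rewrite -addr_eq0 -lcD addNr lc0. Qed.

Lemma lcB f g j : lc (f - g) j = lc f j - lc g j.
Proof. by rewrite lcD lcN. Qed.

Lemma lc_sum (I : Type) (r : seq I) (P : pred I) (F : I -> laurent) j :
  lc (\sum_(i <- r | P i) F i) j = \sum_(i <- r | P i) lc (F i) j.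
Proof.
apply: (big_morph (fun f => lc f j)); last exact: lc0.
by move=> f g; apply: lcD.
Qed.

Lemma lc_intM (m : int) f j : lc (m%:~R * f) j = m * lc f j.
Proof.
have H := lrepr_lrep f; have := lreprM (lrepr_int m) H; rewrite add0n => H'.
rewrite (lc_repr _ H') (lc_repr _ H); case: ifP; rewrite ?mulr0 // => _.
by rewrite -(rmorph_int (@polyC int)) coefCM intz.
Qed.

Lemma lc_xL f j : lc (xL * f) j = lc f (j - 1).
Proof.
have H := lrepr_lrep f; have H' := lreprM lrepr_xL H.
rewrite (lc_repr _ H) (lc_repr _ H') add0n coefXM.
case: ifP => h1; case: ifP => h2; try case: ifP => h3 //; try lia; rewrite ?ifF //; try lia.
by congr (nth 0 _ _); lia.
Qed.

Lemma lc_xLi f j : lc (xLi * f) j = lc f (j + 1).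
Proof. by rewrite -[in RHS](mul1r f) -xLxLi -mulrA lc_xL addrK. Qed.

Lemma lc_ext f g : (forall j, lc f j = lc g j) -> f = g.
Proof.
have [k [p [q [Hf Hg]]]] := lrepr_ex2 f g => H.
suff E : p = q.
  apply: laurent_eq; apply: (mulIf (expf_neq0 k xK_neq0)).
  by rewrite Hf Hg E.
apply/polyP => i; have := H (i%:Z - k%:Z).
by rewrite (lc_repr _ Hf) (lc_repr _ Hg) subrK.
Qed.

Lemma lc_low f : exists B : nat, forall j : int, j < - B%:Z -> lc f j = 0.
Proof.
have := lrepr_lrep f; case: (lrep f) => k p /= H; exists k => j hj.
rewrite (lc_repr _ H) ifF //; lia.
Qed.

(** Evaluation at [x^-1] is a ring morphism; expressing [lbar] through it makes additivity and
    multiplicativity available, which the sum over a chosen representation hides. *)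
Definition xinv_eval (p : {poly int}) : Kx := (map_poly intr p).[xK^-1].

Lemma xinv_evalM p q : xinv_eval (p * q) = xinv_eval p * xinv_eval q.
Proof. by rewrite /xinv_eval rmorphM /= hornerM. Qed.

Lemma xinv_evalXn k : xinv_eval 'X^k = xK^-1 ^+ k.
Proof. by rewrite /xinv_eval map_polyXn hornerXn. Qed.

Lemma lv_xz (m : int) : lv (xz m) = xK ^ m.
Proof.
rewrite /xz; case: m => m /=.
  by rewrite -[lv _]/(val _) rmorphXn.
by rewrite -[lv _]/(val _) rmorphXn /= NegzE -exprnN exprVn.
Qed.

Lemma lv_lbar0 f : lv (lbar f) = xK ^+ (lrep f).1 * xinv_eval (lrep f).2.
Proof.
rewrite /lbar; case: (lrep f) => k p /=.
rewrite -[lv _]/(val _) rmorph_sum /xinv_eval /=.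
rewrite (@horner_coef_wide _ (size p)) ?size_poly_leq //; last first.
  by rewrite map_polyE; apply: leq_trans (size_Poly _) _; rewrite size_map.
rewrite big_distrr; apply: eq_bigr => i _ /=.
rewrite -/(lv (xz _)) -/(lv _%:~R) lv_xz expfzDr ?xK_neq0 // coef_map /=.
have -> : lv (p`_i)%:~R = (p`_i)%:~R by rewrite -[lv _]/(val _) rmorph_int.
by rewrite mulrCA -exprnN exprVn.
Qed.

Lemma lv_lbar f k p : lrepr f k p -> lv (lbar f) = xK ^+ k * xinv_eval p.
Proof.
move=> H; rewrite lv_lbar0; have := lrepr_uniq H (lrepr_lrep f).
case: (lrep f) => k0 p0 /= /(congr1 xinv_eval); rewrite !xinv_evalM !xinv_evalXn => E.
have X0 m : xK ^+ m != 0 by rewrite expf_neq0 ?xK_neq0.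
have -> : xinv_eval p0 = xinv_eval p0 * xK^-1 ^+ k * xK ^+ k.
  by rewrite exprVn mulfVK.
by rewrite -E exprVn !mulrA [_ * xinv_eval p]mulrC mulfK // mulrC.
Qed.

Lemma lbar_sealed : {b : laurent -> laurent | b = lbar}.
Proof. by exists lbar. Qed.
Definition lb := proj1_sig lbar_sealed.
Lemma lbE : lb = lbar. Proof. exact: proj2_sig lbar_sealed. Qed.

Lemma lv_lb f k p : lrepr f k p -> lv (lb f) = xK ^+ k * xinv_eval p.
Proof. by rewrite lbE; exact: lv_lbar. Qed.

Lemma lbarD f g : lb (f + g) = lb f + lb g.
Proof.
have [k [p [q [Hf Hg]]]] := lrepr_ex2 f g; apply: laurent_eq.
rewrite (lv_lb (lreprD Hf Hg)) lvD (lv_lb Hf) (lv_lb Hg).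
by rewrite /xinv_eval rmorphD /= hornerD mulrDr.
Qed.

Lemma lbarM f g : lb (f * g) = lb f * lb g.
Proof.
have [k [p [q [Hf Hg]]]] := lrepr_ex2 f g; apply: laurent_eq.
rewrite (lv_lb (lreprM Hf Hg)) lvM (lv_lb Hf) (lv_lb Hg).
by rewrite xinv_evalM exprD mulrACA.
Qed.

Lemma lbar_int (m : int) : lb m%:~R = m%:~R.
Proof.
apply: laurent_eq; rewrite (lv_lb (lrepr_int m)) expr0 mul1r /xinv_eval.
by rewrite rmorph_int -(rmorph_int (@polyC Kx)) hornerC -[lv _]/(val _) rmorph_int.
Qed.

Lemma lbar0 : lb 0 = 0. Proof. exact: (lbar_int 0). Qed.
Lemma lbar1 : lb 1 = 1. Proof. exact: (lbar_int 1). Qed.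
Lemma lbarN f : lb (- f) = - lb f.
Proof. by apply/eqP; rewrite -addr_eq0 -lbarD addNr lbar0. Qed.
Lemma lbar_xL : lb xL = xLi.
Proof.
apply: laurent_eq; rewrite (lv_lb lrepr_xL) expr0 mul1r /xinv_eval.
by rewrite map_polyX hornerX.
Qed.
Lemma lbar_xLi : lb xLi = xL.
Proof.
apply: laurent_eq; rewrite (lv_lb lrepr_xLi) expr1 /xinv_eval.
by rewrite rmorph1 hornerE mulr1.
Qed.

Lemma lbar_sum (I : Type) (r : seq I) (P : pred I) (F : I -> laurent) :
  lb (\sum_(i <- r | P i) F i) = \sum_(i <- r | P i) lb (F i).
Proof. by apply: big_morph; [exact: lbarD | exact: lbar0]. Qed.

Lemma lbar_xz m : lb (xz m) = xz (- m).
Proof.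
have H k : lb (xL ^+ k) = xLi ^+ k.
  by elim: k => [|k IH]; rewrite ?expr0 ?lbar1 // !exprS lbarM IH lbar_xL.
have H' k : lb (xLi ^+ k) = xL ^+ k.
  by elim: k => [|k IH]; rewrite ?expr0 ?lbar1 // !exprS lbarM IH lbar_xLi.
rewrite /xz abszN; case: ifP => h; rewrite ?H ?H'; case: ifP => h' //; try lia.
by have -> : m = 0 by lia.
Qed.

Lemma lc_xz m j : lc (xz m) j = (j == m)%:R.
Proof.
have H k i : lc (xL ^+ k) i = (i == k%:Z)%:R.
  elim: k i => [|k IH] i; first by rewrite expr0 lc1.
  by rewrite exprS lc_xL IH; congr (nat_of_bool _)%:R; lia.
have H' k i : lc (xLi ^+ k) i = (i == - k%:Z)%:R.
  elim: k i => [|k IH] i; first by rewrite expr0 lc1.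
  by rewrite exprS lc_xLi IH; congr (nat_of_bool _)%:R; lia.
rewrite /xz; case: ifP => h; rewrite ?H ?H'; congr (nat_of_bool _)%:R; lia.
Qed.

(** Reduces the effect of the bar on coefficients to the monomials [xz m]. *)
Lemma laurent_sum f :
  f = \sum_(i < size (lrep f).2) ((lrep f).2`_i)%:~R * xz (i%:Z - (lrep f).1%:Z).
Proof.
have := lrepr_lrep f; case E: (lrep f) => [k p] /= H; apply: lc_ext => j.
rewrite lc_sum (lc_repr _ H).
under eq_bigr do rewrite lc_intM lc_xz.
case: ifP => h; last first.
  by rewrite big1 // => i _; case: eqP => // h'; [lia | rewrite mulr0].
case: (ltnP (absz (j + k%:Z)) (size p)) => hs.
  rewrite (bigD1 (Ordinal hs)) //= big1 ?addr0.
    by rewrite (_ : (_ == _) = true) ?mulr1 //; lia.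
  move=> i /eqP hi; case: eqP => h'; last by rewrite mulr0.
  case: hi; apply: val_inj => /=; lia.
rewrite nth_default // big1 // => i _; case: eqP => h'; last by rewrite mulr0.
by have := leq_trans (ltn_ord i) hs; lia.
Qed.

Lemma lc_lbar f j : lc (lb f) j = lc f (- j).
Proof.
rewrite [in LHS](laurent_sum f) [in RHS](laurent_sum f) lbar_sum !lc_sum.
apply: eq_bigr => i _; rewrite lbarM lbar_int lbar_xz !lc_intM !lc_xz.
by congr (_ * (nat_of_bool _)%:R); lia.
Qed.

(** Membership in [x^-1 Z[x^-1]]; [lnpos] is membership in [Z[x^-1]]. *)
Definition lneg (f : laurent) := forall j : int, 0 <= j -> lc f j = 0.
Definition lnpos (f : laurent) := forall j : int, 0 < j -> lc f j = 0.

Lemma lnegW f : lneg f -> lnpos f. Proof. by move=> H j /ltW; apply: H. Qed.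
Lemma lneg_lnpos f : lnpos f -> lc f 0 = 0 -> lneg f.
Proof. by move=> H H0 j; rewrite le_eqVlt => /orP[/eqP <-//|]; apply: H. Qed.
Lemma lneg0 : lneg 0. Proof. by move=> j _; rewrite lc0. Qed.
Lemma lnposD f g : lnpos f -> lnpos g -> lnpos (f + g).
Proof. by move=> Hf Hg j hj; rewrite lcD Hf // Hg. Qed.
Lemma lnposN f : lnpos f -> lnpos (- f).
Proof. by move=> Hf j hj; rewrite lcN Hf ?oppr0. Qed.
Lemma lnpos_int (m : int) : lnpos m%:~R.
Proof. by move=> j hj; rewrite lc_int gt_eqF. Qed.
Lemma lnpos_xLi f : lnpos f -> lneg (xLi * f).
Proof. by move=> Hf j hj; rewrite lc_xLi Hf //; lia. Qed.
Lemma lneg_xL f : lneg f -> lnpos (xL * f).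
Proof. by move=> Hf j hj; rewrite lc_xL Hf //; lia. Qed.

(** The bar reverses exponents, so a fixed element with only negative exponents has none. All
    uniqueness arguments for canonical bases rest on this. *)
Lemma lneg_bar_fixed f : lneg f -> lb f = f -> f = 0.
Proof.
move=> H E; apply: lc_ext => j; rewrite lc0.
case: (lerP 0 j) => hj; first exact: H.
by rewrite -E lc_lbar H //; lia.
Qed.

(* Comparing coefficients from the top makes those of [f] at -1, -3, -5, ...
   equal up to sign, so they vanish by finiteness. *)
Lemma lneg_mul_xDxi f (k : int) : lneg f -> (xL + xLi) * f = k%:~R -> k = 0.
Proof.
move=> H E; have R j : lc f (j - 1) + lc f (j + 1) = if j == 0 then k else 0.
  by rewrite -lc_xL -lc_xLi -lcD -mulrDl E lc_int.
have A m : `|lc f (- 1 - (m%:Z *+ 2))| = `|k|.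
  elim: m => [|m IH].
    have := R 0; rewrite eqxx add0r (H 1) // addr0 => <-.
    by congr (`|lc f _|); lia.
  have := R (- 2 - m%:Z *+ 2); rewrite ifF; last lia.
  move=> /eqP; rewrite addr_eq0 => /eqP E2; rewrite -IH.
  have -> : - 1 - m.+1%:Z *+ 2 = - 2 - m%:Z *+ 2 - 1 by lia.
  by rewrite E2 normrN; congr (`|lc f _|); lia.
have [B HB] := lc_low f; have := A B; rewrite HB ?normr0; last lia.
by move/esym/eqP; rewrite normr_eq0 => /eqP.
Qed.

(** The parity of the exponents is tracked because it yields the bipartition of the W-graph. *)
Definition lpar (e : bool) (f : laurent) := forall j : int, lc f j != 0 -> odd `|j|%N = e.

Lemma lparD e f g : lpar e f -> lpar e g -> lpar e (f + g).
Proof.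
move=> Hf Hg j; rewrite lcD => H; case: (eqVneq (lc f j) 0) => [E|]; last exact: Hf.
by apply: Hg; move: H; rewrite E add0r.
Qed.
Lemma lparN e f : lpar e f -> lpar e (- f).
Proof. by move=> Hf j; rewrite lcN oppr_eq0; apply: Hf. Qed.
Lemma lpar0 e : lpar e 0. Proof. by move=> j; rewrite lc0 eqxx. Qed.
Lemma lpar_sum (I : Type) (r : seq I) (P : pred I) (F : I -> laurent) e :
  (forall i, P i -> lpar e (F i)) -> lpar e (\sum_(i <- r | P i) F i).
Proof. by move=> H; apply: big_ind => //; [apply: lpar0 | apply: lparD]. Qed.
Lemma lpar_int (m : int) : lpar false m%:~R.
Proof. by move=> j; rewrite lc_int; case: (eqVneq j 0) => [->|]. Qed.
Lemma odd_abszD1 (j : int) : odd (absz (j + 1)) = ~~ odd (absz j).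
Proof.
case: j => [m|[|m]]; [by rewrite -PoszD addn1 | by [] | ].
have -> : Negz m.+1 + 1 = Negz m by lia.
by rewrite /= !negbK.
Qed.
Lemma lpar_xL e f : lpar e f -> lpar (~~ e) (xL * f).
Proof. by move=> H j; rewrite lc_xL => /H <-; rewrite -odd_abszD1 subrK. Qed.
Lemma lpar_xLi e f : lpar e f -> lpar (~~ e) (xLi * f).
Proof. by move=> H j; rewrite lc_xLi => /H <-; rewrite odd_abszD1 negbK. Qed.
Lemma lpar_intM (m : int) e f : lpar e f -> lpar e (m%:~R * f).
Proof. by move=> H j; rewrite lc_intM mulf_eq0 negb_or => /andP[_ /H]. Qed.

Local Notation sval := Defs.sval.

(** The reflection [refl] below, read on signed integers, so that identities between points become
    linear arithmetic. *)
Definition rv (a b v : int) : int :=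
  if v == a then - b else if v == - b then a else
  if v == - a then b else if v == b then - a else v.

Ltac rvlia := rewrite ?/rv; repeat match goal with
  | |- context [if ?b then _ else _] =>
    lazymatch b with context [if _ then _ else _] => fail | _ => case: (boolP b) => ? end
  end; lia.

(** * Roots and reflections *)

Section Signed.
Variable n : nat.
Local Notation N := (n.*2).
Local Notation P := {perm pt N}.
Local Notation neg := (negp n).
Implicit Types (p q x y : pt N) (w z : P).

Lemma sval_neg p : sval (neg p) = - sval p.
Proof. by rewrite /sval /negp /=; case: p.1; rewrite //= opprK. Qed.

Lemma negK : involutive neg.
Proof. by move=> [b i]; rewrite /negp /= negbK. Qed.

Lemma sval_bnd p : (sval p != 0) && (`|sval p| <= N%:Z).
Proof. by rewrite /sval; case: p => [[] i] /=; have := ltn_ord i; lia. Qed.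

Lemma sval_inj : injective (@Defs.sval N).
Proof.
move=> [b i] [c j]; rewrite /sval /=; have := ltn_ord i; have := ltn_ord j.
move=> h1 h2 H; have -> : b = c by case: b c H => [] []; lia.
by congr (_, _); apply: val_inj => /=; case: b c H => [] []; lia.
Qed.

Lemma sval_eq p q : (p == q) = (sval p == sval q).
Proof. by rewrite (inj_eq sval_inj). Qed.

Lemma sval_ex (v : int) : v != 0 -> `|v| <= N%:Z -> exists p : pt N, sval p = v.
Proof.
move=> h0 h1; have H : ((absz v).-1 < N)%N by lia.
by exists (v < 0, Ordinal H); rewrite /Defs.sval /=; case: ifP => h; lia.
Qed.

Lemma ptof_sval p : ptof N (sval p) = Some p.
Proof.
rewrite /ptof; case: pickP => [q /eqP /sval_inj ->|] //.
by move/(_ p); rewrite eqxx.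
Qed.

Lemma sapp_sval z p : sapp z (sval p) = sval (z p).
Proof. by rewrite /sapp ptof_sval. Qed.

Lemma stp_sval p q : stp N (sval p) (sval q) = tperm p q.
Proof. by rewrite /stp !ptof_sval. Qed.

(* A pair [(p, q)] stands for the root [e_p + e_q], where [e_(-i) = - e_i], and for
   [e_p] when [p = q]; [refl p q] is the reflection in it, which swaps [p] with [-q]
   and [q] with [-p]. *)
Definition rf p q x : pt N :=
  if x == p then neg q else if x == neg q then p else
  if x == neg p then q else if x == q then neg p else x.

Lemma sval_rf p q x : sval (rf p q x) = rv (sval p) (sval q) (sval x).
Proof. by rewrite /rf /rv !sval_eq !sval_neg !(fun_if sval) !sval_neg. Qed.

Lemma rfK p q : involutive (rf p q).
Proof.
move=> x; apply: sval_inj; rewrite !sval_rf.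
have := sval_bnd p; have := sval_bnd q; have := sval_bnd x; rvlia.
Qed.

Definition refl p q : P := perm (can_inj (rfK p q)).

Lemma reflE p q x : refl p q x = rf p q x. Proof. exact: permE. Qed.
Lemma sval_refl p q x : sval (refl p q x) = rv (sval p) (sval q) (sval x).
Proof. by rewrite reflE sval_rf. Qed.
Lemma reflK p q x : refl p q (refl p q x) = x.
Proof. by rewrite !reflE rfK. Qed.
Lemma refl2 p q : (refl p q * refl p q = 1)%g.
Proof. by apply/permP => x; rewrite permM reflK perm1. Qed.
Lemma reflV p q : ((refl p q)^-1 = refl p q)%g.
Proof. by rewrite -[LHS]mulg1 -(refl2 p q) mulKg. Qed.

Lemma isBCP w : reflect (forall p, w (neg p) = neg (w p)) (isBC n w).
Proof. by apply: (iffP forallP) => H p; apply/eqP. Qed.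

Lemma sval_isBC w p : isBC n w -> sval (w (neg p)) = - sval (w p).
Proof. by move/isBCP->; rewrite sval_neg. Qed.

Lemma isBC_refl p q : isBC n (refl p q).
Proof.
apply/isBCP => x; apply: sval_inj; rewrite sval_neg !sval_refl sval_neg.
have := sval_bnd p; have := sval_bnd q; have := sval_bnd x; rvlia.
Qed.

Lemma isBC1 : isBC n 1. Proof. by apply/isBCP => p; rewrite !perm1. Qed.
Lemma isBCM w z : isBC n w -> isBC n z -> isBC n (w * z)%g.
Proof. by move=> /isBCP Hw /isBCP Hz; apply/isBCP => p; rewrite !permM Hw Hz. Qed.
Lemma isBCV w : isBC n w -> isBC n w^-1.
Proof.
by move=> /isBCP Hw; apply/isBCP => p; apply: (@perm_inj _ w); rewrite Hw !permKV.
Qed.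

Lemma refl_conj w p q : isBC n w -> (refl p q * w = w * refl (w p) (w q))%g.
Proof.
move/isBCP => Hw; apply/permP => x; rewrite !permM !reflE /rf -!Hw !(inj_eq perm_inj).
by rewrite !(fun_if w).
Qed.

Lemma refl_sym p q : refl p q = refl q p.
Proof.
apply/permP => x; apply: sval_inj; rewrite !sval_refl.
have := sval_bnd p; have := sval_bnd q; have := sval_bnd x; rvlia.
Qed.

Lemma refl_neg p q : refl (neg p) (neg q) = refl p q.
Proof.
apply/permP => x; apply: sval_inj; rewrite !sval_refl !sval_neg.
have := sval_bnd p; have := sval_bnd q; have := sval_bnd x; rvlia.
Qed.

Lemma sval_tperm p q x : sval (tperm p q x) =
  if sval x == sval p then sval q else if sval x == sval q then sval p else sval x.
Proof.
rewrite -!sval_eq; case: tpermP => [->|->|/eqP/negPf-> /eqP/negPf->];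
  by rewrite ?eqxx //; case: eqP => // ->.
Qed.

Lemma refl_tperm p q : q != neg p ->
  refl p q = (if p == q then tperm p (neg p) else tperm p (neg q) * tperm (neg p) q)%g.
Proof.
rewrite !sval_eq sval_neg => H; apply/permP => x; apply: sval_inj.
case: ifP => h; rewrite ?permM !sval_tperm sval_refl ?sval_neg.
  have := sval_bnd p; have := sval_bnd q; have := sval_bnd x; rvlia.
have := sval_bnd p; have := sval_bnd q; have := sval_bnd x; rvlia.
Qed.

Lemma odd_refl p q : q != neg p -> odd_perm (refl p q) = (p == q).
Proof.
move=> H; rewrite refl_tperm //; have := H; rewrite !sval_eq sval_neg.
have := sval_bnd p => H1 H2.
case: ifP => h; rewrite ?odd_permM !odd_tperm !sval_eq !sval_neg; lia.
Qed.

(** Sign of the root [e_x + e_y], read off by the functional sending [e_i] to [i], which is positive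
    on every simple root. *)
Definition posr x y : bool := 0 < sval x + sval y.

Lemma posr_neg x y : y != neg x -> posr (neg x) (neg y) = ~~ posr x y.
Proof. by rewrite /posr sval_eq !sval_neg; lia. Qed.

Lemma posrC x y : posr x y = posr y x. Proof. by rewrite /posr addrC. Qed.

Lemma sgen_refl i p q : sval p = - i%:Z -> sval q = i.+1%:Z -> sgen N i = refl p q.
Proof.
  move=> hp hq; rewrite refl_tperm ?sval_eq ?sval_neg; last lia.
  rewrite ifF; last lia.
  rewrite /sgen -[i%:Z]opprK -hp -hq -!sval_neg !stp_sval negK.
  have := sval_bnd p; have := sval_bnd q => h1 h2.
  have C : commute (tperm (neg p) q) (tperm p (neg q)).
    apply/permP => x; apply: sval_inj; rewrite !permM !sval_tperm !sval_neg.
    have := sval_bnd x; rvlia.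
  exact: C.
Qed.

Variable t : ctype.
Definition is_B := if t is TBC then true else false.
Definition is_D := if t is TD then true else false.
(* The simple roots of rank [K]: the pair [(-i, i+1)] for [s_i], [(1, 1)] for [s_0] and
   [(1, 2)] for [s_(-1)]. In type A, [isroot] below still accepts the pairs of type D;
   this is harmless because [weyl] fixes the signs there. *)
Definition simple_root (K : nat) p q : bool :=
  [|| [&& sval p < 0, sval q == 1 - sval p & sval q <= K%:Z],
      [&& is_B, sval p == 1 & sval q == 1]
    | [&& is_D, sval p == 1 & sval q == 2]].

Lemma simpleW K K' p q : (K <= K')%N -> simple_root K p q -> simple_root K' p q.
Proof. rewrite /simple_root; lia. Qed.

Lemma simple_posr K p q : simple_root K p q -> posr p q.
Proof. by rewrite /simple_root /posr; lia. Qed.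

Lemma simple_neq K p q : simple_root K p q -> q != neg p.
Proof. by rewrite /simple_root sval_eq sval_neg; lia. Qed.

Lemma gens_simple K s : (2 <= K <= N)%N ->
  (s \in gens t N K) <-> (exists p q, simple_root K p q /\ s = refl p q).
Proof.
move=> hK.
have A i : (0 < i < K)%N -> exists p q,
    [&& sval p < 0, sval q == 1 - sval p & sval q <= K%:Z] /\ sgen N i = refl p q.
  move=> hi; have [p hp] : exists p : pt N, sval p = - i%:Z by apply: sval_ex; lia.
  have [q hq] : exists p : pt N, sval p = i.+1%:Z by apply: sval_ex; lia.
  by exists p, q; split; [lia | exact: sgen_refl].
have [p1 hp1] : exists p : pt N, sval p = 1 by apply: sval_ex; lia.
have [p2 hp2] : exists p : pt N, sval p = 2 by apply: sval_ex; lia.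
have b1 := sval_bnd p1; have b2 := sval_bnd p2.
have E0 : s0 N = refl p1 p1.
  rewrite refl_tperm ?sval_eq ?sval_neg; last lia.
  by rewrite eqxx /s0 -hp1 -sval_neg stp_sval tpermC.
have E1 : sm1 N = refl p1 p2.
  rewrite refl_tperm ?sval_eq ?sval_neg; last lia.
  rewrite ifF; last lia.
  have <- : stp N 1 (-2) = tperm p1 (neg p2) by rewrite -stp_sval sval_neg hp1 hp2.
  by have <- : stp N (-1) 2 = tperm (neg p1) p2 by rewrite -stp_sval sval_neg hp1 hp2.
have B p q : [&& sval p < 0, sval q == 1 - sval p & sval q <= K%:Z] ->
    refl p q \in [seq sgen N i | i <- iota 1 K.-1].
  move=> h; apply/mapP; exists `|sval p|%N; first by rewrite mem_iota; lia.
  by symmetry; apply: sgen_refl; lia.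
have A' i : i \in iota 1 K.-1 -> (0 < i < K)%N by rewrite mem_iota; lia.
rewrite /simple_root /gens /is_B /is_D; case: t => /=.
- split=> [/mapP[i /A' /A [p [q [h ->]]] ->]|[p [q [h ->]]]].
    by exists p, q; rewrite h.
  by apply: B; rewrite !orbF in h.
- rewrite inE; split=> [/orP[/eqP->|/mapP[i /A' /A [p [q [h ->]]] ->]]|].
  + by exists p1, p1; rewrite E0 hp1 !orbT.
  + by exists p, q; rewrite h.
  + move=> [p [q [/or3P[h|/andP[/eqP h /eqP h']|h] ->]]]; apply/orP; [right; exact: B|left|by []].
    by rewrite E0; apply/eqP; congr refl; apply: sval_inj; lia.
- rewrite inE; split=> [/orP[/eqP->|/mapP[i /A' /A [p [q [h ->]]] ->]]|].
  + by exists p1, p2; rewrite E1 hp1 hp2 !orbT.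
  + by exists p, q; rewrite h.
  + move=> [p [q [/orP[h|/andP[/eqP h /eqP h']] ->]]]; apply/orP; [right; exact: B|left].
    by rewrite E1; apply/eqP; congr refl; apply: sval_inj; lia.
Qed.

(** The pair [(x, neg x)] would give the zero vector, and the roots [e_x] belong to type B only. *)
Definition isroot x y : bool := (y != neg x) && (is_B || (y != x)).

Lemma PhiM w x y : isBC n w -> isroot (w x) (w y) = isroot x y.
Proof. by move/isBCP => Hw; rewrite /isroot -Hw !(inj_eq perm_inj). Qed.
Lemma Phi_neg x y : isroot (neg x) (neg y) = isroot x y.
Proof. by rewrite /isroot !(inj_eq (inv_inj negK)). Qed.
Lemma simple_Phi K p q : simple_root K p q -> isroot p q.
Proof.
by have := sval_bnd p; rewrite /simple_root /isroot !sval_eq !sval_neg /is_B /is_D; case: t; lia.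
Qed.

(** Equality of roots up to sign, hence of their reflections ([refl_same_root]). *)
Definition same_root x y p q : bool :=
  [|| (x == p) && (y == q), (x == q) && (y == p),
      (x == neg p) && (y == neg q) | (x == neg q) && (y == neg p)].

(** A case split that lets the values of [rv] be generalised, leaving only linear facts for
    [lia]. *)
Lemma rvP (a b v : int) : a != 0 -> b != 0 -> a != - b ->
  [\/ v = a /\ rv a b v = - b, v = - b /\ rv a b v = a, v = - a /\ rv a b v = b
    | v = b /\ rv a b v = - a] \/ [/\ v <> a, v <> - b, v <> - a & v <> b] /\ rv a b v = v.
Proof.
move=> ha hb hab; rewrite /rv; case: eqP => [->|h1]; first by left; constructor 1.
case: eqP => [->|h2]; first by left; constructor 2.
case: eqP => [->|h3]; first by left; constructor 3.
by case: eqP => [->|h4]; [left; constructor 4 | right].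
Qed.

Lemma rv_id (a b v : int) : v <> a -> v <> - b -> v <> - a -> v <> b -> rv a b v = v.
Proof. by rewrite /rv; do 4![move/eqP/negPf->]. Qed.

Lemma simple_posr_refl K p q x y : simple_root K p q -> isroot x y -> ~~ same_root x y p q ->
  posr (refl p q x) (refl p q y) = posr x y.
Proof.
have /andP[hp _] := sval_bnd p; have /andP[hq _] := sval_bnd q.
have /andP[hx _] := sval_bnd x; have /andP[hy _] := sval_bnd y.
move=> S; have := simple_neq S; have := S.
rewrite /same_root /isroot !sval_eq !sval_neg /posr !sval_refl /simple_root.
move: (sval p) (sval q) (sval x) (sval y) hp hq hx hy {S}=> a b v w ha hb hv hw S hab.
have hab' : a != - b by lia.
have := rvP v ha hb hab'; have := rvP w ha hb hab'.
move: (rv a b v) (rv a b w) => rv rw Hw Hv.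
case/or3P: S => [/and3P[h1 /eqP h2 _]|/and3P[hB /eqP h1 /eqP h2]|/and3P[hD /eqP h1 /eqP h2]];
  first (move=> {hab hab'} /andP[h3 _]); rewrite ?hB; last first.
- have -> : is_B = false by move: hD; rewrite /is_D /is_B; case: t.
  subst a b; case: Hv => [[[-> ->]|[-> ->]|[-> ->]|[-> ->]]|[[? ? ? ?] ->]];
  case: Hw => [[[-> ->]|[-> ->]|[-> ->]|[-> ->]]|[[? ? ? ?] ->]] /andP[h3 h4] h5; lia.
- subst a b; case: Hv => [[[-> ->]|[-> ->]|[-> ->]|[-> ->]]|[[? ? ? ?] ->]];
  case: Hw => [[[-> ->]|[-> ->]|[-> ->]|[-> ->]]|[[? ? ? ?] ->]] h3 h5; lia.
subst b; case: Hv => [[[-> ->]|[-> ->]|[-> ->]|[-> ->]]|[[? ? ? ?] ->]];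
case: Hw => [[[-> ->]|[-> ->]|[-> ->]|[-> ->]]|[[? ? ? ?] ->]] h5; lia.
Qed.

End Signed.

(** * The length function *)

Section Length.
Variables (n : nat) (t : ctype).
Local Notation N := (n.*2).
Local Notation P := {perm pt N}.
Local Notation neg := (negp n).
Local Notation Phi := (@isroot n t).
Local Notation simple := (@simple_root n t).
Implicit Types (p q x y : pt N) (w z : P) (a : pt N * pt N).

(** In type A the group consists of the sign preserving elements. In type D, each [s_i] is a product
    of two transpositions of points and a single sign change is one transposition, so evenness of
    the number of sign changes is evenness as a permutation. *)
Definition weyl w : bool := isBC n w &&
  match t with
  | TA => [forall p, (sval (w p) < 0) == (sval p < 0)]
  | TBC => true
  | TD => ~~ odd_perm w
  end.

Lemma WG_BC w : weyl w -> isBC n w. Proof. by case/andP. Qed.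
Lemma WG1 : weyl 1.
Proof.
rewrite /weyl isBC1; case: t => //; last by rewrite odd_perm1.
by apply/forallP => p; rewrite perm1.
Qed.
Lemma WGM w z : weyl w -> weyl z -> weyl (w * z)%g.
Proof.
move=> /andP[Bw Hw] /andP[Bz Hz]; rewrite /weyl isBCM //=.
case: t Hw Hz => //; last by rewrite odd_permM => /negPf-> /negPf->.
by move=> /forallP Hw /forallP Hz; apply/forallP => p; rewrite permM (eqP (Hz _)) (eqP (Hw _)).
Qed.
Lemma WGV w : weyl w -> weyl w^-1%g.
Proof.
move=> /andP[Bw Hw]; rewrite /weyl isBCV //=.
case: t Hw => //; last by rewrite odd_permV.
by move=> /forallP Hw; apply/forallP => p; rewrite -(eqP (Hw _)) permKV.
Qed.
Lemma WG_refl K p q : simple K p q -> weyl (refl p q).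
Proof.
move=> H; rewrite /weyl isBC_refl /= odd_refl ?(simple_neq H) //.
move: H; rewrite /simple_root sval_eq /is_B /is_D; case: t => //=; last by lia.
rewrite !orbF => H; apply/forallP => x; rewrite sval_refl; have := sval_bnd x; rvlia.
Qed.

Definition act2 w a : pt N * pt N := (w a.1, w a.2).
Definition wt a : nat := (a.1 == a.2).+1.

(* Twice the number of inversions: a root [(x, y)] with [x <> y] occurs also as [(y, x)],
   and [wt] doubles the roots [(x, x)]. *)
Definition L2 w : nat :=
  (\sum_(a | Phi a.1 a.2) wt a * (posr a.1 a.2 && ~~ posr (w a.1) (w a.2)))%N.

(** This is what [wt] is for: a root with [p <> q] is met as two pairs of weight 1, a root [e_p] as
    one pair of weight 2, so both contribute alike. *)
Lemma sum_same_root p q (F : pt N * pt N -> nat) c d : q != neg p ->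
  (forall x y, (x, y) = (p, q) \/ (x, y) = (q, p) -> F (x, y) = wt (x, y) * c)%N ->
  (forall x y, (x, y) = (neg p, neg q) \/ (x, y) = (neg q, neg p) -> F (x, y) = wt (x, y) * d)%N ->
  (\sum_(a | same_root a.1 a.2 p q) F a = 2 * c + 2 * d)%N.
Proof.
rewrite sval_eq sval_neg => Hpq Hc Hd; have bp := sval_bnd p; have bq := sval_bnd q.
rewrite (bigID (fun a => (a.1 == p) && (a.2 == q) || (a.1 == q) && (a.2 == p))) /=.
have E (r s : pt N) (G : pt N * pt N -> nat) e (Q : pred (pt N * pt N)) :
    (forall a, Q a = (a.1 == r) && (a.2 == s) || (a.1 == s) && (a.2 == r)) ->
    (forall x y, (x, y) = (r, s) \/ (x, y) = (s, r) -> G (x, y) = wt (x, y) * e)%N ->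
    (\sum_(a | Q a) G a = 2 * e)%N.
  move=> HQ HG; rewrite (eq_bigl _ _ HQ) (bigD1 (r, s)) ?eqxx //=.
  rewrite HG; last by left.
  case: (eqVneq r s) => [<-|hrs].
    rewrite big1 ?addn0 /wt /= ?eqxx // => [[x y]] /=.
    by rewrite orbb => /andP[/andP[/eqP-> /eqP->]]; rewrite eqxx.
  rewrite (bigD1 (s, r)) /=; last by rewrite !eqxx orbT /= xpair_eqE negb_and eq_sym hrs.
  rewrite HG; last by right.
  rewrite big1 ?addn0 => [|[x y]].
    by rewrite /wt /= [s == r]eq_sym (negPf hrs) !mul1n mul2n addnn.
  by move=> /= /andP[/andP[/orP[/andP[/eqP-> /eqP->]|/andP[/eqP-> /eqP->]]]]; rewrite ?eqxx.
rewrite (E p q F c) //; last first.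
  by move=> [x y] /=; rewrite /same_root andb_idl // => /orP[]->; rewrite ?orbT.
rewrite (E (neg p) (neg q) F d) //.
have nn r : (neg r == r) = false by rewrite sval_eq sval_neg; have := sval_bnd r; lia.
have npq : (neg p == q) = false by rewrite sval_eq sval_neg; lia.
have nqp : (neg q == p) = false by rewrite sval_eq sval_neg; lia.
move=> [x y] /=; rewrite /same_root.
apply/idP/idP => [/andP[/or4P[->|->|->|->]]|/orP[] /andP[/eqP-> /eqP->]];
  by rewrite ?eqxx ?nn ?npq ?nqp ?orbT.
Qed.

(** After reindexing by the reflection, which permutes the positive roots other than its own, the
    two counts differ only in the terms of that root and of its negative. *)
Lemma L2_refl K p q w : simple K p q -> isBC n w ->
  (L2 (refl p q * w) + 2 * ~~ posr (w p) (w q) = L2 w + 2 * posr (w p) (w q))%N.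
Proof.
move=> S Bw; have D := simple_neq S; have Pp := simple_posr S; have B := isBC_refl p q.
have SR a : same_root a.1 a.2 p q -> Phi a.1 a.2.
  have H := simple_Phi S; have H' : Phi q p.
    by rewrite /isroot eq_sym (can2_eq (@negK n) (@negK n)) [p == q]eq_sym.
  by case: a => x y /or4P[] /andP[/eqP-> /eqP->] //=; rewrite Phi_neg.
have wN x y : posr (w (neg x)) (w (neg y)) = posr (neg (w x)) (neg (w y)).
  by rewrite !(isBCP _ Bw).
have wD : w q != neg (w p) by rewrite -(isBCP _ Bw) (inj_eq perm_inj).
have rp : refl p q p = neg q by rewrite reflE /rf eqxx.
have rq : refl p q q = neg p.
  by apply: sval_inj; rewrite sval_refl sval_neg; have := sval_bnd p; have := sval_bnd q; rvlia.
have -> : L2 (refl p q * w) = (\sum_(a | Phi a.1 a.2)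
    wt a * (posr (refl p q a.1) (refl p q a.2) && ~~ posr (w a.1) (w a.2)))%N.
  have hK : involutive (act2 (refl p q)) by case=> x y; rewrite /act2 /= !reflK.
  rewrite /L2 (reindex_inj (inv_inj hK)) /=.
  apply: eq_big => [a|a _]; first by rewrite PhiM.
  by rewrite !permM !reflK /wt (inj_eq perm_inj).
rewrite /L2 (bigID (fun a => same_root a.1 a.2 p q)) /=.
rewrite [X in _ = (X + _)%N](bigID (fun a => same_root a.1 a.2 p q)) /=.
rewrite [in RHS]addnC [X in (_ + X + _)%N](_ : _ = \sum_(a | Phi a.1 a.2 && ~~ same_root a.1 a.2 p q)
    wt a * (posr a.1 a.2 && ~~ posr (w a.1) (w a.2)))%N; last first.
  by apply: eq_bigr => a /andP[h1 h2]; rewrite (simple_posr_refl S).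
have rnp : refl p q (neg p) = q by rewrite (isBCP _ B) rp negK.
have rnq : refl p q (neg q) = p by rewrite (isBCP _ B) rq negK.
have nP : posr (neg p) (neg q) = false by rewrite posr_neg // Pp.
have nP' : posr (neg q) (neg p) = false by rewrite posrC.
have Pp' : posr q p by rewrite posrC.
have cN : posr (neg (w p)) (neg (w q)) = ~~ posr (w p) (w q) by rewrite posr_neg.
have cN' : posr (neg (w q)) (neg (w p)) = ~~ posr (w p) (w q) by rewrite posrC.
have SE a : Phi a.1 a.2 && same_root a.1 a.2 p q = same_root a.1 a.2 p q.
  by apply: andb_idl; apply: SR.
rewrite !(eq_bigl _ _ SE).
rewrite (@sum_same_root p q _ 0 (posr (w p) (w q))) //; first last.
- by move=> x y [[-> ->]|[-> ->]]; rewrite /= ?rnp ?rnq ?Pp ?Pp' wN ?cN ?cN' negbK.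
- by move=> x y [[-> ->]|[-> ->]]; rewrite /= ?rp ?rq ?nP ?nP'.
rewrite (@sum_same_root p q _ (~~ posr (w p) (w q)) 0) //; first last.
- by move=> x y [[-> ->]|[-> ->]]; rewrite /= ?nP ?nP'.
- by move=> x y [[-> ->]|[-> ->]]; rewrite /= ?Pp ?Pp' // posrC.
by case: (posr _ _); rewrite !muln0 !muln1 ?addn0 ?add0n // addnC.
Qed.

Lemma L2_V w : isBC n w -> L2 w^-1%g = L2 w.
Proof.
(* The negative of the image under [w] of an inversion of [w] is an inversion of the inverse. *)
move=> Bw; pose h a := (neg (w a.1), neg (w a.2)).
have hi : injective h.
  move=> [x y] [x' y'] /eqP; rewrite xpair_eqE /= !(inj_eq (inv_inj (@negK n))) !(inj_eq perm_inj).
  by move=> /andP[/eqP-> /eqP->].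
rewrite /L2 (reindex_inj hi) /=; apply: eq_big => [a|a]; first by rewrite Phi_neg PhiM.
rewrite Phi_neg PhiM // => Ha; have Hw : Phi (w a.1) (w a.2) by rewrite PhiM.
move: Ha Hw => /andP[Ha _] /andP[Hw _].
rewrite -!(isBCP _ Bw) !permK !(isBCP _ Bw) !posr_neg // negbK andbC.
by rewrite /wt /= (inj_eq (inv_inj (@negK n))) (inj_eq perm_inj).
Qed.

Definition interval (X : pred (pt N)) := forall x y z : pt N,
  x \in X -> z \in X -> sval x < sval y -> sval y < sval z -> y \in X.

Lemma interval_mono (X : pred (pt N)) (f : pt N -> int) : interval X ->
  (forall x, x \in X -> 0 < sval x) ->
  (forall x y, x \in X -> y \in X -> sval y = sval x + 1 -> f x < f y) ->
  forall x y, x \in X -> y \in X -> sval x < sval y -> f x < f y.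
Proof.
move=> HI HP H x y Xx; have [k] := ubnP (absz (sval y - sval x)).
elim: k y => // k IH y hk Xy hxy.
have [E|D] := eqVneq (sval y) (sval x + 1); first exact: H.
have [u hu] : exists u : pt N, sval u = sval y - 1.
  by apply: sval_ex; have := HP _ Xx; have := sval_bnd y; lia.
have Xu : u \in X by apply: (HI x u y) => //; lia.
apply: (@lt_trans _ _ (f u)); first by apply: IH => //; lia.
by apply: H => //; lia.
Qed.

(** If [w x > x], then also [w (w x) > w x], and the iterates would increase forever below the bound
    [N]; likewise downwards. *)
Lemma mono_id (X : pred (pt N)) w :
  (forall x, x \in X -> w x \in X) ->
  (forall x y, x \in X -> y \in X -> sval x < sval y -> sval (w x) < sval (w y)) ->
  forall x, x \in X -> w x = x.
Proof.
move=> HX H x Xx; apply: sval_inj; apply/eqP; rewrite eq_le; apply/andP; split.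
- have [k] := ubnP (absz (N%:Z - sval x)).
  elim: k x Xx => // k IH x Xx hk; case: lerP => // h.
  have := IH _ (HX _ Xx); have := H _ _ Xx (HX _ Xx) h.
  have := sval_bnd (w x); have := sval_bnd x; lia.
- have [k] := ubnP (absz (N%:Z + sval x)).
  elim: k x Xx => // k IH x Xx hk; case: lerP => // h.
  have := IH _ (HX _ Xx); have := H _ _ (HX _ Xx) Xx h.
  have := sval_bnd (w x); have := sval_bnd x; lia.
Qed.

Lemma isBC_eq1 w : isBC n w -> (forall x, 0 < sval x -> w x = x) -> w = 1%g.
Proof.
move=> /isBCP Bw H; apply/permP => x; rewrite perm1.
case: (ltrP 0 (sval x)) => [|h]; first exact: H.
have {}h : 0 < sval (neg x) by rewrite sval_neg; have := sval_bnd x; lia.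
by apply: (inv_inj (@negK n)); rewrite -Bw H.
Qed.

Lemma no_descent_eq1 w : (1 < n)%N -> weyl w ->
  (forall p q, simple N p q -> posr (w p) (w q)) -> w = 1%g.
Proof.
move=> hn Ww HS; have Bw := WG_BC Ww.
pose X := [pred x : pt N | 0 < sval x].
have XI : interval X by move=> x y z; rewrite !inE; lia.
have asc x y : x \in X -> sval y = sval x + 1 -> sval (w x) < sval (w y).
  rewrite inE => hx hxy; have : simple N (neg x) y.
    by rewrite /simple_root sval_neg; have := sval_bnd y; lia.
  by move/HS; rewrite /posr sval_isBC //; lia.
have K v : isBC n v -> (forall x y, x \in X -> sval y = sval x + 1 -> sval (v x) < sval (v y)) ->
    (forall x, sval x = 1 -> 0 < sval (v x)) -> v = 1%g.
  move=> Bv Av Pv; apply: isBC_eq1 => // x hx.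
  have [p1 hp1] : exists p : pt N, sval p = 1 by apply: sval_ex; lia.
  have M := @interval_mono X (fun x => sval (v x)) XI _ (fun x y Xx _ => Av x y Xx).
  have {}M := M (fun x Xx => Xx).
  apply: (@mono_id X) => // y Xy; have := Pv _ hp1; rewrite !inE in Xy *.
  have [E|D] := eqVneq (sval y) 1; first by move=> _; apply: Pv.
  by have := M p1 y; rewrite !inE hp1 => /(_ isT Xy); lia.
have [p1 hp1] : exists p : pt N, sval p = 1 by apply: sval_ex; lia.
have [p2 hp2] : exists p : pt N, sval p = 2 by apply: sval_ex; lia.
have P1 (x : pt N) : sval x = 1 -> x = p1 by rewrite -hp1 => /sval_inj.
move: (Ww); rewrite /weyl => /andP[_]; case E : t HS => HS Wt.
- apply: K => // x hx; move/forallP: Wt => /(_ x).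
  have := sval_bnd (w x); rewrite hx; lia.
- apply: K => // x hx; have := HS x x; rewrite /simple_root hx /= => /(_ isT).
  by rewrite /posr; lia.
have S12 : posr (w p1) (w p2) by apply: HS; rewrite /simple_root hp1 hp2 orbT.
case: (ltrP 0 (sval (w p1))) => h1; first by apply: K => // x /P1->.
(* In type D a negative [w 1] is still possible. Changing the sign of 1 first would then give an
   increasing element with positive values, hence the identity; so [w] would be a single sign
   change, which is odd. *)
have Br := isBC_refl p1 p1; have bw := sval_bnd (w p1).
have rE x : refl p1 p1 x = if (x == p1) || (x == neg p1) then neg x else x.
  apply: sval_inj; rewrite sval_refl !sval_eq (fun_if sval) !sval_neg.
  by have := sval_bnd x; rvlia.
have E1 : (refl p1 p1 * w = 1)%g.
  apply: K; first exact: isBCM.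
  - move=> x y Xx hxy; have Hxy := asc _ _ Xx hxy; rewrite !permM !rE !sval_eq !sval_neg hp1.
    have {}Xx : 0 < sval x := Xx.
    rewrite [X in _ < sval (w X)]ifF; last lia.
    case: ifP => [h|//]; have Ex : x = p1 by apply: P1; lia.
    have Ey : y = p2 by apply: sval_inj; rewrite hp2 hxy Ex hp1.
    rewrite Ex Ey sval_isBC //; move: S12; rewrite /posr; lia.
  - by move=> x /P1->; rewrite permM rE eqxx sval_isBC //; lia.
have Ew : w = refl p1 p1 by rewrite -[RHS]mulg1 -E1 mulgA refl2 mul1g.
move: Wt; rewrite Ew odd_refl ?eqxx // sval_eq sval_neg; lia.
Qed.

Lemma descent_ex w : (1 < n)%N -> weyl w -> w != 1%g ->
  exists p q, simple N p q /\ posr (w p) (w q) = false.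
Proof.
move=> hn Ww /negP D; apply: contrapT => H; apply: D; apply/eqP.
apply: no_descent_eq1 => // p q S; apply/negPn/negP => /negPf H'; apply: H.
by exists p, q.
Qed.

Lemma L2_1 : L2 1 = 0%N.
Proof.
rewrite /L2 big1 // => a _; rewrite !perm1.
by case: posr; rewrite ?muln0.
Qed.

Lemma reach_L2 w k : w \in reach (gens t N N) k -> (1 < n)%N -> weyl w /\ (L2 w <= k.*2)%N.
Proof.
move=> + hn; elim: k w => [|k IH] w /=.
  rewrite inE => /eqP->; split; first exact: WG1.
  by rewrite L2_1.
rewrite inE => /orP[/IH[H1 H2]|/imset2P[a s /IH[H1 H2]]]; first by split=> //; lia.
rewrite inE => /(gens_simple t s (_ : 2 <= N <= N)%N) H ->.
have {H}[p [q [S ->]]] := H ltac:(lia).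
have W := WG_refl S; split; first exact: WGM.
rewrite -L2_V ?isBCM ?isBC_refl ?WG_BC // invMg reflV.
have := L2_refl S (isBCV (WG_BC H1)); rewrite (L2_V (WG_BC H1)).
case: posr => /=; rewrite ?muln0 ?muln1 ?addn0 => E.
  by rewrite E; apply: (leq_trans (leq_add H2 (leqnn 2))); rewrite doubleS addn2.
apply: (@leq_trans k.*2); last by rewrite leq_double.
by apply: leq_trans H2; rewrite -E leq_addr.
Qed.

Lemma L2_reach w : (1 < n)%N -> weyl w ->
  exists2 k, L2 w = k.*2 & w \in reach (gens t N N) k.
Proof.
move=> hn; have [k] := ubnP (L2 w); elim: k w => // k IH w hk Ww.
have [->|D] := eqVneq w 1%g.
  by exists 0%N; [rewrite L2_1 | rewrite inE].
have D' : (w^-1 != 1)%g by rewrite eq_invg1.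
have [p [q [S Hpq]]] := descent_ex hn (WGV Ww) D'.
have Bw := WG_BC Ww; have := L2_refl S (isBCV Bw); rewrite Hpq L2_V // => E.
have E' : L2 (w * refl p q)%g = L2 (refl p q * w^-1)%g.
  by rewrite -L2_V ?invMg ?reflV // isBCM // isBC_refl.
have hk' : (L2 (w * refl p q)%g < k)%N by lia.
have [k' Hk' Hr] := IH _ hk' (WGM Ww (WG_refl S)).
exists k'.+1; first by lia.
rewrite /= inE; apply/orP; right; apply/imset2P.
exists (w * refl p q)%g (refl p q) => //; last by rewrite -mulgA refl2 mulg1.
by rewrite inE; apply/(gens_simple t _ (_ : 2 <= N <= N)%N); [lia | exists p, q].
Qed.

Lemma lenE w : (1 < n)%N -> weyl w -> L2 w = (lenG t n w).*2.
Proof.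
move=> hn Ww; have [k Ek Hk] := L2_reach hn Ww; rewrite Ek; congr _.*2.
have low j : (j < k)%N -> w \notin reach (gens t N N) j.
  by move=> hj; apply/negP => /reach_L2 /(_ hn) [_]; lia.
(* Walking down from [w] realises every value up to [k] as a length. Hence [k] is at most the number
   of permutations, the bound of the search in [len]. *)
have cover j : (j <= k)%N -> exists v, weyl v /\ L2 v = j.*2.
  move=> /subnKC; move: (k - j)%N => d; elim: d j => [|d IH] j; first by rewrite addn0 => ->; exists w.
  rewrite addnS -addSn => /IH [v [Wv Hv]].
  have D : v != 1%g by apply/negP => /eqP E; move: Hv; rewrite E L2_1.
  have [p [q [S Hpq]]] := descent_ex hn Wv D; exists (refl p q * v)%g.
  split; first by apply: WGM => //; apply: WG_refl S.
  by have := L2_refl S (WG_BC Wv); rewrite Hpq Hv; lia.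
have kM : (k <= #|{perm pt N}|)%N.
  apply: ltnW; rewrite -(size_iota 0 k.+1) cardE -(size_map (fun v => (L2 v)./2)).
  apply: uniq_leq_size; first exact: iota_uniq.
  move=> j; rewrite mem_iota add0n ltnS => /cover [v [_ Hv]]; apply/mapP.
  by exists v; rewrite ?mem_enum // Hv doubleK.
rewrite /lenG /len /bigGens; set s := iota _ _.
have nthS j : (j <= k)%N -> nth 0%N s j = j.
  by move=> hj; rewrite nth_iota ?add0n //; lia.
have Hk' : (k < size s)%N by rewrite size_iota; lia.
set a := fun _ => _; have Ha : has a s.
  by apply/(has_nthP 0%N); exists k => //; rewrite nthS.
case: (ltngtP k (find a s)) => // h.
  by have := before_find 0%N h; rewrite nthS // /a Hk.
by have := nth_find 0%N Ha; rewrite nthS ?(ltnW h) // /a => H; have := low _ h; rewrite H.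
Qed.

End Length.

Lemma partition_porbits (T : finType) (z : {perm T}) : partition (porbits z) [set: T].
Proof.
apply/and3P; split.
- rewrite eqEsubset subsetT /=; apply/subsetP => x _.
  by apply/bigcupP; exists (porbit z x); [apply: imset_f | apply: porbit_id].
- apply/trivIsetP => A B /imsetP[x _ ->] /imsetP[y _ ->]; apply: contraR => /pred0Pn [u /=].
  by rewrite -!eq_porbit_mem => /andP[/eqP<- /eqP<-].
- by apply/imsetP => [[x _ E]]; have := porbit_id z x; rewrite -E inE.
Qed.

(** * Fixed-point-free involutions *)

Section Fpf.
Variables (n : nat) (t : ctype).
Hypothesis hn : (1 < n)%N.
Local Notation N := (n.*2).
Local Notation P := {perm pt N}.
Local Notation neg := (negp n).
Local Notation Phi := (@isroot n t).
Local Notation simple := (@simple_root n t).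
Local Notation WG := (@weyl n t).
Local Notation len := (lenG t n).
Implicit Types (p q r x y : pt N) (w z : P).

Lemma len_up p q w : simple N p q -> WG w -> posr (w p) (w q) ->
  len (refl p q * w)%g = (len w).+1.
Proof.
move=> S W H; have := L2_refl S (WG_BC W); rewrite H !lenE //.
  by rewrite muln0 muln1 addn0 -mul2n; lia.
by apply: WGM => //; apply: WG_refl S.
Qed.

Lemma len_dn p q w : simple N p q -> WG w -> ~~ posr (w p) (w q) ->
  len w = (len (refl p q * w)%g).+1.
Proof.
move=> S W /negPf H; have := L2_refl S (WG_BC W); rewrite H !lenE //.
  by rewrite muln0 muln1 addn0 -mul2n; lia.
by apply: WGM => //; apply: WG_refl S.
Qed.

Lemma len_V w : WG w -> len w^-1%g = len w.
Proof.
by move=> W; apply: double_inj; rewrite -!lenE ?L2_V ?WGV ?(WG_BC W).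
Qed.

Lemma len_upl p q w : simple N p q -> WG w -> posr (w^-1%g p) (w^-1%g q) ->
  len (w * refl p q)%g = (len w).+1.
Proof.
move=> S W H; rewrite -len_V; last by apply: WGM => //; apply: WG_refl S.
by rewrite invMg reflV len_up ?len_V //; apply: WGV.
Qed.

Lemma len_dnl p q w : simple N p q -> WG w -> ~~ posr (w^-1%g p) (w^-1%g q) ->
  len w = (len (w * refl p q)%g).+1.
Proof.
move=> S W H; have W' : WG (w * refl p q)%g by apply: WGM => //; apply: WG_refl S.
by rewrite -(len_V W') invMg reflV -len_dn ?len_V //; apply: WGV.
Qed.

Lemma len1 : len 1 = 0%N.
Proof. by apply: double_inj; rewrite -lenE ?L2_1 //; apply: WG1. Qed.

(* The parity condition of type D is imposed on all positive points; on G this amounts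
   to the points up to [n] (lemma [kneg_card]). *)
Definition kneg z : nat := #|[set p : pt N | (0 < sval p) && (sval p + sval (z p) < 0)]|.

Definition fpf_inv z : bool := [&& isBC n z, (z^-1)%g == z,
  [forall p, (z p != p) && (z p != neg p)] &
  match t with
  | TA => [forall p, (sval (z p) < 0) == (sval p < 0)]
  | TBC => true
  | TD => ~~ odd (kneg z)
  end].

Section FzTheory.
Variable z : P.
Hypothesis Hz : fpf_inv z.
Lemma Fz_BC : isBC n z. Proof. by case/and4P: Hz. Qed.
Lemma Fz_inv : (z^-1)%g = z. Proof. by case/and4P: Hz => _ /eqP. Qed.
Lemma Fz_K x : z (z x) = x. Proof. by rewrite -{1}Fz_inv permK. Qed.
Lemma Fz_neg x : z (neg x) = neg (z x). Proof. exact: (isBCP _ Fz_BC). Qed.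
Lemma Fz_eqC x y : (z x == y) = (z y == x).
Proof. by rewrite -(inj_eq (@perm_inj _ z)) Fz_K eq_sym. Qed.
Lemma Fz_fpf x : (z x != x) && (z x != neg x).
Proof. by case/and4P: Hz => _ _ /forallP. Qed.
Lemma Fz_Phi x : Phi x (z x).
Proof. by rewrite /isroot; case/andP: (Fz_fpf x) => -> ->; rewrite orbT. Qed.
End FzTheory.

(** In type D: a fixed-point-free involution of the [4n] signed points is a product of [2n]
    transpositions, hence even. *)
Lemma Fz_WG z : fpf_inv z -> WG z.
Proof.
move=> Hz; rewrite /weyl Fz_BC //=; case/and4P: (Hz) => _ _ _; case E : t => // _.
have C A : A \in porbits z -> #|A| = 2%N.
  move=> /imsetP [x _ ->].
  have -> : porbit z x = [set x; z x].
    apply/setP => y; apply/porbitP/set2P => [[i ->]|[->|->]].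
    - elim: i => [|i [] IH]; first by left; rewrite expg0 perm1.
        by right; rewrite expgSr permM IH.
      by left; rewrite expgSr permM IH Fz_K.
    - by exists 0%N; rewrite expg0 perm1.
    - by exists 1%N; rewrite expg1.
  by rewrite cards2 eq_sym; case/andP: (Fz_fpf Hz x) => ->.
have := card_uniform_partition C (partition_porbits z).
rewrite cardsT card_prod card_bool card_ord /odd_perm => E2.
have E3 : #|porbits z| = n.*2 by apply/eqP; rewrite -(eqn_pmul2r (isT : 0 < 2)%N) -E2 mulnC.
by rewrite E3 card_prod card_bool card_ord mul2n !odd_double.
Qed.

Lemma refl_same_root (a b p q : pt N) : b != neg a -> q != neg p ->
  (refl a b == refl p q) = same_root a b p q.
Proof.
move=> hab hpq; apply/eqP/idP => [E|].
  have := congr1 (fun w : P => w p) E; rewrite !reflE /rf eqxx /same_root.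
  have -> : (p == neg b) = (b == neg p) by rewrite eq_sym (can2_eq (@negK n) (@negK n)).
  have -> : (p == neg a) = (a == neg p) by rewrite eq_sym (can2_eq (@negK n) (@negK n)).
  rewrite [p == a]eq_sym [p == b]eq_sym.
  case: eqP => [-> /(inv_inj (@negK n)) ->|_]; first by rewrite !eqxx.
  case: eqP => [-> ->|_]; first by rewrite !eqxx !orbT.
  case: eqP => [-> ->|_]; first by rewrite !eqxx !orbT.
  case: eqP => [-> /(inv_inj (@negK n)) ->|_ E2]; first by rewrite !eqxx !orbT.
  by rewrite E2 negK eqxx in hpq.
by case/or4P => /andP[/eqP-> /eqP->]; rewrite ?refl_neg // refl_sym ?refl_neg.
Qed.

(** Stands for [s] in [Des^=(z)]: by [fxE] it says that [z] commutes with [refl p q]. *)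
Definition fx p q z := same_root (z p) (z q) p q.
Definition cj p q z : P := (refl p q * z * refl p q)%g.

Lemma cjE p q z x : cj p q z x = refl p q (z (refl p q x)).
Proof. by rewrite /cj !permM. Qed.

Lemma cjK p q : involutive (cj p q).
Proof. by move=> z; rewrite /cj !mulgA refl2 mul1g -mulgA refl2 mulg1. Qed.

Lemma root_neq z p q : isBC n z -> q != neg p -> z q != neg (z p).
Proof. by move/isBCP=> H; rewrite -H (inj_eq perm_inj). Qed.

Lemma conj_refl z p q x y : isBC n z -> q != neg p -> y != neg x ->
  (refl p q * z == z * refl x y)%g = same_root (z p) (z q) x y.
Proof.
move=> Bz hpq hxy; rewrite refl_conj // (inj_eq (mulgI z)).
by rewrite refl_same_root // root_neq.
Qed.

Lemma fxE z p q : isBC n z -> q != neg p -> (refl p q * z == z * refl p q)%g = fx p q z.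
Proof. by move=> Bz hpq; apply: conj_refl. Qed.

Lemma fx_cj_id z p q : isBC n z -> q != neg p -> fx p q z -> cj p q z = z.
Proof.
by move=> Bz hpq; rewrite -fxE // /cj => /eqP->; rewrite -mulgA refl2 mulg1.
Qed.

Lemma cj_BC p q z : isBC n z -> isBC n (cj p q z).
Proof. by move=> Bz; rewrite /cj !isBCM ?isBC_refl. Qed.

Lemma fx_cj p q p' q' z : isBC n z -> q != neg p -> q' != neg p' ->
  (refl p q * refl p' q' = refl p' q' * refl p q)%g -> fx p q (cj p' q' z) = fx p q z.
Proof.
move=> Bz hpq hpq' C; rewrite -!fxE ?cj_BC // /cj.
rewrite !mulgA C -2!(mulgA (refl p' q')) -!mulgA (inj_eq (mulgI _)) !mulgA.
by rewrite -[X in _ == X]mulgA -C !mulgA (inj_eq (mulIg _)).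
Qed.

Lemma Fz_root z p q : fpf_inv z -> simple N p q -> Phi (z p) (z q).
Proof. by move=> Hz S; rewrite PhiM ?Fz_BC // (simple_Phi S). Qed.

Lemma refl_p p q : q != neg p -> refl p q p = neg q.
Proof. by move=> H; rewrite reflE /rf eqxx. Qed.
Lemma refl_q p q : q != neg p -> refl p q q = neg p.
Proof. by move=> H; rewrite refl_sym refl_p // eq_sym (can2_eq (@negK n) (@negK n)). Qed.

Lemma posr_cj z p q : fpf_inv z -> simple N p q -> ~~ fx p q z ->
  posr (cj p q z p) (cj p q z q) = ~~ posr (z p) (z q).
Proof.
move=> Hz S F; have D := simple_neq S; have Bz := Fz_BC Hz.
rewrite !cjE refl_p // refl_q // !(isBCP _ Bz) !(isBCP _ (isBC_refl _ _)) posrC posr_neg.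
  by rewrite (simple_posr_refl S) // Fz_root.
by rewrite -(isBCP _ (isBC_refl p q)) (inj_eq perm_inj) root_neq.
Qed.

(** Conjugation keeps the signs of the roots [e_x + e_(z x)] and can only change which of [x] and
    [- x] is counted. An [s_i] changes nothing; [s_(-1)] does so for the two points 1 and 2, and
    negating two truth values keeps the parity. *)
Lemma kneg_cj z p q : ~~ is_B t -> fpf_inv z -> simple N p q -> odd (kneg (cj p q z)) = odd (kneg z).
Proof.
clear hn => nB Hz S; have D := simple_neq S; have Bz := Fz_BC Hz.
have [H|H] := boolP (fx p q z); first by rewrite fx_cj_id.
have nposr v x : fpf_inv v -> (sval x + sval (v x) < 0) = ~~ posr x (v x).
  by move=> Hv; have /andP[+ _] := Fz_Phi Hv x; rewrite /posr sval_eq sval_neg; lia.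
have key x : posr (refl p q x) (refl p q (z x)) = posr x (z x).
  rewrite (simple_posr_refl S) ?(Fz_Phi Hz) //.
  apply/negP => h; move/negP: H; apply; rewrite -fxE //; apply/eqP.
  have /eqP E : refl x (z x) == refl p q.
    by rewrite refl_same_root //; case/andP: (Fz_Phi Hz x).
  by rewrite -E refl_conj // Fz_K // refl_sym.
have nposr' x : (sval (refl p q x) + sval (refl p q (z x)) < 0) = ~~ posr x (z x).
  rewrite -key /posr; have /andP[+ _] := Fz_Phi Hz x.
  rewrite -(inj_eq (@perm_inj _ (refl p q))) (isBCP _ (isBC_refl p q)) sval_eq sval_neg; lia.
have -> : kneg (cj p q z) = #|[set y : pt N | (0 < sval (refl p q y)) && ~~ posr y (z y)]|.
  rewrite /kneg -(card_imset _ (@perm_inj _ (refl p q))); apply: eq_card => y.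
  rewrite !inE; apply/imsetP/andP => [[x]|[h1 h2]].
    by rewrite inE cjE => /andP[h1 h2] ->; rewrite reflK -nposr' reflK.
  by exists (refl p q y); rewrite ?reflK // inE cjE reflK h1 nposr'.
have -> : kneg z = #|[set y : pt N | (0 < sval y) && ~~ posr y (z y)]|.
  by apply: eq_card => y; rewrite !inE nposr.
have nE x : posr (neg x) (z (neg x)) = ~~ posr x (z x).
  by rewrite Fz_neg // posr_neg //; case/andP: (Fz_Phi Hz x).
have bp := sval_bnd p; have bq := sval_bnd q.
case/or3P: S => [/and3P[h1 h2 h3]|/and3P[h0 _ _]|/and3P[h0 /eqP h1 /eqP h2]].
- congr (odd _); apply: eq_card => y; rewrite !inE sval_refl.
  by congr (_ && _); have := sval_bnd y; rvlia.
- by rewrite h0 in nB.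
- have B := isBC_refl p q.
  set S2 := finset (fun y => (0 < sval (refl p q y)) && _).
  set S1 := finset (fun y => (0 < sval y) && _).
  rewrite (cardsD1 (neg p) S2) (cardsD1 (neg q) (S2 :\ neg p)).
  rewrite (cardsD1 p S1) (cardsD1 q (S1 :\ p)).
  have -> : S2 :\ neg p :\ neg q = S1 :\ p :\ q.
    apply/setP => y; rewrite !inE !sval_eq !sval_neg sval_refl h1 h2.
    case: (posr y (z y)); rewrite ?andbF ?andbT //.
    by have := sval_bnd y; rvlia.
  rewrite !inE !nE.
  rewrite !(isBCP _ B) refl_p // refl_q // !negK h1 h2 !sval_eq !sval_neg h1 h2 /=.
  by rewrite !negbK; case: (posr p _); case: (posr q _); rewrite /= !add0n ?add1n /= ?negbK.
Qed.

Lemma Fz_cj z p q : fpf_inv z -> simple N p q -> fpf_inv (cj p q z).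
Proof.
move=> Hz S; rewrite /fpf_inv; apply/and4P; split.
- exact: cj_BC (Fz_BC Hz).
- by rewrite /cj !invMg !reflV Fz_inv // mulgA.
- apply/forallP => x; rewrite cjE.
  have /andP[h1 h2] := Fz_fpf Hz (refl p q x).
  rewrite -{2}(reflK p q x) -{4}(reflK p q x) -(isBCP _ (isBC_refl p q)).
  by rewrite !(inj_eq perm_inj) h1 h2.
- case/and4P: (Hz) => _ _ _; have := fun h => @kneg_cj z p q h Hz S; rewrite /is_B; case E : t => // H.
    move=> /forallP W; apply/forallP => x; rewrite cjE.
    have := WG_refl S; rewrite /weyl E => /andP[_ /forallP Wr].
    by rewrite (eqP (Wr _)) (eqP (W _)) (eqP (Wr _)).
  by rewrite H.
Qed.

End Fpf.

(** * Operators of the generators on functions *)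

Section Ops.
Variables (n : nat) (t : ctype).
Hypothesis hn : (1 < n)%N.
Local Notation N := (n.*2).
Local Notation P := {perm pt N}.
Local Notation neg := (negp n).
Local Notation simple := (@simple_root n t).
Local Notation len := (lenG t n).
Local Notation Fz := (@fpf_inv n t).
Implicit Types (p q r x y : pt N) (w z : P).

Lemma len_cj_up z p q : Fz z -> simple N p q -> ~~ fx p q z -> posr (z p) (z q) ->
  len (cj p q z) = (len z).+2.
Proof.
move=> Hz S F H; have Wz := Fz_WG Hz.
have E : len (z * refl p q)%g = (len z).+1 by rewrite (len_upl hn S) // (Fz_inv Hz).
rewrite /cj -mulgA (len_up hn S) ?E //; first by apply: WGM => //; apply: WG_refl S.
by rewrite !permM (simple_posr_refl S) // (Fz_root Hz).
Qed.

Lemma len_cj_dn z p q : Fz z -> simple N p q -> ~~ fx p q z -> ~~ posr (z p) (z q) ->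
  len z = (len (cj p q z)).+2.
Proof.
move=> Hz S F H; have D := simple_neq S.
rewrite -{1}(cjK p q z) len_cj_up ?Fz_cj ?fx_cj ?(Fz_BC Hz) //.
by rewrite (posr_cj Hz S).
Qed.

Lemma len_cj_le z p q : Fz z -> simple N p q -> (len (cj p q z) <= (len z).+2)%N.
Proof.
move=> Hz S; have [F|F] := boolP (fx p q z).
  by rewrite fx_cj_id ?(Fz_BC Hz) ?(simple_neq S) //; lia.
have [H|H] := boolP (posr (z p) (z q)); first by rewrite (len_cj_up Hz S).
by rewrite (len_cj_dn Hz S F H); lia.
Qed.

Variables (R : comNzRingType) (ci th : R).
Hypothesis hci : ci * ci = 1 + th * ci.

(* The transpose of the action of the inverse of [H_s] on functions over all the
   fixed-point-free involutions, where no equality ascents occur. *)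
Definition Dop p q (f : P -> R) : P -> R := fun z =>
  if Fz z then
    if fx p q z then ci * f z
    else if posr (z p) (z q) then f (cj p q z) + th * f z else f (cj p q z)
  else 0.

Lemma Dop_fx p q f z : Fz z -> fx p q z -> Dop p q f z = ci * f z.
Proof. by rewrite /Dop => -> ->. Qed.
Lemma Dop_up p q f z : Fz z -> ~~ fx p q z -> posr (z p) (z q) ->
  Dop p q f z = f (cj p q z) + th * f z.
Proof. by rewrite /Dop => -> /negPf-> ->. Qed.
Lemma Dop_dn p q f z : Fz z -> ~~ fx p q z -> ~~ posr (z p) (z q) ->
  Dop p q f z = f (cj p q z).
Proof. by rewrite /Dop => -> /negPf-> /negPf->. Qed.

Lemma Dop_ext p q f g : (forall z, Fz z -> Fz (cj p q z)) ->
  (forall z, Fz z -> f z = g z) -> Dop p q f = Dop p q g.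
Proof.
move=> HF H; apply: funext => z; rewrite /Dop; case: ifP => // Hz.
by rewrite !H // HF.
Qed.

Lemma Dop_lin p q f g (c : R) :
  Dop p q (fun z => f z + c * g z) = (fun z => Dop p q f z + c * Dop p q g z).
Proof.
apply: funext => z; rewrite /Dop; case: ifP => _; last by rewrite mulr0 addr0.
by case: ifP => _; [ring | case: ifP => _; ring].
Qed.

Lemma Dop_quad p q f z : Fz z -> simple N p q ->
  Dop p q (Dop p q f) z = f z + th * Dop p q f z.
Proof.
move=> Hz S; have D := simple_neq S; have Hc := Fz_cj Hz S.
have [F|F] := boolP (fx p q z); first by rewrite !Dop_fx // mulrA hci; ring.
have F' : ~~ fx p q (cj p q z) by rewrite fx_cj ?(Fz_BC Hz).
have [H|H] := boolP (posr (z p) (z q)).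
  by rewrite Dop_up // (Dop_dn f Hc F') ?cjK // (posr_cj Hz S F) H.
by rewrite !(Dop_dn _ Hz) // (Dop_up f Hc F') ?cjK // (posr_cj Hz S F).
Qed.

Lemma Dop_quad_in p q p' q' f : simple N p q -> simple N p' q' ->
  Dop p' q' (Dop p q (Dop p q f)) = Dop p' q' (fun z => f z + th * Dop p q f z).
Proof.
move=> S S'; apply: Dop_ext => z Hz; [exact: Fz_cj | exact: Dop_quad].
Qed.

(** * Braid relations *)

(* The three ways in which the reflections of two distinct simple roots interact:
   they commute, or generate a dihedral group of order 6 or 8. *)
Definition comm_roots p q p' q' := (refl p q p' == p') && (refl p q q' == q') ||
  (refl p q p' == q') && (refl p q q' == p').
Definition link3 p q r := (sval r == sval q + 1) &&
  ((sval p < 0) && (sval q == 1 - sval p) || (sval p == 1) && (sval q == 2)).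
Definition link4 p q := (sval p == 1) && (sval q == 2).

(** The linked cases are put in a form where the two roots share a point with opposite signs. In
    this form [s_i, s_(i+1)] and [s_(-1), s_2] are treated by one computation. *)
Lemma simple_cases p q p' q' : simple N p q -> simple N p' q' -> (p, q) <> (p', q') ->
  [\/ comm_roots p q p' q' && comm_roots p' q' p q,
      p' = neg q /\ link3 p q q', p = neg q' /\ link3 p' q' q
    | [/\ q = p, p' = neg p & link4 p q'] \/ [/\ q' = p', p = neg p' & link4 p' q]].
Proof.
move=> S S' D.
have {}D : ~~ ((sval p == sval p') && (sval q == sval q')).
  by apply/negP => /andP[/eqP/sval_inj E /eqP/sval_inj E']; apply: D; rewrite E E'.
have bp := sval_bnd p; have bq := sval_bnd q; have bp' := sval_bnd p'; have bq' := sval_bnd q'.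
have EQ x y : (x == y) = (sval x == sval y) by rewrite sval_eq.
have [H|H] := boolP (comm_roots p q p' q' && comm_roots p' q' p q); first by constructor 1.
have [/andP[/eqP H2 H2']|H2] := boolP ((p' == neg q) && link3 p q q'); first by constructor 2.
have [/andP[/eqP H3 H3']|H3] := boolP ((p == neg q') && link3 p' q' q); first by constructor 3.
have [/and3P[/eqP H4 /eqP H4' H4'']|H4] := boolP [&& q == p, p' == neg p & link4 p q'].
  by constructor 4; left.
have [/and3P[/eqP H5 /eqP H5' H5'']|H5] := boolP [&& q' == p', p == neg p' & link4 p' q].
  by constructor 4; right.
exfalso; move: H H2 H3 H4 H5; rewrite /comm_roots /link3 /link4 !EQ !sval_refl !sval_neg.
move: S S'; rewrite /simple_root.
move: (sval p) (sval q) (sval p') (sval q') D bp bq bp' bq' => a b c d.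
have nBD : ~~ (is_B t && is_D t) by rewrite /is_B /is_D; case: t.
move=> D bp bq bp' bq' /or3P[/and3P[h1 /eqP h2 _]|/and3P[h0 /eqP h1 /eqP h2]|/and3P[h0 /eqP h1 /eqP h2]]
  /or3P[/and3P[k1 /eqP k2 _]|/and3P[k0 /eqP k1 /eqP k2]|/and3P[k0 /eqP k1 /eqP k2]].
- have [E|[E|E]] : c = a - 1 \/ a = c - 1 \/ (c < a - 1 \/ a < c - 1).
  + by move: D; lia.
  + by subst => _ /negP[]; lia.
  + by subst => _ _ /negP[]; lia.
  + by move=> /negP[]; rewrite !rv_id ?eqxx //; lia.
- have [E|E] : a = -1 \/ a <> -1 by lia.
    by subst => _ _ _ _ /negP[]; lia.
  by move=> /negP[]; rewrite !rv_id ?eqxx //; lia.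
- have [E|E] : a = -1 \/ a <> -1 by lia.
    have R1 : rv a b c = d by rvlia.
    have R2 : rv a b d = c by rvlia.
    have R3 : rv c d a = b by rvlia.
    have R4 : rv c d b = a by rvlia.
    by rewrite R1 R2 R3 R4 !eqxx !orbT.
  have [E'|E'] : a = -2 \/ a <> -2 by lia.
    by subst => _ _ /negP[]; lia.
  by move=> /negP[]; rewrite !rv_id ?eqxx //; lia.
- have [E|E] : c = -1 \/ c <> -1 by lia.
    by subst => _ _ _ /negP[]; lia.
  by move=> /negP[]; rewrite !rv_id ?eqxx //; lia.
- by rewrite h1 h2 k1 k2 !eqxx in D.
- by move: nBD; rewrite h0 k0.
- have [E|E] : c = -1 \/ c <> -1 by lia.
    have R1 : rv a b c = d by rvlia.
    have R2 : rv a b d = c by rvlia.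
    have R3 : rv c d a = b by rvlia.
    have R4 : rv c d b = a by rvlia.
    by rewrite R1 R2 R3 R4 !eqxx !orbT.
  have [E'|E'] : c = -2 \/ c <> -2 by lia.
    by subst => _ /negP[]; lia.
  by move=> /negP[]; rewrite !rv_id ?eqxx //; lia.
- by move: nBD; rewrite h0 k0.
- by rewrite h1 h2 k1 k2 !eqxx in D.
Qed.

End Ops.

Section Braid.
Variables (n : nat) (t : ctype).
Hypothesis hn : (1 < n)%N.
Local Notation N := (n.*2).
Local Notation P := {perm pt N}.
Local Notation neg := (negp n).
Local Notation simple := (@simple_root n t).
Local Notation len := (lenG t n).
Local Notation Fz := (@fpf_inv n t).
Implicit Types (p q r x y : pt N) (w z : P).

Lemma same_rootM w x y p q : isBC n w ->
  same_root (w x) (w y) (w p) (w q) = same_root x y p q.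
Proof. by move=> /isBCP Bw; rewrite /same_root -!Bw !(inj_eq perm_inj). Qed.

Lemma Fz_svalC z x y : Fz z -> (sval (z x) == sval y) = (sval (z y) == sval x).
Proof. by move=> Hz; rewrite -!sval_eq (Fz_eqC Hz). Qed.
Lemma Fz_svalN z x y : Fz z -> (sval (z x) == - sval y) = (sval (z y) == - sval x).
Proof.
move=> Hz; rewrite -!sval_neg -!sval_eq (Fz_eqC Hz) (Fz_neg Hz).
by rewrite -(inj_eq (inv_inj (@negK n))) negK.
Qed.
Lemma Fz_sval z x : Fz z -> (sval (z x) != sval x) && (sval (z x) != - sval x).
Proof. by move=> Hz; rewrite -sval_neg -!sval_eq; exact: Fz_fpf Hz x. Qed.
Lemma Fz_svalI z x y : Fz z -> sval x != sval y -> sval x != - sval y ->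
  (sval (z x) != sval (z y)) && (sval (z x) != - sval (z y)).
Proof.
move=> Hz; rewrite -!sval_neg -!sval_eq -(Fz_neg Hz) !(inj_eq perm_inj) => -> ->.
by [].
Qed.

Lemma refl_np p q : q != neg p -> refl p q (neg p) = q.
Proof. by move=> H; rewrite (isBCP _ (isBC_refl p q)) refl_p // negK. Qed.
Lemma refl_nq p q : q != neg p -> refl p q (neg q) = p.
Proof. by move=> H; rewrite (isBCP _ (isBC_refl p q)) refl_q // negK. Qed.
Lemma refl_id p q x : sval x <> sval p -> sval x <> - sval q -> sval x <> - sval p ->
  sval x <> sval q -> refl p q x = x.
Proof. by move=> h1 h2 h3 h4; apply: sval_inj; rewrite sval_refl rv_id. Qed.

(** Absence of a strict ascent. Below, [dn] is a strict descent, where [D] is a mere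
    substitution. *)
Definition at_top p q z := fx p q z || ~~ posr (z p) (z q).
Definition dn p q z := ~~ fx p q z && ~~ posr (z p) (z q).

Lemma top_dn p q z : at_top p q z -> ~~ fx p q z -> dn p q z.
Proof. by rewrite /at_top /dn => /orP[-> //|->] ->. Qed.

(* Induction over an orbit of a rank two subgroup, starting from its top. *)
Lemma climb p q p' q' (Q : P -> Prop) : simple N p q -> simple N p' q' ->
  (forall z, Fz z -> ~~ fx p q z -> posr (z p) (z q) -> Q (cj p q z) -> Q z) ->
  (forall z, Fz z -> ~~ fx p' q' z -> posr (z p') (z q') -> Q (cj p' q' z) -> Q z) ->
  (forall z, Fz z -> at_top p q z -> at_top p' q' z -> Q z) ->
  forall z, Fz z -> Q z.
Proof.
move=> S S' H H' Ht z Hz; pose M := (\max_(v : P) len v)%N.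
have [k] := ubnP (M - len z)%N; elim: k z Hz => // k IH z Hz hk.
have le v : (len v <= M)%N by apply: leq_bigmax.
have [T1|] := boolP (at_top p q z); last first.
  rewrite /at_top negb_or negbK => /andP[F1 P1]; apply: H => //; apply: IH; first exact: Fz_cj.
  have := le (cj p q z); rewrite (len_cj_up hn Hz S) //; lia.
have [T2|] := boolP (at_top p' q' z); last first.
  rewrite /at_top negb_or negbK => /andP[F1 P1]; apply: H' => //; apply: IH; first exact: Fz_cj.
  have := le (cj p' q' z); rewrite (len_cj_up hn Hz S') //; lia.
exact: Ht.
Qed.

Variables (R : comNzRingType) (ci th : R).
Hypothesis hci : ci * ci = 1 + th * ci.
Local Notation D := (Dop t ci th).

Lemma D_dn p q f z : Fz z -> dn p q z -> D p q f z = f (cj p q z).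
Proof. by move=> Hz /andP[h1 h2]; rewrite Dop_dn. Qed.

Lemma D_cj p q f z : Fz z -> simple N p q -> ~~ fx p q z -> posr (z p) (z q) ->
  f z = D p q f (cj p q z).
Proof.
move=> Hz S F H; rewrite D_dn ?cjK ?Fz_cj //.
by rewrite /dn fx_cj ?(simple_neq S) ?(Fz_BC Hz) // F (posr_cj Hz S F) H.
Qed.

Lemma D_lin2 p q p' q' f g c : D p q (D p' q' (fun z => f z + c * g z)) =
  (fun z => D p q (D p' q' f) z + c * D p q (D p' q' g) z).
Proof. by rewrite !Dop_lin. Qed.
Lemma D_lin3 p q p' q' p'' q'' f g c : D p q (D p' q' (D p'' q'' (fun z => f z + c * g z))) =
  (fun z => D p q (D p' q' (D p'' q'' f)) z + c * D p q (D p' q' (D p'' q'' g)) z).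
Proof. by rewrite !Dop_lin. Qed.

Section Two.
Variables p q p' q' : pt N.
Hypotheses (S : simple N p q) (S' : simple N p' q').

(** At an ascent, a value at [z] is the value of [D p q] at the conjugate. The quadratic relation
    then reduces the claim to the relation at the conjugate, used once for [f] and once for
    [D p q f]. The versions for three and four letters are the same. *)
Lemma good2_step z : Fz z -> ~~ fx p q z -> posr (z p) (z q) ->
  (forall f, D p q (D p' q' f) (cj p q z) = D p' q' (D p q f) (cj p q z)) ->
  forall f, D p q (D p' q' f) z = D p' q' (D p q f) z.
Proof.
move=> Hz F H G f; have Hc := Fz_cj Hz S.
rewrite (D_cj (D p q (D p' q' f)) Hz S F H) (Dop_quad hci) //.
rewrite (D_cj (D p' q' (D p q f)) Hz S F H) (G (D p q f)) (Dop_quad_in hci) // Dop_lin.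
by rewrite G.
Qed.

Lemma good3_step z : Fz z -> ~~ fx p q z -> posr (z p) (z q) ->
  (forall f, D p q (D p' q' (D p q f)) (cj p q z) = D p' q' (D p q (D p' q' f)) (cj p q z)) ->
  forall f, D p q (D p' q' (D p q f)) z = D p' q' (D p q (D p' q' f)) z.
Proof.
move=> Hz F H G f; have Hc := Fz_cj Hz S.
rewrite (D_cj (D p q (D p' q' (D p q f))) Hz S F H) (Dop_quad hci) //.
rewrite (D_cj (D p' q' (D p q (D p' q' f))) Hz S F H) (G (D p' q' f)) (Dop_quad_in hci) // D_lin2.
by rewrite G.
Qed.

Lemma good4_step z : Fz z -> ~~ fx p q z -> posr (z p) (z q) ->
  (forall f, D p q (D p' q' (D p q (D p' q' f))) (cj p q z) =
             D p' q' (D p q (D p' q' (D p q f))) (cj p q z)) ->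
  forall f, D p q (D p' q' (D p q (D p' q' f))) z = D p' q' (D p q (D p' q' (D p q f))) z.
Proof.
move=> Hz F H G f; have Hc := Fz_cj Hz S.
rewrite (D_cj (D p q (D p' q' (D p q (D p' q' f)))) Hz S F H) (Dop_quad hci) //.
rewrite (D_cj (D p' q' (D p q (D p' q' (D p q f)))) Hz S F H) (G (D p q f)) (Dop_quad_in hci) // D_lin3.
by rewrite G.
Qed.
End Two.

Lemma comm_refl p q p' q' : comm_roots p q p' q' ->
  (refl p q * refl p' q' = refl p' q' * refl p q)%g.
Proof.
move=> C; rewrite (refl_conj p' q' (isBC_refl p q)).
by case/orP: C => /andP[/eqP-> /eqP->] //; congr (_ * _)%g; exact: refl_sym.
Qed.

Lemma posr_cj_comm z p q p' q' : Fz z -> simple N p q -> simple N p' q' ->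
  comm_roots p q p' q' -> ~~ same_root (z p') (z q') p q ->
  posr (cj p q z p') (cj p q z q') = posr (z p') (z q').
Proof.
move=> Hz S S' C H; rewrite !cjE.
have E : posr (refl p q (z p')) (refl p q (z q')) = posr (z p') (z q').
  by rewrite (simple_posr_refl S) // (Fz_root Hz S').
by case/orP: C => /andP[/eqP-> /eqP->]; [exact: E | rewrite posrC E].
Qed.

Lemma cj_same z p q p' q' : Fz z -> simple N p q -> simple N p' q' ->
  comm_roots p q p' q' -> same_root (z p') (z q') p q -> cj p q z = cj p' q' z.
Proof.
move=> Hz S S' C; rewrite -conj_refl ?(Fz_BC Hz) ?(simple_neq S) ?(simple_neq S') // => /eqP E.
have E' : (refl p q * z = z * refl p' q')%g.
  by apply: (@invg_inj _); rewrite !invMg !reflV (Fz_inv Hz) -E.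
by rewrite /cj E' E -!mulgA (comm_refl C).
Qed.

Lemma braid2 p q p' q' f : simple N p q -> simple N p' q' ->
  comm_roots p q p' q' -> comm_roots p' q' p q ->
  D p q (D p' q' f) = D p' q' (D p q f).
Proof.
move=> S S' C C'; apply: funext => z; have [Hz|/negPf Hz] := boolP (Fz z); last by rewrite /Dop Hz.
move: f; apply: (@climb p q p' q' (fun z => forall f, D p q (D p' q' f) z = D p' q' (D p q f) z)) (Hz) => // {}z {}Hz.
- exact: good2_step.
- by move=> F H G f; symmetry; apply: (good2_step S' S Hz F H) => g; symmetry; exact: G.
move=> T1 T2 f; have H1 := Fz_cj Hz S; have H2 := Fz_cj Hz S'.
have D1 := simple_neq S; have D2 := simple_neq S'; have Bz := Fz_BC Hz; have C2 := comm_refl C.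
have [F1|F1] := boolP (fx p q z); have [F2|F2] := boolP (fx p' q' z).
- by rewrite !Dop_fx // mulrCA.
- by have d2 := top_dn T2 F2; rewrite (D_dn _ Hz d2) (Dop_fx _ _ _ Hz F1) (Dop_fx _ _ _ H2) ?fx_cj // (D_dn _ Hz d2).
- by have d1 := top_dn T1 F1; rewrite (D_dn _ Hz d1) (Dop_fx _ _ _ Hz F2) (Dop_fx _ _ _ H1) ?fx_cj // (D_dn _ Hz d1).
have d1 := top_dn T1 F1; have d2 := top_dn T2 F2.
rewrite (D_dn _ Hz d1) (D_dn _ Hz d2).
have [E|E] := boolP (same_root (z p') (z q') p q).
  (* Here [z] conjugates one reflection to the other, so both lead to the same lower element, and
     from there either one leads back to [z]. *)
  have EC := cj_same Hz S S' C E; case/andP: d1 => _ d1; case/andP: d2 => _ d2.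
  rewrite (Dop_up _ _ _ H2) ?fx_cj //; last by rewrite -EC (posr_cj Hz S).
  rewrite (Dop_up _ _ _ H1) ?fx_cj //; last by rewrite EC (posr_cj Hz S').
  by rewrite {1}EC -{2}EC !cjK EC.
have E' : ~~ same_root (z p) (z q) p' q'.
  rewrite -conj_refl //; move: E; rewrite -conj_refl //; apply: contra => /eqP E.
  by apply/eqP/(@invg_inj _); rewrite !invMg !reflV (Fz_inv Hz) -E.
rewrite !D_dn // /dn ?fx_cj ?F1 ?F2 ?posr_cj_comm //; last first.
- by case/andP: d2.
- by case/andP: d1.
by rewrite /cj !mulgA -C2 -!mulgA C2.
Qed.

(** Otherwise [z] would match [p], up to sign, both with [q] and with [r]. *)
Lemma no_same_root z p q r : Fz z -> sval p != sval q -> sval p != - sval q ->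
  sval p != sval r -> sval p != - sval r -> sval q != sval r -> sval q != - sval r ->
  ~~ same_root (z p) (z r) p q.
Proof.
rewrite -!sval_neg -!sval_eq => Hz h1 h2 h3 h4 h5 h6; have /andP[f1 f2] := Fz_fpf Hz p.
have zrp : z r = p -> z p = r by move=> <-; exact: Fz_K Hz _.
have zrnp : z r = neg p -> z p = neg r.
  by move=> E; rewrite -[p]negK -E (Fz_neg Hz) (Fz_K Hz).
rewrite /same_root (negPf f1) (negPf f2) /=.
apply/norP; split; apply/andP => [[/eqP E1 /eqP E2]].
  by move: h5; rewrite -E1 (zrp E2) eqxx.
by move: h5; rewrite -(inj_eq (inv_inj (@negK n))) -E1 (zrnp E2) eqxx.
Qed.

Lemma fx_cases p q z : Fz z -> fx p q z ->
  (z p = q /\ z q = p) \/ (z p = neg q /\ z q = neg p).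
Proof.
move=> Hz; have /andP[f1 f2] := Fz_fpf Hz p.
rewrite /fx /same_root (negPf f1) (negPf f2) /=.
by case/orP => /andP[/eqP-> /eqP->]; [left | right].
Qed.

Lemma same_root_negl x y p q : same_root x y (neg p) (neg q) = same_root x y p q.
Proof.
rewrite /same_root !negK.
by do 4![case: (_ && _)].
Qed.

Lemma same_rootC x y p q : same_root y x p q = same_root x y p q.
Proof. by rewrite /same_root ![(y == _) && _]andbC; do 4![case: (_ && _)]. Qed.
Lemma same_rootC' x y p q : same_root x y q p = same_root x y p q.
Proof. by rewrite /same_root; do 4![case: (_ && _)]. Qed.

Section Three.
Variables p q r : pt N.
Hypotheses (S : simple N p q) (S' : simple N (neg q) r) (L : link3 p q r).
Local Notation s := (refl p q).
Local Notation s' := (refl (neg q) r).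

Let Lv : [/\ sval p != sval q, sval p != - sval q & sval p != sval r] /\
  [/\ sval p != - sval r, sval q != sval r & sval q != - sval r].
Proof. by have := sval_bnd p; have := sval_bnd q; have := L; rewrite /link3; do 2!split; lia. Qed.

Let D1 : q != neg p. Proof. exact: simple_neq S. Qed.
Let D2 : r != neg (neg q). Proof. exact: simple_neq S'. Qed.
Let sp : s p = neg q. Proof. exact: refl_p. Qed.
Let sq : s q = neg p. Proof. exact: refl_q. Qed.
Let snq : s (neg q) = p. Proof. exact: refl_nq. Qed.
Let sr : s r = r.
Proof. by apply: refl_id; case: Lv => [[? ? ?] [? ? ?]]; have := sval_bnd p; lia. Qed.
Let s'q : s' q = r. Proof. by rewrite -{2}(negK q) refl_np. Qed.
Let s'r : s' r = q. Proof. by rewrite refl_q // negK. Qed.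
Let s'p : s' p = p.
Proof. by apply: refl_id; rewrite ?sval_neg; case: Lv => [[? ? ?] [? ? ?]]; have := sval_bnd p; lia. Qed.

(** The root [(p, r)] is the sum of the two simple roots, so its image under [z] is negative if both
    of theirs are. The cases where [z] fixes one of them are settled by the matching of the points
    involved. *)
Lemma top3 z : Fz z -> at_top p q z -> at_top (neg q) r z ->
  [/\ ~~ posr (z p) (z r), ~~ same_root (z p) (z r) p r & ~~ (fx p q z && fx (neg q) r z)].
Proof.
move=> Hz T1 T2; case: (Lv) => [[h1 h2 h3] [h4 h5 h6]]; have := L; rewrite /link3 => Lk.
have sI x y : x = y -> sval x = sval y by move->.
have /andP[i1 i2] := Fz_svalI Hz h1 h2; have /andP[i3 i4] := Fz_svalI Hz h3 h4.
have /andP[i5 i6] := Fz_svalI Hz h5 h6.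
have /andP[f1 f2] := Fz_sval p Hz; have /andP[f3 f4] := Fz_sval q Hz.
have /andP[f5 f6] := Fz_sval r Hz.
have F1 : fx p q z \/ sval (z p) + sval (z q) <= 0.
  by case/orP: T1 => [|h]; [left | right; move: h; rewrite /posr -leNgt].
have F2 : fx (neg q) r z \/ sval (z r) <= sval (z q).
  case/orP: T2 => [|h]; [by left | right; move: h; rewrite /posr -leNgt (Fz_neg Hz) sval_neg; lia].
have N1 : fx p q z -> (sval (z p) = sval q /\ sval (z q) = sval p) \/
    (sval (z p) = - sval q /\ sval (z q) = - sval p).
  by case/(fx_cases Hz) => [[-> ->]|[-> ->]]; rewrite ?sval_neg; [left | right].
have N2 : fx (neg q) r z -> (sval (z q) = - sval r /\ sval (z r) = - sval q) \/
    (sval (z q) = sval r /\ sval (z r) = sval q).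
  move/(fx_cases Hz); rewrite (Fz_neg Hz).
  case => -[/(congr1 Defs.sval) + /(congr1 Defs.sval)]; rewrite !sval_neg => E1 E2; [left | right];
    by clear -E1 E2; lia.
have N12 : ~~ (fx p q z && fx (neg q) r z).
  apply/negP => /andP[/N1 K1 /N2 K2]; clear -K1 K2 h3 h4 h5 h6 Lk.
  by case: K1 => -[k1 k2]; case: K2 => -[k3 k4]; lia.
have N3 : same_root (z p) (z r) p r -> (sval (z p) = sval r /\ sval (z r) = sval p) \/
    (sval (z p) = - sval r /\ sval (z r) = - sval p).
  by case/(fx_cases Hz) => [[-> ->]|[-> ->]]; rewrite ?sval_neg; [left | right].
have Z3 : sval (z q) = sval p -> sval (z p) = sval q.
  by move/eqP; rewrite (Fz_svalC _ _ Hz) => /eqP.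
have Z4 : sval (z q) = - sval p -> sval (z p) = - sval q.
  by move/eqP; rewrite (Fz_svalN _ _ Hz) => /eqP.
clear T1 T2 sI; split=> //.
  rewrite /posr -leNgt.
  have /andP[br _] := sval_bnd (z r).
  case: F1 => [G1|F1]; case: F2 => [G2|F2].
  - by rewrite G1 G2 in N12.
  - by have := N1 G1; clear -F2 i5 i6 br Lk => K1; case: K1 => -[k1 k2]; lia.
  - by have := N2 G2; clear -F1 i1 i2 Lk => K1; case: K1 => -[k1 k2]; lia.
  - by clear -F1 F2; lia.
apply/negP => /N3 K3.
have Z1 : fx p q z -> False.
  move=> /N1 K1; clear -K1 K3 h3 h4 h5 h6 Lk.
  by case: K1 => -[k1 k2]; case: K3 => -[k3 k4]; lia.
have Z2 : fx (neg q) r z -> False.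
  move=> /N2 K1; clear -K1 K3 h1 h2 h3 h4 h5 h6 Lk.
  by case: K1 => -[k1 k2]; case: K3 => -[k3 k4]; lia.
case: F1 => [/Z1//|F1]; case: F2 => [/Z2//|F2].
have E1 : sval (z q) <> sval p.
  move=> E; have := Z3 E; clear -K3 h3 h4 h5 h6; case: K3 => -[k3 k4]; lia.
have E2 : sval (z q) <> - sval p.
  move=> E; have := Z4 E; clear -K3 h3 h4 h5 h6; case: K3 => -[k3 k4]; lia.
have /andP[bq _] := sval_bnd (z q).
by clear -F1 F2 E1 E2 f3 i2 bq Lk K3; case: K3 => -[k3 k4]; lia.
Qed.

Lemma cj_braid z : cj p q (cj (neg q) r (cj p q z)) = cj (neg q) r (cj p q (cj (neg q) r z)).
Proof.
have E : (s * s' * s = s' * s * s')%g.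
  have -> : (s * s' * s = refl p r)%g.
    by rewrite -mulgA (refl_conj _ _ (isBC_refl p q)) snq sr mulgA refl2 mul1g.
  rewrite -mulgA (refl_conj _ _ (isBC_refl (neg q) r)) s'p s'q mulgA refl2 mul1g.
  by [].
have E' v : (s * (s' * (s * v)) = s' * (s * (s' * v)))%g by rewrite !mulgA E.
have E2 : (s * (s' * s) = s' * (s * s'))%g by rewrite !mulgA.
by rewrite /cj -!mulgA E' E2.
Qed.

(** From a top element every letter of either word is a descent or, at most once, the scalar [ci];
    both sides become a multiple of [f] at a common point. *)
Lemma braid3 f : D p q (D (neg q) r (D p q f)) = D (neg q) r (D p q (D (neg q) r f)).
Proof.
apply: funext => z; have [Hz|/negPf Hz] := boolP (Fz z); last by rewrite /Dop Hz.
move: f; apply: (climb S S' (Q := fun z => forall f, D p q (D (neg q) r (D p q f)) z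
   = D (neg q) r (D p q (D (neg q) r f)) z)) Hz => {}z {}Hz.
- exact: good3_step.
- by move=> F H G f; symmetry; apply: (good3_step S' S Hz F H) => g; symmetry; exact: G.
move=> T1 T2 f; have H1 := Fz_cj Hz S; have H2 := Fz_cj Hz S'.
have H12 := Fz_cj H1 S'; have H21 := Fz_cj H2 S.
have Bz := Fz_BC Hz; have [Q1 Q2 Q3] := top3 Hz T1 T2.
have Bs := isBC_refl p q; have Bs' := isBC_refl (neg q) r.
case: Lv => [[l1 l2 l3] [l4 l5 l6]].
have PH (x y : pt N) : isroot t (z x) (z y) = isroot t x y by rewrite PhiM.
have Ppr : isroot t p r.
  rewrite /isroot !sval_eq sval_neg.
  by apply/andP; split; [clear -l4; lia | apply/orP; right; clear -l3; lia].
(* Along the two paths down from [z], the second letter tests the third root [(p, r)] and the last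
   letter tests the simple root that the path did not begin with. *)
have X1 : fx (neg q) r (cj p q z) = same_root (z p) (z r) p r.
  by rewrite /fx !cjE snq sr -[RHS](same_rootM _ _ _ _ Bs) sp sr.
have X2 : fx p q (cj (neg q) r z) = same_root (z p) (z r) p r.
  by rewrite /fx !cjE s'p s'q -[RHS](same_rootM _ _ _ _ Bs') s'p s'r.
have X3 : fx p q (cj (neg q) r (cj p q z)) = fx (neg q) r z.
  rewrite /fx !cjE s'p s'q sp sr -[RHS](same_rootM _ _ _ _ Bs) -[RHS](same_rootM _ _ _ _ Bs').
  by rewrite snq sr s'p s'r.
have X4 : fx (neg q) r (cj p q (cj (neg q) r z)) = fx p q z.
  rewrite /fx !cjE snq sr s'p s'r -[RHS](same_rootM _ _ _ _ Bs') -[RHS](same_rootM _ _ _ _ Bs).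
  by rewrite s'p s'q sp sr.
have NR1 := no_same_root Hz l1 l2 l3 l4 l5 l6.
have NR2 : ~~ same_root (z p) (z r) (neg q) r.
  rewrite same_rootC same_rootC'; apply: no_same_root => //; rewrite ?sval_neg; clear -l1 l2 l3 l4 l5 l6; lia.
have Y1 : ~~ posr (cj p q z (neg q)) (cj p q z r).
  by rewrite !cjE snq sr (simple_posr_refl S) // PH.
have Y2 : ~~ posr (cj (neg q) r z p) (cj (neg q) r z q).
  by rewrite !cjE s'p s'q (simple_posr_refl S') // PH.
have Y3 : ~~ posr (z (neg q)) (z r) ->
    ~~ posr (cj (neg q) r (cj p q z) p) (cj (neg q) r (cj p q z) q).
  move=> h; rewrite !cjE s'p s'q sp sr (simple_posr_refl S').
  - rewrite (simple_posr_refl S) ?PH ?(simple_Phi S') //.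
    rewrite -same_root_negl -same_rootC' ; apply: no_same_root => //; rewrite ?sval_neg ?opprK; clear -l1 l2 l3 l4 l5 l6; lia.
  - by rewrite PhiM // PH (simple_Phi S').
  - have -> : same_root (s (z (neg q))) (s (z r)) (neg q) r = same_root (z (neg q)) (z r) p r.
      by rewrite -[RHS](same_rootM _ _ _ _ Bs) sp sr.
    rewrite same_rootC same_rootC'.
    apply: no_same_root => //; rewrite ?sval_neg; clear -l1 l2 l3 l4 l5 l6; lia.
have Y4 : ~~ posr (z p) (z q) ->
    ~~ posr (cj p q (cj (neg q) r z) (neg q)) (cj p q (cj (neg q) r z) r).
  move=> h; rewrite !cjE snq sr s'p s'r (simple_posr_refl S).
  - rewrite (simple_posr_refl S') ?PH ?(simple_Phi S) //.
    rewrite -same_root_negl negK same_rootC; apply: no_same_root => //; rewrite ?sval_neg ?opprK; clear -l1 l2 l3 l4 l5 l6; lia.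
  - by rewrite PhiM // PH (simple_Phi S).
  - have -> : same_root (s' (z p)) (s' (z q)) p q = same_root (z p) (z q) p r.
      by rewrite -[RHS](same_rootM _ _ _ _ Bs') s'p s'r.
    apply: no_same_root => //; clear -l1 l2 l3 l4 l5 l6; lia.
have d1 : dn (neg q) r (cj p q z) by rewrite /dn X1 Q2 Y1.
have d2 : dn p q (cj (neg q) r z) by rewrite /dn X2 Q2 Y2.
have [F1|F1] := boolP (fx p q z); have [F2|F2] := boolP (fx (neg q) r z).
- by rewrite F1 F2 in Q3.
- have e2 := top_dn T2 F2; rewrite (Dop_fx _ _ _ Hz F1) !(D_dn _ Hz e2) !(D_dn _ H2 d2).
  by rewrite (Dop_fx _ _ _ H21) // X4.
- have e1 := top_dn T1 F1; rewrite (Dop_fx _ _ _ Hz F2) !(D_dn _ Hz e1) !(D_dn _ H1 d1).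
  by rewrite (Dop_fx _ _ _ H12) // X3.
have e1 := top_dn T1 F1; have e2 := top_dn T2 F2.
rewrite (D_dn _ Hz e1) (D_dn _ Hz e2) (D_dn _ H1 d1) (D_dn _ H2 d2).
case/andP: e1 => _ e1; case/andP: e2 => _ e2.
rewrite !D_dn //; first by rewrite cj_braid.
  by rewrite /dn X4 F1 Y4.
by rewrite /dn X3 F2 Y3.
Qed.
End Three.

End Braid.

(** * Operators attached to group elements *)

Section Matsumoto.
Variables (n : nat) (t : ctype).
Hypothesis hn : (1 < n)%N.
Local Notation N := (n.*2).
Local Notation P := {perm pt N}.
Local Notation neg := (negp n).
Local Notation simple := (@simple_root n t).
Local Notation len := (lenG t n).
Local Notation Fz := (@fpf_inv n t).
Local Notation WG := (@weyl n t).
Implicit Types (p q r x y : pt N) (w z : P).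
Variables (R : comNzRingType) (ci th : R).
Hypothesis hci : ci * ci = 1 + th * ci.
Local Notation D := (Dop t ci th).

Section Four.
Variables p q : pt N.
Hypotheses (S : simple N p p) (S' : simple N (neg p) q) (L : link4 p q).
Local Notation s := (refl p p).
Local Notation s' := (refl (neg p) q).

Let v1 : sval p = 1. Proof. by case/andP: L => /eqP. Qed.
Let v2 : sval q = 2. Proof. by case/andP: L => _ /eqP. Qed.
Let sp : s p = neg p. Proof. exact: refl_p (simple_neq S). Qed.
Let snp : s (neg p) = p. Proof. exact: refl_np (simple_neq S). Qed.
Let sq : s q = q. Proof. by apply: refl_id; rewrite v1 v2. Qed.
Let s'p : s' p = q. Proof. by rewrite -{2}(negK p) (refl_np (simple_neq S')). Qed.
Let s'q : s' q = p. Proof. by rewrite (refl_q (simple_neq S')) negK. Qed.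

Lemma fx_pp z : Fz z -> ~~ fx p p z.
Proof.
move=> Hz; have /andP[/negPf f1 /negPf f2] := Fz_fpf Hz p.
by rewrite /fx /same_root f1 f2.
Qed.

Lemma braid4_conj z : cj p p (cj (neg p) q (cj p p (cj (neg p) q z))) =
  cj (neg p) q (cj p p (cj (neg p) q (cj p p z))).
Proof.
have E : (s * (s' * (s * s')) = s' * (s * (s' * s)))%g.
  have C : (s * refl q q = refl q q * s)%g by rewrite (refl_conj _ _ (isBC_refl p p)) sq.
  have -> : (s' * (s * (s' * s)) = refl q q * s)%g.
    by rewrite !mulgA; congr (_ * _)%g; rewrite -mulgA (refl_conj _ _ (isBC_refl (neg p) q)) s'p mulgA refl2 mul1g.
  rewrite -C; congr (_ * _)%g.
  by rewrite (refl_conj _ _ (isBC_refl (neg p) q)) s'p mulgA refl2 mul1g.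
have E' v : (s * (s' * (s * (s' * v))) = s' * (s * (s' * (s * v))))%g.
  by have := congr1 (fun u => u * v)%g E; rewrite -!mulgA.
by rewrite /cj -!mulgA E' -E.
Qed.

Lemma braid4 f : D p p (D (neg p) q (D p p (D (neg p) q f))) =
  D (neg p) q (D p p (D (neg p) q (D p p f))).
Proof.
apply: funext => z; have [Hz|/negPf Hz] := boolP (Fz z); last by rewrite /Dop Hz.
move: f; apply: (climb hn S S' (Q := fun z => forall f,
   D p p (D (neg p) q (D p p (D (neg p) q f))) z =
   D (neg p) q (D p p (D (neg p) q (D p p f))) z)) Hz => {}z {}Hz.
- exact: good4_step.
- by move=> F H G f; symmetry; apply: (good4_step hci S' S Hz F H) => g; symmetry; exact: G.
move=> T1 T2 f; have H1 := Fz_cj Hz S; have H2 := Fz_cj Hz S'.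
have d1 := top_dn T1 (fx_pp Hz).
have [F2|F2] := boolP (fx (neg p) q z).
  (* Here [z] matches [p] with [q] up to sign, and so does [cj p p z]; the whole computation stays
     within these two elements. *)
  have F3 : fx (neg p) q (cj p p z).
    rewrite /fx !cjE snp sq; have : same_root (s (z p)) (s (z q)) (s p) (s q).
      rewrite same_rootM ?isBC_refl //.
      case/(fx_cases Hz): F2; rewrite (Fz_neg Hz) => -[E1 E2].
        have -> : z p = neg q by rewrite -E1 negK.
        by rewrite E2 /same_root !eqxx !orbT.
      have -> : z p = q by apply: (inv_inj (@negK n)).
      by rewrite E2 negK /same_root !eqxx !orbT.
    by rewrite sp sq.
  have U : posr (cj p p z p) (cj p p z p).
    by rewrite (posr_cj Hz S (fx_pp Hz)); case/andP: d1.
  rewrite (D_dn _ _ _ Hz d1) (Dop_fx _ _ _ Hz F2) (Dop_fx _ _ _ H1 F3).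
  rewrite (Dop_up _ _ _ H1 (fx_pp H1) U) (D_dn _ _ _ Hz d1) cjK.
  rewrite (Dop_fx _ _ _ Hz F2) !(Dop_fx _ _ _ H1 F3).
  rewrite (Dop_up _ _ _ H1 (fx_pp H1) U) cjK; ring.
have d2 := top_dn T2 F2.
(* In the remaining case [z p] and [z q] turn out to lie below -2, out of reach of both reflections,
   and both words are chains of four descents. *)
have /andP[f1 f2] := Fz_sval p Hz; have /andP[f3 f4] := Fz_sval q Hz.
have a0 : sval (z p) < 0.
  by case/andP: d1 => _; rewrite /posr -leNgt; have := sval_bnd (z p); clear; lia.
have ba : sval (z q) < sval (z p).
  case/andP: d2 => _; rewrite /posr -leNgt (Fz_neg Hz) sval_neg.
  have : sval (z q) != sval (z p) by rewrite -sval_eq (inj_eq perm_inj) sval_eq v1 v2.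
  clear; lia.
have an2 : sval (z p) <> -2.
  move=> E; move/negP: F2; apply; rewrite /fx (Fz_neg Hz).
  have -> : z p = neg q by apply: sval_inj; rewrite sval_neg v2.
  have -> : z q = neg p.
    have := Fz_svalN p q Hz; rewrite E v2 eqxx => /esym /eqP; rewrite -sval_neg; exact: sval_inj.
  by rewrite negK /same_root !eqxx !orbT.
have an1 : sval (z p) <> -1 by move: f2; rewrite v1 => /eqP.
have sid x : sval x < -2 -> s x = x by move=> h; apply: refl_id; rewrite v1; clear -h; lia.
have s'id x : sval x < -2 -> s' x = x.
  by move=> h; apply: refl_id; rewrite ?sval_neg ?v1 ?v2; clear -h; lia.
have ap : sval (z p) < -2 by clear -a0 an1 an2; lia.
have bq : sval (z q) < -2 by clear -ap ba; lia.
have H21 := Fz_cj H2 S; have H12 := Fz_cj H1 S'.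
have H212 := Fz_cj H21 S'; have H121 := Fz_cj H12 S.
have dI z' x y : z' (neg p) = x -> z' q = y -> sval x < -2 -> sval x + sval y < 0 ->
    dn (neg p) q z'.
  move=> h1 h2 h3 h4; rewrite /dn /fx h1 h2 /same_root /posr !sval_eq !sval_neg v1 v2 -leNgt.
  by clear -h3 h4; lia.
have dI' z' x : Fz z' -> z' p = x -> sval x < -2 -> dn p p z'.
  by move=> h1 h2 h3; rewrite /dn fx_pp // h2 /posr -leNgt; clear -h3; lia.
have ns'id x : sval x < -2 -> s' (neg x) = neg x.
  by move=> h; rewrite (isBCP _ (isBC_refl (neg p) q)) s'id.
have nsid x : sval x < -2 -> s (neg x) = neg x by move=> h; rewrite (isBCP _ (isBC_refl p p)) sid.
have e1 : dn (neg p) q (cj p p z).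
  apply: (dI _ (z p) (z q)) => //; [by rewrite cjE snp sid | by rewrite cjE sq sid | clear -ap bq; lia].
have e2 : dn p p (cj (neg p) q (cj p p z)).
  by apply: (dI' _ (z q)) => //; rewrite !cjE s'p sq sid ?s'id.
have e3 : dn (neg p) q (cj p p (cj (neg p) q (cj p p z))).
  apply: (dI _ (z q) (neg (z p))) => //; last by rewrite sval_neg; clear -ba; lia.
    by rewrite !cjE snp s'p sq sid ?s'id ?sid.
  by rewrite !cjE sq s'q sp (Fz_neg Hz) nsid ?ns'id ?nsid.
have g1 : dn p p (cj (neg p) q z) by apply: (dI' _ (z q)) => //; rewrite !cjE s'p s'id.
have g2 : dn (neg p) q (cj p p (cj (neg p) q z)).
  apply: (dI _ (z q) (z p)) => //; last by clear -ap bq; lia.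
    by rewrite !cjE snp s'p s'id ?sid.
  by rewrite !cjE sq s'q s'id ?sid.
have g3 : dn p p (cj (neg p) q (cj p p (cj (neg p) q z))).
  by apply: (dI' _ (z p)) => //; rewrite !cjE s'p sq s'q s'id ?sid ?s'id.
rewrite (D_dn _ _ _ Hz d1) (D_dn _ _ _ H1 e1) (D_dn _ _ _ H12 e2) (D_dn _ _ _ H121 e3).
rewrite (D_dn _ _ _ Hz d2) (D_dn _ _ _ H2 g1) (D_dn _ _ _ H21 g2) (D_dn _ _ _ H212 g3).
by rewrite braid4_conj.
Qed.
End Four.

Definition desc w (a : pt N * pt N) := simple N a.1 a.2 && ~~ posr (w a.1) (w a.2).

(* [Tk k w] composes the operators [D] along a reduced word of [w], if [k] is the
   length of [w]; by the braid relations the choices made do not matter. *)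
Fixpoint Tk k w (f : P -> R) : P -> R :=
  if k is k'.+1 then
    if [pick a | desc w a] is Some a then
      Tk k' (refl a.1 a.2 * w)%g (D a.1 a.2 f)
    else f
  else f.
Definition Tw w := Tk (len w) w.

Lemma T1 f : Tw 1 f = f. Proof. by rewrite /Tw len1. Qed.

Lemma T_pick w f : WG w -> (exists a, desc w a) ->
  exists2 a, desc w a & Tw w f = Tw (refl a.1 a.2 * w)%g (D a.1 a.2 f).
Proof.
move=> W [a0 H0]; rewrite {1}/Tw; case/andP: (H0) => S0 P0.
rewrite (len_dn hn S0 W P0) /=; case: pickP => [a Ha|/(_ a0)]; last by rewrite H0.
exists a => //; case/andP: Ha => Sa Pa; rewrite /Tw.
by have := len_dn hn S0 W P0; rewrite (len_dn hn Sa W Pa) => -[->].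
Qed.

Lemma link3_refl p q r : link3 p q r ->
  [/\ refl p q (neg q) = p, refl p q r = r, refl (neg q) r p = p,
      refl (neg q) r q = r & refl (neg q) r r = q] /\
  [/\ refl p q p = neg q, refl p q q = neg p, refl p q \o refl (neg q) r \o refl p q =1
    refl (neg q) r \o refl p q \o refl (neg q) r,
    (refl p q * refl (neg q) r * refl p q = refl (neg q) r * refl p q * refl (neg q) r)%g & q != neg p].
Proof.
rewrite /link3 => L; have /andP[b1 _] := sval_bnd p; have /andP[b2 _] := sval_bnd q.
have D1 : q != neg p by rewrite sval_eq sval_neg; clear -L b1 b2; lia.
have D2 : r != neg (neg q) by rewrite negK sval_eq; clear -L b1 b2; lia.
have e1 := refl_nq D1; have e2 : refl p q r = r by apply: refl_id; clear -L b1 b2; lia.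
have e3 : refl (neg q) r p = p by apply: refl_id; rewrite ?sval_neg; clear -L b1 b2; lia.
have e4 : refl (neg q) r q = r by rewrite -{2}(negK q) (refl_np D2).
have e5 : refl (neg q) r r = q by rewrite (refl_q D2) negK.
have E : (refl p q * refl (neg q) r * refl p q = refl (neg q) r * refl p q * refl (neg q) r)%g.
  have -> : (refl p q * refl (neg q) r * refl p q = refl p r)%g.
    by rewrite -mulgA (refl_conj _ _ (isBC_refl p q)) e1 e2 mulgA refl2 mul1g.
  by rewrite -mulgA (refl_conj _ _ (isBC_refl (neg q) r)) e3 e4 mulgA refl2 mul1g.
split; split=> //; [exact: refl_p | exact: refl_q |].
by move=> x /=; have := congr1 (fun u : P => u x) E; rewrite !permM.
Qed.

Section Dihedral.
Variable w : P.
Hypothesis W : WG w.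
Hypothesis IH : forall v a g, (len v < len w)%N -> WG v -> desc v a ->
     Tw v g = Tw (refl a.1 a.2 * v)%g (D a.1 a.2 g).

Let sneg x : sval (w (neg x)) = - sval (w x).
Proof. by rewrite (isBCP _ (WG_BC W)) sval_neg. Qed.

Let step v a : (len v < len w)%N -> WG v -> simple N a.1 a.2 -> ~~ posr (v a.1) (v a.2) ->
    [/\ (len (refl a.1 a.2 * v)%g < len w)%N, WG (refl a.1 a.2 * v)%g &
      forall g, Tw v g = Tw (refl a.1 a.2 * v)%g (D a.1 a.2 g)].
Proof.
move=> h Wv Sa Pa; split; last by move=> g; apply: IH; rewrite // /desc Sa.
  by have := len_dn hn Sa Wv Pa; move: h; clear; lia.
by apply: WGM => //; apply: WG_refl Sa.
Qed.

Let first a : desc w a -> [/\ (len (refl a.1 a.2 * w)%g < len w)%N, WG (refl a.1 a.2 * w)%g,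
  simple N a.1 a.2 & sval (w a.1) + sval (w a.2) <= 0].
Proof.
move=> /andP[S P0]; split=> //; last by rewrite leNgt.
  by rewrite (len_dn hn S W P0).
by apply: WGM => //; apply: WG_refl S.
Qed.

(** An element with both descents can be shortened by the longest element of the dihedral group
    along either of its two reduced words. [IH] peels off the letters after the first, and the braid
    relation compares the two results. *)
Lemma dihedral2 p q p' q' f : desc w (p, q) -> desc w (p', q') ->
  comm_roots p q p' q' -> comm_roots p' q' p q ->
  Tw (refl p q * w)%g (D p q f) = Tw (refl p' q' * w)%g (D p' q' f).
Proof.
move=> d1 d2 C C'; have [/= l1 W1 S1 _] := first d1; have [/= l2 W2 S2 _] := first d2.
have P1 : ~~ posr ((refl p q * w)%g p') ((refl p q * w)%g q').
  have /andP[_ /= h] := d2; rewrite !permM.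
  by case/orP: C => /andP[/eqP-> /eqP->] //; rewrite posrC.
have P2 : ~~ posr ((refl p' q' * w)%g p) ((refl p' q' * w)%g q).
  have /andP[_ /= h] := d1; rewrite !permM.
  by case/orP: C' => /andP[/eqP-> /eqP->] //; rewrite posrC.
have [_ _ ->] := @step _ (p', q') l1 W1 S2 P1.
have [_ _ ->] := @step _ (p, q) l2 W2 S1 P2.
by rewrite /= !mulgA (comm_refl C) (braid2 hn hci) .
Qed.

Lemma dihedral3 p q r f : desc w (p, q) -> desc w (neg q, r) -> link3 p q r ->
  Tw (refl p q * w)%g (D p q f) = Tw (refl (neg q) r * w)%g (D (neg q) r f).
Proof.
move=> d1 d2 L; have [/= l1 W1 S1 u1] := first d1; have [/= l2 W2 S2 u2] := first d2.
have [[e1 e2 e3 e4 e5] [e6 e7 _ E _]] := link3_refl L; rewrite sneg in u2.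
have P1 : ~~ posr ((refl p q * w)%g (neg q)) ((refl p q * w)%g r).
  by rewrite !permM e1 e2 /posr -leNgt; clear -u1 u2; lia.
have [l3 W3 ->] := @step _ (neg q, r) l1 W1 S2 P1; rewrite /= in l3 W3 *.
have P2 : ~~ posr ((refl (neg q) r * w)%g p) ((refl (neg q) r * w)%g q).
  by rewrite !permM e3 e4 /posr -leNgt; clear -u1 u2; lia.
have [l4 W4 ->] := @step _ (p, q) l2 W2 S1 P2; rewrite /= in l4 W4 *.
have P3 : ~~ posr ((refl (neg q) r * (refl p q * w))%g p) ((refl (neg q) r * (refl p q * w))%g q).
  by rewrite !permM e3 e4 e2 e6 /posr sneg -leNgt; clear -u1 u2; lia.
have [_ _ ->] := @step _ (p, q) l3 W3 S1 P3.
have P4 : ~~ posr ((refl p q * (refl (neg q) r * w))%g (neg q)) ((refl p q * (refl (neg q) r * w))%g r).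
  by rewrite !permM e1 e2 e3 e5 /posr -leNgt; clear -u1 u2; lia.
have [_ _ ->] := @step _ (neg q, r) l4 W4 S2 P4.
by rewrite /= !mulgA E (braid3 hn hci S1 S2 L).
Qed.

Lemma dihedral4 p q f : desc w (p, p) -> desc w (neg p, q) -> link4 p q ->
  Tw (refl p p * w)%g (D p p f) = Tw (refl (neg p) q * w)%g (D (neg p) q f).
Proof.
move=> d1 d2 L; have [/= l1 W1 S1 u1] := first d1; have [/= l2 W2 S2 u2] := first d2.
case/andP: (L) => /eqP v1 /eqP v2; rewrite sneg in u2.
have e1 : refl p p p = neg p := refl_p (simple_neq S1).
have e2 : refl p p (neg p) = p := refl_np (simple_neq S1).
have e3 : refl p p q = q by apply: refl_id; rewrite v1 v2.
have e4 : refl (neg p) q p = q by rewrite -{2}(negK p) (refl_np (simple_neq S2)).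
have e5 : refl (neg p) q q = p by rewrite (refl_q (simple_neq S2)) negK.
have e6 : refl (neg p) q (neg p) = neg q := refl_p (simple_neq S2).
have P1 : ~~ posr ((refl p p * w)%g (neg p)) ((refl p p * w)%g q).
  by rewrite !permM e2 e3 /posr -leNgt; clear -u1 u2; lia.
have [l3 W3 ->] := @step _ (neg p, q) l1 W1 S2 P1; rewrite /= in l3 W3 *.
have P2 : ~~ posr ((refl (neg p) q * w)%g p) ((refl (neg p) q * w)%g p).
  by rewrite !permM e4 /posr -leNgt; clear -u1 u2; lia.
have [l4 W4 ->] := @step _ (p, p) l2 W2 S1 P2; rewrite /= in l4 W4 *.
have P3 : ~~ posr ((refl (neg p) q * (refl p p * w))%g p) ((refl (neg p) q * (refl p p * w))%g p).
  by rewrite !permM e4 e3 /posr -leNgt; clear -u1 u2; lia.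
have [l5 W5 ->] := @step _ (p, p) l3 W3 S1 P3; rewrite /= in l5 W5 *.
have P4 : ~~ posr ((refl p p * (refl (neg p) q * w))%g (neg p)) ((refl p p * (refl (neg p) q * w))%g q).
  by rewrite !permM e2 e3 e4 e5 /posr -leNgt; clear -u1 u2; lia.
have [l6 W6 ->] := @step _ (neg p, q) l4 W4 S2 P4; rewrite /= in l6 W6 *.
have P5 : ~~ posr ((refl p p * (refl (neg p) q * (refl p p * w)))%g (neg p))
    ((refl p p * (refl (neg p) q * (refl p p * w)))%g q).
  by rewrite !permM e2 e3 e4 e5 e3 e1 /posr sneg -leNgt; clear -u1 u2; lia.
have [_ _ ->] := @step _ (neg p, q) l5 W5 S2 P5.
have P6 : ~~ posr ((refl (neg p) q * (refl p p * (refl (neg p) q * w)))%g p)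
    ((refl (neg p) q * (refl p p * (refl (neg p) q * w)))%g p).
  by rewrite !permM e4 e3 e5 /posr -leNgt; clear -u1 u2; lia.
have [_ _ ->] := @step _ (p, p) l6 W6 S1 P6.
have E : (refl p p * refl (neg p) q * refl p p * refl (neg p) q =
  refl (neg p) q * refl p p * refl (neg p) q * refl p p)%g.
  have C : (refl p p * refl q q = refl q q * refl p p)%g.
    by rewrite (refl_conj _ _ (isBC_refl p p)) e3.
  have F : (refl (neg p) q * refl p p * refl (neg p) q = refl q q)%g.
    by rewrite -mulgA (refl_conj _ _ (isBC_refl (neg p) q)) e4 mulgA refl2 mul1g.
  by rewrite F -C -F !mulgA.
by rewrite /= !mulgA E (braid4 S1 S2 L).
Qed.
End Dihedral.

(** The argument of Matsumoto's theorem, by induction on the length: the descent picked by [Tk] and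
    the given one generate a dihedral group. *)
Lemma T_desc w p q f : WG w -> simple N p q -> ~~ posr (w p) (w q) ->
  Tw w f = Tw (refl p q * w)%g (D p q f).
Proof.
move=> W S P0; have [k] := ubnP (len w); elim: k w p q f W S P0 => // k IHk w p q f W S P0 hk.
have d1 : desc w (p, q) by rewrite /desc S.
have ex : exists a, desc w a by exists (p, q).
have [[p' q'] d2 ->] := T_pick f W ex.
have IH v a g : (len v < len w)%N -> WG v -> desc v a ->
     Tw v g = Tw (refl a.1 a.2 * v)%g (D a.1 a.2 g).
  move=> h Wv /andP[Sa Pa]; apply: IHk => //; exact: leq_trans h _.
have [E|/eqP NE] := eqVneq (p, q) (p', q'); first by case: E => <- <-.
have /andP[/= S' _] := d2.
case: (simple_cases hn S S' NE) => [/andP[C C']|[E L]|[E L]|[[E1 E2 L]|[E1 E2 L]]] /=.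
- exact: (dihedral2 W IH _ d2 d1 C' C).
- by subst p'; symmetry; apply: (dihedral3 W IH).
- by subst p; apply: (dihedral3 W IH).
- by subst q p'; symmetry; apply: (dihedral4 W IH).
- by subst q' p; apply: (dihedral4 W IH).
Qed.

Lemma T_up w p q f : WG w -> simple N p q -> posr (w p) (w q) ->
  Tw (refl p q * w)%g f = Tw w (D p q f).
Proof.
move=> W S H; have D1 := simple_neq S.
rewrite (T_desc f (WGM (WG_refl S) W) S) ?mulgA ?refl2 ?mul1g //.
rewrite !permM refl_p // refl_q // !(isBCP _ (WG_BC W)) posrC posr_neg ?negbK //.
by apply: root_neq => //; exact: WG_BC W.
Qed.

(** The new letter sits at the opposite end of the word, so the induction removes a descent [(x, y)]
    from the other end. Comparing lengths shows that [(x, y)] stays a descent and [(p, q)] an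
    ascent. *)
Lemma T_upl w p q f : WG w -> simple N p q -> posr (w^-1%g p) (w^-1%g q) ->
  Tw (w * refl p q)%g f = D p q (Tw w f).
Proof.
have [k] := ubnP (len w); elim: k w f => // k IH w f hk W S H.
have [E|E] := eqVneq w 1%g.
  move: H; rewrite E mul1g invg1 !perm1 T1 => H.
  by rewrite -[refl p q]mulg1 T_up ?T1 ?perm1 //; apply: WG1.
have [x [y [Sx Hxy]]] := descent_ex hn W E; have Ws := WG_refl S; have Wx := WG_refl Sx.
have lw := len_dn hn Sx W (negbT Hxy); have lu := len_upl hn S W H.
have W' : WG (refl x y * w)%g by apply: WGM.
have Wr : WG (w * refl p q)%g by apply: WGM.
have Wr' : WG (refl x y * w * refl p q)%g by apply: WGM.
have Px : ~~ posr ((w * refl p q)%g x) ((w * refl p q)%g y).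
  apply/negP => h; have := len_up hn Sx Wr h; rewrite lu mulgA.
  have [h'|h'] := boolP (posr ((refl x y * w)^-1%g p) ((refl x y * w)^-1%g q)).
    by rewrite (len_upl hn S W' h') lw; move: (len (refl x y * w)%g) (len (refl x y * w * refl p q)%g) => A B; clear; lia.
  have := len_dnl hn S W' h'; rewrite lw; move: (len (refl x y * w)%g) (len (refl x y * w * refl p q)%g) => A B; clear; lia.
have H' : posr ((refl x y * w)^-1%g p) ((refl x y * w)^-1%g q).
  apply/negPn/negP => h'; have := len_dnl hn S W' h'; have := len_dn hn Sx Wr Px.
  by rewrite lu mulgA lw; move: (len (refl x y * w)%g) (len (refl x y * w * refl p q)%g) => A B; clear; lia.
rewrite (T_desc _ Wr Sx Px) (T_desc _ W Sx (negbT Hxy)) mulgA; apply: IH => //.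
by rewrite -ltnS -lw.
Qed.

Lemma T_conj z p q f : Fz z -> simple N p q -> ~~ fx p q z -> posr (z p) (z q) ->
  Tw (cj p q z) f = D p q (Tw z (D p q f)).
Proof.
move=> Hz S F H; have Wz := Fz_WG Hz; have Bz := Fz_BC Hz.
rewrite /cj -mulgA (T_up f (WGM Wz (WG_refl S)) S); last first.
  by rewrite !permM (simple_posr_refl S) // (Fz_root Hz).
by rewrite (T_upl _ Wz S) // (Fz_inv Hz).
Qed.

(* The hypothesis on roots says that [z] conjugates one simple reflection to the other. *)
Lemma T_swap z p q p' q' f : Fz z -> simple N p q -> simple N p' q' ->
  same_root (z p) (z q) p' q' -> posr (z p) (z q) ->
  Tw z (D p q f) = D p' q' (Tw z f).
Proof.
move=> Hz S S'; have Wz := Fz_WG Hz; have Bz := Fz_BC Hz.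
rewrite -conj_refl ?(simple_neq S) ?(simple_neq S') // => /eqP E H.
rewrite -(T_up f Wz S H) E (T_upl f Wz S') // (Fz_inv Hz).
apply/negPn/negP => h; have := len_dnl hn S' Wz.
rewrite (Fz_inv Hz) => /(_ h); rewrite -E (len_up hn S Wz H); clear; lia.
Qed.

Lemma T_fx z p q f : Fz z -> simple N p q -> fx p q z -> Tw z (D p q f) = D p q (Tw z f).
Proof.
move=> Hz S F; have [H|H] := boolP (posr (z p) (z q)); first exact: T_swap.
(* For a descent, the generator splits off at either end of [z] and leaves the same element
   [s z = z s]. *)
have Wz := Fz_WG Hz; have Bz := Fz_BC Hz; have Dq := simple_neq S.
have E : (refl p q * z = z * refl p q)%g by apply/eqP; rewrite fxE.
have U : posr ((refl p q * z)^-1%g p) ((refl p q * z)^-1%g q).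
  rewrite invMg reflV (Fz_inv Hz) -E !permM refl_p // refl_q // !(isBCP _ Bz).
  by rewrite posrC posr_neg // root_neq.
have L g : Tw z g = D p q (Tw (refl p q * z)%g g).
  by rewrite -(T_upl g _ S U) ?WGM ?(WG_refl S) // -mulgA -E mulgA refl2 mul1g.
by rewrite L -(T_desc f Wz S H).
Qed.
End Matsumoto.

(** * Minimal involutions and triangularity of [T z] *)

Section Minimal.
Variables (n : nat) (t : ctype).
Hypothesis hn : (1 < n)%N.
Local Notation N := (n.*2).
Local Notation P := {perm pt N}.
Local Notation neg := (negp n).
Local Notation simple := (@simple_root n t).
Local Notation len := (lenG t n).
Local Notation Fz := (@fpf_inv n t).
Local Notation WG := (@weyl n t).
Implicit Types (p q r x y : pt N) (w : P).

Section MinStruct.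
Variables (z : P) (K : nat).
Hypotheses (Hz : Fz z) (hK : (2 <= K <= N)%N).
Hypothesis Hmin : forall p q, simple K p q -> posr (z p) (z q) \/ z p = neg q.
Hypothesis Hhigh : forall x, K%:Z < sval x -> 0 < sval x + sval (z x).

(** Here [K] is the rank of the group under which [z] is minimal: [N] in [minimal_T], and [n] in
    [min_shape], where only W conjugates. *)
Lemma min_asc x y : 0 < sval x -> sval y = sval x + 1 -> sval y <= K%:Z ->
  sval (z x) < sval (z y) \/ (sval (z x) = sval y /\ sval (z y) = sval x).
Proof.
move=> h1 h2 h3; have S : simple K (neg x) y by rewrite /simple_root sval_neg; clear -h1 h2 h3; lia.
case: (Hmin S) => [|E]; [left|right].
  by move: a; rewrite /posr (Fz_neg Hz) sval_neg; clear; lia.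
have E' : z x = y by apply: (inv_inj (@negK n)); rewrite -(Fz_neg Hz).
by rewrite -E' (Fz_K Hz).
Qed.

Lemma min_pos_from x0 : 0 < sval x0 -> 0 < sval (z x0) ->
  forall x, sval x0 <= sval x -> sval x <= K%:Z -> 0 < sval (z x).
Proof.
move=> h0 hz0 x; have [k] := ubnP (absz (sval x)); elim: k x => // k IH x hk h1 h2.
have [E|D] : sval x = sval x0 \/ sval x <> sval x0 by clear; lia.
  by rewrite (sval_inj E).
have [u hu] : exists u : pt N, sval u = sval x - 1.
  by apply: sval_ex; have := sval_bnd x; clear -h0 h1 D; lia.
have : 0 < sval (z u) by apply: IH; rewrite hu; clear -hk h0 h1 h2 D; lia.
have A1 : 0 < sval u by rewrite hu; clear -h0 h1 D; lia.
have A2 : sval x = sval u + 1 by rewrite hu; clear; lia.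
case: (min_asc A1 A2 h2) => [h|[_ h]] h'; first by clear -h h'; lia.
by rewrite h.
Qed.

(** In type D it is the parity of [kneg] that excludes a negative [z 1]: every other positive point
    satisfies [x + z x > 0], so [kneg z] would be exactly 1. *)
Lemma min_pos (x0 : pt N) : 0 < sval x0 -> sval x0 <= K%:Z -> 0 < sval (z x0).
Proof.
have [p1 v1] : exists p : pt N, sval p = 1 by apply: sval_ex; clear -hK; lia.
have [p2 v2] : exists p : pt N, sval p = 2 by apply: sval_ex; clear -hK; lia.
suff H1 : 0 < sval (z p1).
  by move=> h1 h2; apply: (min_pos_from _ H1) => //; rewrite v1; clear -h1; lia.
have b1 := sval_bnd (z p1); have /andP[f1 f2] := Fz_sval p1 Hz.
case/and4P: (Hz) => _ _ _; case E : t => A.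
- by move/forallP: A => /(_ p1) /eqP; rewrite v1; clear -b1; lia.
- case: (@Hmin p1 p1); first by rewrite /simple_root E v1 ?orbT.
    by rewrite /posr; clear; lia.
  by move/(congr1 Defs.sval) => e; move: f2; rewrite e sval_neg eqxx.
have {}A : ~~ odd (kneg z) := A.
case: (ltrP 0 (sval (z p1))) => // h1; exfalso.
have {}h1 : sval (z p1) < -1 by move: f1 f2; rewrite v1; clear -h1 b1; lia.
have K2 x : 2 <= sval x -> sval x <= K%:Z -> 0 < sval x + sval (z x).
  have := @Hmin p1 p2; rewrite /simple_root E v1 v2 ?orbT => /(_ isT) [H|H] h2 h3.
    have h4 : 0 < sval (z p2) by move: H; rewrite /posr; clear -h1; lia.
    suff : 0 < sval (z x) by clear -h2; lia.
    by apply: (@min_pos_from p2) => //; rewrite v2.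
  have H' : sval (z p2) = -1.
    by rewrite -[p2]negK -H (Fz_neg Hz) (Fz_K Hz) sval_neg v1.
  have [e|e] : sval x = 2 \/ 3 <= sval x by clear -h2; lia.
    have -> : x = p2 by apply: sval_inj; rewrite v2.
    by rewrite v2 H'.
  have [p3 v3] : exists p : pt N, sval p = 3.
    by apply: sval_ex; have := sval_bnd x; clear -e; lia.
  have h4 : 0 < sval (z p3).
    have A1 : 0 < sval p2 by rewrite v2.
    have A2 : sval p3 = sval p2 + 1 by rewrite v2 v3.
    have A3 : sval p3 <= K%:Z by rewrite v3; clear -e h3; lia.
    case: (min_asc A1 A2 A3) => [|[_ ->]]; last by rewrite v2.
    by rewrite H'; have := sval_bnd (z p3); clear; lia.
  suff : 0 < sval (z x) by clear -h2; lia.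
  by apply: (@min_pos_from p3) => //; rewrite v3.
suff E1 : kneg z = 1%N by rewrite E1 in A.
rewrite /kneg (_ : [set p | _] = [set p1]) ?cards1 //; apply/setP => x; rewrite !inE.
apply/andP/eqP => [[h2 h3]|->]; last by rewrite v1; split=> //; clear -h1; lia.
apply: sval_inj; rewrite v1.
have [e|[e|e]] : sval x = 1 \/ (2 <= sval x /\ sval x <= K%:Z) \/ K%:Z < sval x by clear -h2; lia.
- by [].
- by case: e => e1 e2; have := K2 _ e1 e2; clear -h3; lia.
- by have := Hhigh e; clear -h3; lia.
Qed.
End MinStruct.

Section Pairs.
Variables (z : P) (a b : nat).
Hypothesis Hz : Fz z.
Hypothesis Hlow : forall x, a%:Z < sval x -> sval x <= b%:Z -> a%:Z < sval (z x).
Hypothesis Hasc : forall x y, a%:Z < sval x -> sval y = sval x + 1 -> sval y <= b%:Z ->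
  sval (z x) < sval (z y) \/ sval x <= sval (z y).

(** Used with [a = 0] for points matched with their neighbours at the bottom, and with [a = N - 2k]
    for those at the top. *)
Definition paired m := forall (j : nat) x, (j < m)%N -> sval x = (a + j.*2).+1%:Z ->
  sval (z x) = (a + j.*2).+2%:Z.

Lemma paired_closed m x : paired m -> a%:Z < sval (z x) -> sval (z x) <= (a + m.*2)%:Z ->
  sval x <= (a + m.*2)%:Z.
Proof.
move=> Hm h1 h2; pose j := (absz (sval (z x)) - a).-1./2.
have hj : (j < m)%N by rewrite /j; clear -h1 h2; lia.
have [E|E] : sval (z x) = (a + j.*2).+1%:Z \/ sval (z x) = (a + j.*2).+2%:Z.
  by rewrite /j; clear -h1 h2; lia.
  by have := Hm j _ hj E; rewrite (Fz_K Hz) => ->; clear -hj; lia.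
have [u hu] : exists u : pt N, sval u = (a + j.*2).+1%:Z.
  by apply: sval_ex; have := sval_bnd (z x); clear -E; lia.
have := Hm j u hj hu; rewrite -E => /sval_inj /perm_inj <-; rewrite hu; clear -hj; lia.
Qed.

(** If [z x] lay beyond [x + 1], the point just before [z x] would be matched below [x], where all
    points are already paired. *)
Lemma paired_step m x : paired m -> sval x = (a + m.*2).+1%:Z -> sval x <= b%:Z ->
  sval (z x) <= b%:Z -> paired m.+1.
Proof.
move=> Hm hx hb hz j y hj hy; have [E|E] : j = m \/ (j < m)%N by clear -hj; lia.
  have {y hy} -> : y = x by apply: sval_inj; rewrite hy hx E.
  suff E2 : sval (z x) = sval x + 1 by rewrite E E2 hx; clear; lia.
  have h1 : a%:Z < sval (z x) by apply: Hlow => //; clear -hx; lia.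
  have /andP[f1 _] := Fz_sval x Hz.
  have h2 : sval x < sval (z x).
    rewrite lt_neqAle eq_sym f1 /= leNgt; apply/negP => h.
    have := paired_closed Hm h1; clear -h hx; lia.
  suff : ~ sval x + 1 < sval (z x) by clear -h2; lia.
  move=> h3; have [u hu] : exists u : pt N, sval u = sval (z x) - 1.
    by apply: sval_ex; have := sval_bnd (z x); clear -h3 hx; lia.
  have A1 : a%:Z < sval u by rewrite hu; clear -h3 hx; lia.
  have A2 : sval (z x) = sval u + 1 by rewrite hu; clear; lia.
  case: (Hasc A1 A2 hz); rewrite (Fz_K Hz) => h4; last by clear -h3 h4 hu; lia.
  have h5 : a%:Z < sval (z u) by apply: Hlow; clear -hu h1 h3 hx hz; lia.
  by have := paired_closed Hm h5; clear -h4 h3 hx hu; lia.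
by apply: Hm.
Qed.
End Pairs.

Lemma min_paired z K : Fz z -> (2 <= K <= N)%N ->
  (forall p q, simple K p q -> posr (z p) (z q) \/ z p = neg q) ->
  (forall x, K%:Z < sval x -> 0 < sval x + sval (z x)) ->
  forall m x, paired z 0 m -> sval x = (m.*2).+1%:Z -> sval x <= K%:Z ->
  sval (z x) <= K%:Z -> paired z 0 m.+1.
Proof.
move=> Hz hK Hmin Hhigh m x Hm hx; apply: (paired_step Hz) => //.
- by move=> y h1 h2; apply: (min_pos Hz hK Hmin Hhigh).
- by move=> y y' h1 h2 h3; case: (min_asc Hz Hmin h1 h2 h3) => [|[_ ->]]; [left | right].
Qed.

Variables (R : comNzRingType) (ci th : R).
Hypothesis hci : ci * ci = 1 + th * ci.
Local Notation T := (@Tw n t R ci th).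

(** The element [w] is the part of [z] on the first [m] pairs. Each further pair multiplies it by a
    generator that commutes with [z], whose operator acts at [z] as the scalar [ci]. *)
Lemma T_paired z m : Fz z -> (m <= n)%N -> paired z 0 m ->
  exists w, [/\ WG w, (forall x, 0 < sval x -> sval x <= m.*2%:Z -> w x = z x),
    (forall x, m.*2%:Z < sval x -> w x = x) &
    (forall f, T w f z = ci ^+ m * f z)].
Proof.
move=> Hz; elim: m => [|m IH] hm Hm.
  exists 1%g; split; [exact: WG1 | by move=> x; clear; lia | by move=> x _; rewrite perm1 |].
  by move=> f; rewrite T1 // expr0 mul1r.
have Hm' : paired z 0 m by move=> j x hj; apply: Hm; apply: leqW.
have [w [W w1 w2 w3]] := IH (ltnW hm) Hm'.
have [p hp] : exists p : pt N, sval p = - (m.*2).+1%:Z by apply: sval_ex; clear -hm; lia.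
have [q hq] : exists p : pt N, sval p = (m.*2).+2%:Z by apply: sval_ex; clear -hm; lia.
have S : simple N p q by rewrite /simple_root hp hq; clear -hm; lia.
have Dpq := simple_neq S.
have znp : z (neg p) = q.
  apply: sval_inj; rewrite hq (Hm m (neg p)) //; rewrite sval_neg hp; clear; lia.
have zq : z q = neg p by rewrite -znp (Fz_K Hz).
have wq : w q = q by apply: w2; rewrite hq; clear; lia.
have wp : w p = p.
  by apply: (inv_inj (@negK n)); rewrite -(isBCP _ (WG_BC W)); apply: w2; rewrite sval_neg hp; clear; lia.
exists (refl p q * w)%g; split.
- by apply: WGM => //; apply: WG_refl S.
- move=> x h1 h2; rewrite permM.
  have [e|[e|e]] : sval x <= m.*2%:Z \/ x = neg p \/ x = q.
    have [e|[e|e]] : sval x <= m.*2%:Z \/ sval x = (m.*2).+1%:Z \/ sval x = (m.*2).+2%:Z.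
      by clear -h2; lia.
    + by left.
    + by right; left; apply: sval_inj; rewrite sval_neg hp e; clear; lia.
    + by right; right; apply: sval_inj; rewrite hq.
  + by rewrite refl_id ?w1 // ?hp ?hq; clear -e h1; lia.
  + by rewrite e refl_np // wq znp.
  + by rewrite e refl_q // zq (isBCP _ (WG_BC W)) wp.
- move=> x h; rewrite permM refl_id ?w2 // ?hp ?hq; clear -h; lia.
move=> f; rewrite (T_up hn hci f W S); last by rewrite wp wq (simple_posr S).
have F : fx p q z.
  by rewrite /fx zq -[z p]negK -(Fz_neg Hz) znp /same_root !eqxx !orbT.
by rewrite w3 (Dop_fx _ _ _ Hz F) exprSr mulrA.
Qed.

Lemma minimal_T z f : Fz z -> (forall p q, simple N p q -> posr (z p) (z q) \/ z p = neg q) ->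
  T z f z = ci ^+ n * f z.
Proof.
move=> Hz Hmin.
have hN : (2 <= N <= N)%N by clear -hn; lia.
have Hh x : N%:Z < sval x -> 0 < sval x + sval (z x) by have := sval_bnd x; clear; lia.
have Hp m : (m <= n)%N -> paired z 0 m.
  elim: m => [|m IH] hm; first by move=> j x.
  have [x hx] : exists p : pt N, sval p = (m.*2).+1%:Z by apply: sval_ex; clear -hm; lia.
  apply: (min_paired Hz hN Hmin Hh (IH (ltnW hm)) hx).
    by have := sval_bnd x; clear; lia.
  by have := sval_bnd (z x); clear; lia.
have [w [W w1 w2 w3]] := T_paired Hz (leqnn n) (Hp n (leqnn n)).
suff {1}-> : z = w by rewrite w3.
apply/permP => x; have b := sval_bnd x.
have [h|h] : 0 < sval x \/ 0 < sval (neg x) by rewrite sval_neg; clear -b; lia.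
  by rewrite w1 //; clear -b; lia.
apply: (inv_inj (@negK n)); rewrite -(Fz_neg Hz) -(isBCP _ (WG_BC W)) w1 // sval_neg; clear -b; lia.
Qed.

(** Conjugating [z] down by [s] replaces [f] by its image under [D]. Conjugation changes lengths by
    at most two, so the new function vanishes below the shorter element, where it takes the value
    [f z]. *)
Lemma T_triangular z f : Fz z -> (forall y : P, Fz y -> (len y < len z)%N -> f y = 0) ->
  T z f z = ci ^+ n * f z.
Proof.
have [k] := ubnP (len z); elim: k z f => // k IH z f hk Hz Hf.
case: (pselect (exists p q, simple N p q /\ dn p q z)) => [[p [q [S d]]]|H]; last first.
  apply: minimal_T => // p q S; have [h|h] := boolP (posr (z p) (z q)); first by left.
  right; have [F|F] := boolP (fx p q z).
    case: (fx_cases Hz F) => [[e1 e2]|[-> _] //].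
    by move: h; rewrite e1 e2 posrC (simple_posr S).
  by case: H; exists p, q; split; rewrite // /dn F.
case/andP: (d) => F h; have Hy := Fz_cj Hz S; have Dpq := simple_neq S.
have Fy : ~~ fx p q (cj p q z) by rewrite fx_cj ?(Fz_BC Hz).
have Py : posr (cj p q z p) (cj p q z q) by rewrite (posr_cj Hz S F).
have ly := len_cj_dn hn Hz S F h.
rewrite -{1}(cjK p q z) (T_conj hn hci _ Hy S Fy Py) (D_dn _ _ _ Hz d).
rewrite IH //; first last.
- move=> v Hv hv; have Hcv := Fz_cj Hv S; have hle := len_cj_le hn Hv S.
  have [Fv|Fv] := boolP (fx p q v).
    by rewrite (Dop_fx _ _ _ Hv Fv) Hf ?mulr0 // ly; move: hv; clear; lia.
  have E : f (cj p q v) = 0 by apply: Hf => //; rewrite ly; move: hv hle; clear; lia.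
  rewrite /Dop Hv (negPf Fv) E; case: ifP => // _.
  by rewrite Hf ?mulr0 ?addr0 // ly; move: hv; clear; lia.
- by rewrite -ltnS ly in hk; move: hk; clear; lia.
have E0 : f (cj p q z) = 0 by apply: Hf => //; rewrite ly; clear; lia.
by rewrite (Dop_up _ _ _ Hy Fy Py) cjK E0 mulr0 addr0.
Qed.

End Minimal.

(** * The set G *)

Section GSet.
Variables (n : nat) (t : ctype).
Hypothesis hn : (1 < n)%N.
Local Notation N := (n.*2).
Local Notation P := {perm pt N}.
Local Notation neg := (negp n).
Local Notation Fz := (@fpf_inv n t).
Implicit Types (p q x y u v : pt N) (w z s : P).

Definition nvd z := forall x, n%:Z < sval x -> 0 < sval x + sval (z x) /\
  forall y, sval y = sval x + 1 -> sval x <= sval (z y) \/ sval (z x) < sval (z y).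

Definition inG z := Fz z /\ nvd z.

Lemma Gp_F z : inG z -> Fz z. Proof. by case. Qed.

Lemma inS_WG w : inS n w = @weyl n TA w.
Proof.
have hN : (2 <= N <= N)%N by clear -hn; lia.
have gW : group_set [set w : P | @weyl n TA w].
  apply/group_setP; split; first by rewrite inE; apply: WG1.
  by move=> v u; rewrite !inE; apply: WGM.
apply/idP/idP => [|W].
  rewrite /inS => H.
  suff : <<[set:: gens TA N N]>>%g \subset Group gW by move/subsetP/(_ _ H); rewrite inE.
  rewrite gen_subG; apply/subsetP => g; rewrite !inE => /(gens_simple TA g hN) [p [q [S ->]]].
  exact: WG_refl S.
have [k _] := L2_reach hn W; elim: k w {W} => [|k IH] w /=.
  by rewrite inE => /eqP->; apply: group1.
rewrite inE => /orP[/IH //|/imset2P[a s /IH Ha Hs ->]].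
by apply: groupM => //; apply: mem_gen.
Qed.

Lemma pt_pos (x : pt N) : 0 < sval x -> exists i : 'I_N, x = (false, i).
Proof.
by case: x => [[] i]; [rewrite /Defs.sval /=; lia | exists i].
Qed.

Lemma sapp_pos z (i : 'I_N) : sapp z (i.+1)%:Z = sval (z (false, i)).
Proof. by rewrite -[X in sapp z X]/(sval (false, i)) sapp_sval. Qed.

Lemma isBC_forall_pos w (Q : pt N -> pt N -> bool) : isBC n w ->
  (forall x y, Q (neg x) (neg y) = Q x y) ->
  reflect (forall x, Q x (w x)) [forall i : 'I_N, Q (false, i) (w (false, i))].
Proof.
move=> Bw HQ; apply: (iffP forallP) => [H x|H i]; last exact: H.
have b := sval_bnd x; have [/pt_pos [i ->]|] : 0 < sval x \/ 0 < sval (neg x).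
- by rewrite sval_neg; clear -b; lia.
- exact: H.
move=> /pt_pos [i E]; rewrite -HQ -(isBCP _ Bw) E; exact: H.
Qed.

Lemma FBC_fpf z : isBC n z -> [forall i : 'I_N, `|sapp z (i.+1)%:Z| != (i.+1)%:Z] =
  [forall p, (z p != p) && (z p != neg p)].
Proof.
move=> Bz; have HQ x y : (fun x y : pt N => (y != x) && (y != neg x)) (neg x) (neg y) =
    (fun x y : pt N => (y != x) && (y != neg x)) x y.
  by rewrite /= !(inj_eq (inv_inj (@negK n))).
have E : [forall i : 'I_N, `|sapp z (i.+1)%:Z| != (i.+1)%:Z] =
   [forall i : 'I_N, (z (false, i) != (false, i)) && (z (false, i) != neg (false, i))].
  apply: eq_forallb => i; rewrite sapp_pos !sval_eq sval_neg.
  by rewrite -[(i.+1)%:Z]/(sval (false, i)); clear; rewrite /Defs.sval /=; lia.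
rewrite E; apply/(isBC_forall_pos Bz HQ)/forallP => H x; exact: H.
Qed.

Lemma Fz_TBC z : Fz z -> @fpf_inv n TBC z.
Proof. by rewrite /fpf_inv => /and4P[-> -> -> _]. Qed.

Lemma vdes_nvd z : @fpf_inv n TBC z ->
  [forall i : 'I_N, (n < i.+1)%N ==> ~~ vdes n z i.+1] <-> nvd z.
Proof.
move=> Hz; split.
  move=> /forallP H x hx; have [|i Ei] := @pt_pos x; first by clear -hx; lia.
  have vx : sval x = (i.+1)%:Z by rewrite Ei.
  have := H i; rewrite /vdes sapp_pos -Ei -vx => /implyP h.
  have {}h := h _; move: (h ltac:(rewrite vx in hx; clear -hx; lia)).
  rewrite negb_or => /andP[h1 h2].
  have /andP[f1 f2] := Fz_sval x Hz; split; first by clear -h2 f2; lia.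
  move=> y hy; have hN : (i.+1 < N)%N by have := sval_bnd y; rewrite hy vx; clear; lia.
  move: h1; rewrite hN /= (_ : (i.+2)%:Z = sval y); last by rewrite hy vx; clear; lia.
  rewrite sapp_sval.
  have : sval (z x) != sval (z y) by rewrite -sval_eq (inj_eq perm_inj) sval_eq hy; clear; lia.
  by clear; lia.
move=> H; apply/forallP => i; apply/implyP => hi.
have [h1 h2] := H (false, i) ltac:(rewrite /Defs.sval /=; clear -hi; lia).
rewrite /vdes sapp_pos; apply/negP => /orP[/and3P[h3 h4 h5]|]; last first.
  by move: h1; rewrite /= {1}/Defs.sval /=; clear; lia.
have [y hy] : exists p : pt N, sval p = (i.+2)%:Z by apply: sval_ex; clear -h3; lia.
have := h2 y; rewrite hy -sapp_sval hy {1 2}/Defs.sval /= => /(_ ltac:(clear; lia)).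
by move: h4 h5; clear; lia.
Qed.

Lemma kneg_card z : @fpf_inv n TBC z -> nvd z ->
  kneg z = #|[set i : 'I_n | sapp z (i.+1)%:Z < - (i.+1)%:Z]|.
Proof.
move=> Hz Hn; have hw : (n <= N)%N by clear; lia.
pose f (i : 'I_n) : pt N := (false, widen_ord hw i).
have fi : injective f by move=> i j [] E; apply: val_inj.
have vf i : sval (f i) = (i.+1)%:Z by [].
rewrite /kneg -(card_imset _ fi); apply: eq_card => x; rewrite inE.
apply/andP/imsetP => [[h1 h2]|[i]].
  have h3 : sval x <= n%:Z.
    rewrite leNgt; apply/negP => h; have [] := Hn x h; clear -h2; lia.
  have [j Ej] := pt_pos h1; have hj : (j < n)%N by move: h3; rewrite Ej /Defs.sval /=; clear; lia.
  have Ef : x = f (Ordinal hj) by rewrite Ej; congr (_, _); apply: val_inj.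
  exists (Ordinal hj) => //; rewrite inE -vf -Ef sapp_sval; clear -h2; lia.
rewrite inE -vf sapp_sval => h ->; rewrite vf; split; [clear -h; lia|].
by rewrite vf in h; clear -h; lia.
Qed.

Lemma FBC_Fz z : FBC n z = @fpf_inv n TBC z.
Proof.
rewrite /FBC /fpf_inv andbT; have [Bz|//] := boolP (isBC n z).
by rewrite FBC_fpf.
Qed.

Lemma FA_Fz z : FA n z = @fpf_inv n TA z.
Proof.
rewrite /FA /fpf_inv inS_WG /weyl; have [Bz|//] := boolP (isBC n z); rewrite /=.
case: (z^-1%g == z); rewrite ?andbF //= andbC.
have [/forallP H|] := boolP [forall p, (sval (z p) < 0) == (sval p < 0)]; last by rewrite !andbF.
rewrite !andbT; apply/forallP/forallP => [h x|h i].
  have b := sval_bnd x; have b' := sval_bnd (z x).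
  rewrite !sval_eq sval_neg; have Hx := eqP (H x).
  have [hx|hx] : 0 < sval x \/ 0 < sval (neg x) by rewrite sval_neg; clear -b; lia.
    have [i Ei] := pt_pos hx; have := h i; rewrite sapp_pos -Ei.
    rewrite (_ : (i.+1)%:Z = sval x); last by rewrite Ei.
    by clear -hx Hx b b'; lia.
  have [i Ei] := pt_pos hx; have := h i; rewrite sapp_pos -Ei.
  rewrite (_ : (i.+1)%:Z = sval (neg x)); last by rewrite Ei.
  rewrite (isBCP _ Bz) !sval_neg; rewrite sval_neg in hx.
  by clear -hx Hx b b'; lia.
rewrite sapp_pos (_ : (i.+1)%:Z = sval (false, i)) // -sval_eq.
by case/andP: (h (false, i)).
Qed.

Lemma Gset_Gp z : (z \in Gset t n) <-> inG z.
Proof.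
rewrite inE /inG; case E : t.
- rewrite FA_Fz; split=> [/andP[H1 H2]|[H1 H2]].
    by split=> //; apply/vdes_nvd => //; apply: Fz_TBC; rewrite E.
  by rewrite H1; apply/vdes_nvd => //; apply: Fz_TBC; rewrite E.
- by rewrite FBC_Fz; split=> [/andP[H1 H2]|[H1 H2]]; rewrite ?H1; [split=> // | ]; apply/vdes_nvd.
- rewrite /FD FBC_Fz; split=> [/andP[/andP[H1 H3] H2]|[H1 H2]].
    have {}H2 : nvd z by apply/vdes_nvd.
    split=> //; move: H3; rewrite -kneg_card // => H3.
    by case/and4P: H1 => h1 h2 h3 _; apply/and4P.
  have H0 : fpf_inv TBC z by apply: Fz_TBC; rewrite E.
  rewrite H0 -kneg_card //; case/and4P: H1 => _ _ _ ->; apply/vdes_nvd => //.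
Qed.

End GSet.

(** * Points beyond [n] matched inside, and the group permuting them *)

Section Orbits.
Variables (n : nat) (t : ctype).
Hypothesis hn : (1 < n)%N.
Local Notation N := (n.*2).
Local Notation P := {perm pt N}.
Local Notation neg := (negp n).
Local Notation simple := (@simple_root n t).
Local Notation Fz := (@fpf_inv n t).
Local Notation Gp := (@inG n t).
Implicit Types (p q x y u v : pt N) (w z s : P).

(* Invariant under conjugation by W (lemma [XX_cj]); it separates the minimal elements
   of G (lemma [min_unique]). *)
Definition XX z : pred (pt N) := [pred x | (n%:Z < `|sval x|) && (`|sval (z x)| <= n%:Z)].

Lemma XXE z x : (x \in XX z) = (n%:Z < `|sval x|) && (`|sval (z x)| <= n%:Z).
Proof. by []. Qed.

Lemma refl_low p q x : simple n p q -> n%:Z < `|sval x| -> refl p q x = x.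
Proof. by rewrite /simple_root => S h; apply: refl_id; clear -S h hn; lia. Qed.

Lemma refl_lowE p q x : simple n p q -> (`|sval (refl p q x)| <= n%:Z) = (`|sval x| <= n%:Z).
Proof.
move=> S; case: (leP `|sval x| n%:Z) => h; last by rewrite refl_low // leNgt h.
apply/negPn/negP; rewrite -ltNge => h'; move: (h').
by rewrite -(refl_low S h') reflK ltNge h.
Qed.

Lemma simple_low p q : simple n p q -> (`|sval p| <= n%:Z) && (`|sval q| <= n%:Z).
Proof. by rewrite /simple_root => S; clear -S hn; lia. Qed.

Lemma XX_cj z p q : simple n p q -> XX (cj p q z) =1 XX z.
Proof.
move=> S x; have E : n%:Z < `|sval x| ->
    (`|sval (cj p q z x)| <= n%:Z) = (`|sval (z x)| <= n%:Z).
  by move=> h; rewrite cjE (refl_low S h) refl_lowE.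
by apply/andP/andP => -[h1 h2]; split=> //; rewrite ?E // -E.
Qed.

Section G.
Variable z : P.
Hypothesis Gz : Gp z.
Let Hz : Fz z := Gp_F Gz.

(** Otherwise [x] and [- z x] are both beyond [n], and the conditions [0 < u + z u] at these two
    points contradict each other. *)
Lemma high_pos x : n%:Z < sval x -> - n%:Z <= sval (z x).
Proof.
move=> h; rewrite leNgt; apply/negP => h'.
have [h1 _] := Gz.2 _ h.
have h2 : n%:Z < sval (neg (z x)) by rewrite sval_neg; clear -h'; lia.
have [h3 _] := Gz.2 _ h2; move: h3.
by rewrite (Fz_neg Hz) (Fz_K Hz) !sval_neg; clear -h1; lia.
Qed.

(** A point beyond [n] matched beyond [n] and followed by one matched inside would be a visible
    descent. So the positive part of [XX z] is an initial segment of the points beyond [n]. *)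
Lemma XX_down x y : y \in XX z -> n%:Z < sval x -> sval x < sval y -> x \in XX z.
Proof.
have [k] := ubnP (absz (sval y - sval x)); elim: k x => // k IH x hk Xy h1 h2.
have [u hu] : exists u : pt N, sval u = sval x + 1.
  by apply: sval_ex; have := sval_bnd y; clear -h1 h2; lia.
have Xu : u \in XX z.
  have [e|e] : sval u = sval y \/ sval u < sval y by rewrite hu; clear -h2; lia.
    by rewrite (sval_inj e).
  by apply: IH => //; rewrite hu; clear -hk h1 h2; lia.
move: Xu; rewrite !XXE => /andP[_ hzu].
have [h3 h4] := Gz.2 _ h1; have := h4 _ hu; have := high_pos h1.
by clear -h1 hzu; lia.
Qed.

Lemma XX_mono x y : x \in XX z -> y \in XX z -> 0 < sval x -> sval x < sval y ->
  sval (z x) < sval (z y).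
Proof.
move=> Xx Xy h0 h; pose X := [pred x | (x \in XX z) && (0 < sval x)].
apply: (@interval_mono n X (fun x => sval (z x))) => //.
- move=> a b c; rewrite !inE => /andP[/andP[Xa _] ha] /andP[Xc hc] h1 h2.
  rewrite andbC; apply/andP; split; first by clear -ha h1; lia.
  by apply: (@XX_down b c) => //; clear -Xa ha h1; lia.
- by move=> a; rewrite !inE => /andP[].
- move=> a b; rewrite !inE => /andP[/andP[h1 h2] h3] /andP[/andP[h4 h5] h6] h7.
  have [_ /(_ _ h7)] := Gz.2 a ltac:(clear -h1 h3; lia).
  by clear -h1 h3 h5; lia.
- by rewrite !inE; move: Xx; rewrite XXE => ->.
- by rewrite !inE; move: Xy; rewrite XXE => ->; clear -h0 h; lia.
Qed.

(* Stands for [s] in [Asc^=(z)]: [z] conjugates [refl p q] to some [s_i] with [i > n]. *)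
Definition aeq p q z := exists p' q', [/\ sval p' < - n%:Z, sval q' = 1 - sval p' &
  same_root (z p) (z q) p' q'].

Lemma aeq_simple p' q' : sval p' < - n%:Z -> sval q' = 1 - sval p' -> simple N p' q'.
Proof. by move=> h1 h2; rewrite /simple_root; have := sval_bnd q'; clear -h1 h2; lia. Qed.

(* Because [z] is increasing on the points beyond [n] that are matched inside. *)
Lemma opp_adjacent p q x y : simple n p q -> x \in XX z -> y \in XX z ->
  sval x < 0 -> 0 < sval y -> (z x = p /\ z y = q) \/ (z x = q /\ z y = p) ->
  sval y = 1 - sval x.
Proof.
move=> S Xx Xy hx hy E.
have sE : sval (z x) + sval (z y) = sval p + sval q by case: E => -[-> ->] //; rewrite addrC.
have spq : 0 < sval p + sval q by have := simple_posr S.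
have Xn : neg x \in XX z.
  by move: Xx; rewrite !XXE (Fz_neg Hz) !sval_neg !normrN.
have zn : sval (z (neg x)) = - sval (z x) by rewrite (Fz_neg Hz) sval_neg.
have nx : 0 < sval (neg x) by rewrite sval_neg; clear -hx; lia.
have lt1 : sval (neg x) < sval y.
  rewrite ltNge le_eqVlt -sval_eq; apply/negP => /orP[/eqP e|h].
    by move: zn sE; rewrite -e; clear -spq; lia.
  by have := XX_mono Xy Xn hy h; rewrite zn; clear -sE spq; lia.
have [e|h] : sval y = 1 - sval x \/ sval (neg x) + 1 < sval y.
  by move: lt1; rewrite sval_neg; clear; lia.
  exact: e.
(* The image of a point between [neg x] and [y] would lie strictly between [- z x] and [z y], where
   a simple root leaves no value free. *)
have [u hu] : exists u : pt N, sval u = sval (neg x) + 1.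
  by apply: sval_ex; have := sval_bnd y; clear -h nx; lia.
have Xu : u \in XX z.
  apply: (XX_down Xy); rewrite hu //.
  by move: Xn; rewrite XXE => /andP[h1 _]; clear -h1 nx; lia.
have m1 : sval (z (neg x)) < sval (z u) by apply: (XX_mono Xn Xu nx); rewrite hu; clear; lia.
have m2 : sval (z u) < sval (z y) by apply: (XX_mono Xu Xy); rewrite hu; [clear -nx; lia | exact: h].
have /andP[b1 _] := sval_bnd (z u).
have n1 : sval (z u) <> sval (z x).
  by move/sval_inj/perm_inj => e; move: hu; rewrite e sval_neg; clear -hx; lia.
have n2 : sval (z u) <> - sval (z y).
  rewrite -sval_neg -(Fz_neg Hz) => /sval_inj/perm_inj e; move: hu; rewrite e !sval_neg.
  by clear -hx hy; lia.
rewrite zn in m1; exfalso; clear Xx Xy Xn Xu lt1 h hu nx zn.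
move: S; rewrite /simple_root; case: E => -[E1 E2]; rewrite E1 E2 in sE m1 m2 n1 n2; clear -b1 m1 m2 n1 n2; lia.
Qed.

Lemma opp_aeq p q : simple n p q -> z p \in XX z -> z q \in XX z ->
  (0 < sval (z p)) != (0 < sval (z q)) -> aeq p q z.
Proof.
move=> S Xp Xq D; have bp := sval_bnd (z p); have bq := sval_bnd (z q).
have low x : x \in XX z -> sval x < 0 -> sval x < - n%:Z.
  by rewrite XXE => /andP[h _]; clear -h; lia.
have [h|h] : (sval (z p) < 0 /\ 0 < sval (z q)) \/ (sval (z q) < 0 /\ 0 < sval (z p)).
  by clear -D bp bq; lia.
  exists (z p), (z q); split; [exact: low Xp h.1 | | by rewrite /same_root !eqxx].
  by apply: (opp_adjacent S) h.1 h.2 _ => //; left; rewrite !(Fz_K Hz).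
exists (z q), (z p); split; [exact: low Xq h.1 | | by rewrite /same_root !eqxx ?orbT].
by apply: (opp_adjacent S) h.1 h.2 _ => //; right; rewrite !(Fz_K Hz).
Qed.

Lemma same_root_XX p q p' q' : simple n p q -> same_root (z p) (z q) p' q' ->
  n%:Z < `|sval p'| -> n%:Z < `|sval q'| -> p' \in XX z /\ q' \in XX z.
Proof.
move=> S E h1 h2; have /andP[l1 l2] := simple_low S; rewrite !XXE h1 h2 /=.
have K x y : z x = y -> `|sval (z y)| = `|sval x| by move=> <-; rewrite (Fz_K Hz).
have K' x y : z x = neg y -> `|sval (z y)| = `|sval x|.
  by move=> e; rewrite -[y]negK -e (Fz_neg Hz) (Fz_K Hz) sval_neg normrN.
by case/or4P: E => /andP[/eqP e1 /eqP e2];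
  rewrite ?(K _ _ e1) ?(K _ _ e2) ?(K' _ _ e1) ?(K' _ _ e2).
Qed.

Lemma aeq_posr p q : simple n p q -> aeq p q z -> posr (z p) (z q).
Proof.
move=> S [p' [q' [h1 h2 E]]]; have := simple_posr S; have /andP[l1 l2] := simple_low S.
have hx : n%:Z < sval (neg p') by rewrite sval_neg; clear -h1; lia.
have hy : sval q' = sval (neg p') + 1 by rewrite sval_neg h2; clear; lia.
have [_ /(_ _ hy) A] := Gz.2 _ hx; move: A; rewrite /posr !(Fz_neg Hz) !sval_neg.
have K x y : z x = y -> sval (z y) = sval x by move=> <-; rewrite (Fz_K Hz).
have K' x y : z x = neg y -> sval (z y) = - sval x.
  by move=> e; rewrite -[y]negK -e (Fz_neg Hz) (Fz_K Hz) sval_neg.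
case/or4P: E => /andP[/eqP e1 /eqP e2].
- by rewrite e1 e2 h2; clear; lia.
- by rewrite e1 e2 h2; clear; lia.
- by rewrite (K' _ _ e1) (K' _ _ e2); clear -l1 l2 h1; lia.
- by rewrite (K' _ _ e1) (K' _ _ e2); clear -l1 l2 h1; lia.
Qed.

(** Such a reflection fixes the points beyond [n], so it only moves their images. It can reverse the
    order of two consecutive images only when they form its own root, and that is an equality
    ascent. *)
Lemma Gp_cj p q : simple n p q -> ~ aeq p q z -> Gp (cj p q z).
Proof.
move=> S A; have SN : simple N p q by apply: simpleW S; clear; lia.
split=> [|x hx]; first exact: Fz_cj.
have Dq := simple_neq S; have Bz := Fz_BC Hz.
have cE y : n%:Z < sval y -> cj p q z y = refl p q (z y).
  by move=> h; rewrite cjE (refl_low S (x := y)) //; clear -h; lia.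
have [h1 h2] := Gz.2 _ hx; split.
  rewrite cE //; case: (leP `|sval (z x)| n%:Z) => h; last by rewrite (refl_low S h).
  have := refl_lowE (z x) S; rewrite h; clear -hx; lia.
move=> y hy; have hny : n%:Z < sval y by rewrite hy; clear -hx; lia.
rewrite (cE _ hny) (cE _ hx).
case: (h2 y hy) => h3.
  by left; rewrite (refl_low S) //; clear -hx h3; lia.
right; have Dxy : neg x != neg y by rewrite (inj_eq (inv_inj (@negK n))) sval_eq hy; clear; lia.
have PH : isroot t (z y) (z (neg x)).
  by rewrite PhiM // /isroot !sval_eq !sval_neg hy; apply/andP; split; [|apply/orP; right]; clear -hx; lia.
have F : ~~ same_root (z y) (z (neg x)) p q.
  apply/negP => H; apply: A; exists (neg x), y.
  rewrite sval_neg; split; [clear -hx; lia | by rewrite hy; clear; lia |].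
  have D' : neg x != neg y by [].
  rewrite -conj_refl //; last by rewrite negK sval_eq hy; clear -hx; lia.
  rewrite -conj_refl // in H.
  have /eqP E := H; apply/eqP/(@invg_inj _); rewrite !invMg !reflV (Fz_inv Hz).
  by rewrite [refl (neg x) y]refl_sym E.
have := simple_posr_refl SN PH F; rewrite (Fz_neg Hz) /posr !sval_isBC ?isBC_refl // sval_neg.
by clear -h3; lia.
Qed.
End G.

Section Q.
Variable z : P.
(* The sign preserving permutations of [XX z]: the group generated by the [s_i], [i > n],
   that touch only points of [XX z]. *)
Definition Qg s := [/\ isBC n s, (forall x, x \notin XX z -> s x = x) &
  (forall x, (0 < sval (s x)) = (0 < sval x))].

Lemma Qg1 : Qg 1.
Proof. by split; [exact: isBC1 | move=> x _; rewrite perm1 | move=> x; rewrite perm1]. Qed.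

Lemma QgM s w : Qg s -> Qg w -> Qg (s * w)%g.
Proof.
move=> [s1 s2 s3] [w1 w2 w3]; split; first exact: isBCM.
  by move=> x h; rewrite permM s2 // w2.
by move=> x; rewrite permM w3 s3.
Qed.

Lemma QgV s : Qg s -> Qg s^-1%g.
Proof.
move=> [s1 s2 s3]; split; first exact: isBCV.
  by move=> x h; rewrite -{1}(s2 _ h) permK.
by move=> x; rewrite -s3 permKV.
Qed.

Lemma Qg_low s x : Qg s -> `|sval x| <= n%:Z -> s x = x.
Proof. by move=> [_ s2 _] h; apply: s2; rewrite XXE ltNge h. Qed.

Lemma Qg_XX s x : Qg s -> x \in XX z -> s x \in XX z.
Proof.
move=> [_ s2 _] h; apply/negPn/negP => h'.
by have /perm_inj e := s2 _ h'; move/negP: h'; rewrite e.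
Qed.

Lemma Qg_XXE s x : Qg s -> (s x \in XX z) = (x \in XX z).
Proof.
move=> Hs; apply/idP/idP => [h|]; last exact: Qg_XX.
by have := Qg_XX (QgV Hs) h; rewrite permK.
Qed.

Lemma Qg_refl p q : p \in XX z -> q \in XX z -> sval p < - n%:Z -> sval q = 1 - sval p ->
  Fz z -> Qg (refl p q).
Proof.
move=> Xp Xq hp hq Hz; split; first exact: isBC_refl.
  have XN x : (neg x \in XX z) = (x \in XX z).
    by rewrite !XXE (Fz_neg Hz) !sval_neg !normrN.
  have D x y : x \in XX z -> y \notin XX z -> sval y <> sval x.
    by move=> h h' /sval_inj e; move/negP: h'; rewrite e.
  by move=> x h; apply: refl_id; rewrite -?sval_neg; apply: (D _ x _ h); rewrite ?XN.
move=> x; have := sval_bnd x; rewrite sval_refl; clear -hp hq hn => b.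
have ha : sval p != 0 by lia.
have hb : sval q != 0 by lia.
have hab : sval p != - sval q by lia.
by case: (rvP (sval x) ha hb hab) => [[[-> ->]|[-> ->]|[-> ->]|[-> ->]]|[_ ->]] //; lia.
Qed.

(** The sign of a sum of a point beyond [n] and one up to [n] is the sign of the former, which [s]
    preserves. *)
Lemma Qg_posr s u v : Qg s -> v != neg u ->
  (u \in XX z -> v \notin XX z -> `|sval v| <= n%:Z) ->
  (v \in XX z -> u \notin XX z -> `|sval u| <= n%:Z) ->
  (u \in XX z -> v \in XX z -> (0 < sval u) = (0 < sval v)) ->
  posr (s u) (s v) = posr u v.
Proof.
move=> Hs D H1 H2 H3; have [s1 s2 s3] := Hs.
have Xb x : x \in XX z -> n%:Z < `|sval x| by rewrite XXE => /andP[].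
have bu := sval_bnd u; have bv := sval_bnd v.
have bsu := sval_bnd (s u); have bsv := sval_bnd (s v).
have [Xu|Xu] := boolP (u \in XX z); have [Xv|Xv] := boolP (v \in XX z).
- have := H3 Xu Xv; have := s3 u; have := s3 v; rewrite /posr.
  by clear -bu bv bsu bsv; lia.
- rewrite (s2 v) //; have := H1 Xu Xv; have := Xb _ Xu; have := Xb _ (Qg_XX Hs Xu); have := s3 u.
  by rewrite /posr; clear; lia.
- rewrite (s2 u) //; have := H2 Xv Xu; have := Xb _ Xv; have := Xb _ (Qg_XX Hs Xv); have := s3 v.
  by rewrite /posr; clear; lia.
- by rewrite !s2.
Qed.

Lemma Qg_comm s p q : Qg s -> simple n p q -> (s * refl p q = refl p q * s)%g.
Proof.
move=> Hs S; have /andP[l1 l2] := simple_low S; have [s1 _ _] := Hs.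
by rewrite refl_conj // !(Qg_low Hs).
Qed.
End Q.
End Orbits.

(** * The embedding of the module *)

Section Psi.
Variables (n : nat) (t : ctype).
Hypothesis hn : (1 < n)%N.
Local Notation N := (n.*2).
Local Notation P := {perm pt N}.
Local Notation neg := (negp n).
Local Notation simple := (@simple_root n t).
Local Notation len := (lenG t n).
Local Notation Fz := (@fpf_inv n t).
Local Notation Gp := (@inG n t).
Implicit Types (p q x u v : pt N) (w y z s : P).

Definition Orb z y := exists s, Qg z s /\ y = (s^-1 * z * s)%g.

Lemma Orb_id z : Orb z z.
Proof. by exists 1%g; split; [exact: Qg1 | rewrite invg1 mul1g mulg1]. Qed.

(** The simple roots of the group [Qg z]. *)
Definition block z p q := [/\ p \in XX z, q \in XX z, sval p < - n%:Z & sval q = 1 - sval p].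

Lemma block_simple z p q : block z p q -> simple N p q.
Proof. by move=> [_ _ h1 h2]; apply: aeq_simple h2. Qed.

Lemma Qg_ext z z' s : XX z =1 XX z' -> Qg z s -> Qg z' s.
Proof.
move=> E [s1 s2 s3]; split=> // x h; apply: s2.
by apply: contra h => h; exact: (etrans (esym (E x)) h).
Qed.

Section OneOrbit.
Variables z y : P.
Hypotheses (Gz : Gp z) (O : Orb z y).
Let Hz : Fz z := Gp_F Gz.

Lemma Orb_F : Fz y.
Proof.
case: O => s [Hs Ey]; have [s1 s2 s3] := Hs.
have yE u : y (s u) = s (z u) by rewrite Ey !permM permK.
have By : isBC n y by rewrite Ey !isBCM ?isBCV ?(Fz_BC Hz).
have Xz u : z u \in XX z -> `|sval u| <= n%:Z by rewrite XXE (Fz_K Hz) => /andP[].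
have Xu u : u \in XX z -> `|sval (z u)| <= n%:Z by rewrite XXE => /andP[].
have key u : posr (s u) (y (s u)) = posr u (z u).
  rewrite yE; apply: (Qg_posr Hs).
  - by have /andP[] := Fz_fpf Hz u.
  - by move=> h _; apply: Xu.
  - by move=> h _; apply: Xz.
  - by move=> /Xu h; rewrite XXE ltNge h.
have fpf x : (y x != x) && (y x != neg x).
  by rewrite -[x](permKV s) yE -(isBCP _ s1) !(inj_eq perm_inj); apply: Fz_fpf Hz _.
have nposr w x : (w x != x) && (w x != neg x) -> (sval x + sval (w x) < 0) = ~~ posr x (w x).
  by move=> /andP[_]; rewrite /posr sval_eq sval_neg; clear; lia.
have kE : kneg y = kneg z.
  rewrite /kneg -[RHS](card_imset _ (@perm_inj _ s)); apply: eq_card => x.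
  rewrite inE nposr // -[x](permKV s) key s3 mem_imset ?inE ?nposr //; last exact: perm_inj.
  exact: Fz_fpf Hz _.
apply/and4P; split=> //.
- by rewrite Ey !invMg invgK (Fz_inv Hz) mulgA.
- by apply/forallP.
- case/and4P: (Hz) => _ _ _; case: t => //; last by rewrite kE.
  move=> /forallP Hs'; apply/forallP => x.
  have sg a : (sval (s a) < 0) = (sval a < 0).
    by have := s3 a; have := sval_bnd a; have := sval_bnd (s a); clear; lia.
  by rewrite -[x](permKV s) yE !sg Hs'.
Qed.

Lemma Orb_posr p q : simple n p q -> ~ aeq p q z -> posr (y p) (y q) = posr (z p) (z q).
Proof.
case: O => s [Hs Ey] S A; have /andP[l1 l2] := simple_low hn S.
have E x : `|sval x| <= n%:Z -> y x = s (z x).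
  by move=> h; rewrite Ey !permM (Qg_low (QgV Hs)).
rewrite !E //; apply: (Qg_posr Hs).
- by apply: root_neq (Fz_BC Hz) (simple_neq S).
- by rewrite !XXE !(Fz_K Hz) l2 andbT -leNgt.
- by rewrite !XXE !(Fz_K Hz) l1 andbT -leNgt.
- move=> h1 h2; apply/eqP/negPn/negP => h; apply: A.
  exact: (opp_aeq Gz S h1 h2 h).
Qed.

Lemma Orb_fx p q : simple n p q -> fx p q y = fx p q z.
Proof.
case: O => s [Hs Ey] S; have /andP[l1 l2] := simple_low hn S.
have E x : `|sval x| <= n%:Z -> y x = s (z x).
  by move=> h; rewrite Ey !permM (Qg_low (QgV Hs)).
rewrite /fx !E // -{2}(Qg_low Hs l1) -{2}(Qg_low Hs l2) same_rootM //.
by case: Hs.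
Qed.

Lemma Orb_cj p q : simple n p q -> Orb (cj p q z) (cj p q y).
Proof.
case: O => s [Hs ->] S; exists s; split.
  by apply: Qg_ext Hs => x; rewrite (XX_cj hn z S).
have C := Qg_comm hn Hs S; have C' := Qg_comm hn (QgV Hs) S.
by rewrite /cj !mulgA C' -!mulgA C.
Qed.

Lemma Orb_conj s : Qg z s -> Orb z (s^-1 * y * s)%g.
Proof.
case: O => s' [Hs' ->] Hs; exists (s' * s)%g; split; first exact: QgM.
by rewrite invMg !mulgA.
Qed.

Lemma Orb_block p q : block z p q -> Orb z (cj p q y) /\ ~~ fx p q y.
Proof.
move=> B; have [Xp Xq h1 h2] := B; split.
  rewrite /cj -{1}(reflV p q); apply: Orb_conj; exact: (Qg_refl hn Xp Xq h1 h2 Hz).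
have D := simple_neq (block_simple B).
case: O => s [Hs Ey]; have Hs' := QgV Hs.
have yp : `|sval (y p)| <= n%:Z.
  have := Qg_XX Hs' Xp; rewrite XXE => /andP[_ h]; rewrite Ey !permM.
  by rewrite (Qg_low Hs).
apply/negP => /(fx_cases Orb_F) [[e _]|[e _]]; move: yp; rewrite e ?sval_neg;
  clear -h1 h2; lia.
Qed.

(** Conjugation by [s] and by the [s_i] which [z] exchanges with it send [z] to the same element,
    and this [s_i] belongs to [Qg z]. *)
Lemma Orb_aeq p q : simple n p q -> aeq p q z -> Orb z (cj p q y) /\ ~~ fx p q y.
Proof.
move=> S A; have [p' [q' [h1 h2 E]]] := A; have Dq := simple_neq S.
have [|| Xp Xq] := same_root_XX hn Gz S E; [by clear -h1; lia | by rewrite h2; clear -h1; lia |].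
have S' := aeq_simple t h1 h2; have Dq' := simple_neq S'; have Bz := Fz_BC Hz.
have /eqP C : (refl p q * z == z * refl p' q')%g by rewrite conj_refl.
have C' : (z * refl p q = refl p' q' * z)%g.
  by apply: (@invg_inj _); rewrite !invMg !reflV (Fz_inv Hz).
have cE : cj p q z = cj p' q' z.
  have Cr : (refl p q * refl p' q' = refl p' q' * refl p q)%g.
    by rewrite refl_conj ?isBC_refl // !(Qg_low (Qg_refl hn Xp Xq h1 h2 Hz)) //; case/andP: (simple_low hn S).
  by rewrite /cj C -mulgA -Cr mulgA C'.
split.
  have [s [Hs Ey]] := Orb_cj S; rewrite Ey cE /cj.
  have Hr := Qg_refl hn Xp Xq h1 h2 Hz.
  have Hs2 : Qg z s by apply: Qg_ext Hs => x; rewrite (XX_cj hn z S).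
  exists (refl p' q' * s)%g; split; first exact: QgM.
  by rewrite invMg reflV !mulgA.
rewrite (Orb_fx S); apply/negP => F.
case/(fx_cases Hz): F => [[e _]|[e _]]; have /andP[l1 l2] := simple_low hn S;
 have : z p \in XX z by case/or4P: E => /andP[/eqP-> _]; rewrite ?XXE // ?(Fz_neg Hz) ?sval_neg ?normrN -?XXE.
 by rewrite e XXE ltNge l2.
by rewrite e XXE sval_neg normrN ltNge l2.
Qed.

(** The assumption makes [y] increasing on the positive part of [XX z], as [z] is; the permutation
    relating them is then increasing, hence trivial. *)
Lemma Orb_sort : (forall p q, block z p q -> posr (y p) (y q)) -> y = z.
Proof.
move=> H; have [s [Hs Ey]] := O; have [s1 s2 s3] := Hs.
have yE u : y (s u) = s (z u) by rewrite Ey !permM permK.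
pose X := [pred x | (x \in XX z) && (0 < sval x)].
have XE x : (x \in X) = (x \in XX z) && (0 < sval x) by [].
have Xn x : (neg x \in XX z) = (x \in XX z) by rewrite !XXE (Fz_neg Hz) !sval_neg !normrN.
have Xi : interval X.
  move=> a b c; rewrite !XE => /andP[/andP[Xa _] ha] /andP[Xc hc] h1 h2.
  apply/andP; split; last by clear -ha h1; lia.
  by apply: (XX_down Gz (x := b) Xc) => //; clear -Xa ha h1; lia.
have ym a b : a \in X -> b \in X -> sval a < sval b -> sval (y a) < sval (y b).
  apply: (@interval_mono n X (fun x => sval (y x)) Xi) => [x|u v].
    by rewrite XE => /andP[].
  rewrite !XE => /andP[Xu hu] /andP[Xv hv] huv.
  have : block z (neg u) v.
    split; rewrite ?Xn ?sval_neg //; last by rewrite huv; clear; lia.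
    by move: Xu; rewrite XXE => /andP[h _]; clear -h hu; lia.
  by move/H; rewrite /posr (Fz_neg Orb_F) sval_neg; clear; lia.
have sX x : x \in X -> s x \in X by rewrite !XE s3 (Qg_XXE _ Hs).
have sz x : x \in X -> s (z x) = z x.
  by rewrite XE XXE => /andP[/andP[_ h] _]; apply: (Qg_low Hs).
have sm a b : a \in X -> b \in X -> sval a < sval b -> sval (s a) < sval (s b).
  move=> Xa Xb hab; rewrite ltNge le_eqVlt -sval_eq (inj_eq perm_inj).
  apply/negP => /orP[/eqP e|h]; first by rewrite e ltxx in hab.
  have := ym _ _ (sX _ Xb) (sX _ Xa) h; rewrite !yE !sz //.
  move: (Xa) (Xb); rewrite !XE => /andP[Xa' ha] /andP[Xb' hb].
  by have := XX_mono Gz Xa' Xb' ha hab; clear; lia.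
have sid := mono_id sX sm.
suff E1 : s = 1%g by rewrite Ey E1 invg1 mul1g mulg1.
apply: isBC_eq1 => // x hx; have [h|h] := boolP (x \in XX z); last exact: s2.
by apply: sid; rewrite XE h.
Qed.
End OneOrbit.

(** Sorting [y] by the reflections of [Qg z] ends at [z] in steps of length two. The parity makes
    the halving in [psi] exact. *)
Lemma Orb_len z y : Gp z -> Orb z y -> (len z <= len y)%N /\ ~~ odd (len y - len z).
Proof.
move=> Gz; have [k] := ubnP (len y); elim: k y => // k IH y hk O.
have Hy := Orb_F Gz O.
case: (pselect (exists p q, block z p q /\ ~~ posr (y p) (y q))) => [[p [q [B h]]]|H].
  have [O' F] := Orb_block Gz O B; have l := len_cj_dn hn Hy (block_simple B) F h.
  have hk' : (len (cj p q y) < k)%N by rewrite l in hk; clear -hk; lia.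
  have [a1 a2] := IH _ hk' O'; rewrite l; split; first by clear -a1; lia.
  by rewrite -addn2 -addnBAC // oddD addbF.
suff -> : y = z by rewrite subnn.
apply: Orb_sort => // p q B; apply/negPn/negP => h; apply: H; by exists p, q.
Qed.

Lemma Orb_G z z' : Gp z -> Gp z' -> Orb z z' -> z' = z.
Proof.
move=> Gz Gz' O; apply: Orb_sort => // p q B; have [Xp Xq h1 h2] := B.
have [s [Hs Ez]] := O; have Hz' := Gp_F Gz'.
have hx : n%:Z < sval (neg p) by rewrite sval_neg; clear -h1; lia.
have hy : sval q = sval (neg p) + 1 by rewrite sval_neg h2; clear; lia.
have [_ /(_ _ hy)] := Gz'.2 _ hx; rewrite /posr (Fz_neg Hz') sval_neg.
have : `|sval (z' q)| <= n%:Z.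
  have := Qg_XX (QgV Hs) Xq; rewrite XXE => /andP[_ h]; rewrite Ez !permM.
  by rewrite (Qg_low Hs).
by clear -h1; rewrite sval_neg; lia.
Qed.

End Psi.

Section Psi.
Variables (n : nat) (t : ctype).
Hypothesis hn : (1 < n)%N.
Local Notation N := (n.*2).
Local Notation P := {perm pt N}.
Local Notation simple := (@simple_root n t).
Local Notation len := (lenG t n).
Local Notation Fz := (@fpf_inv n t).
Local Notation Gp := (@inG n t).
Implicit Types (p q x u v : pt N) (w y z s : P).
Variables (R : comNzRingType) (ci th e e' : R).
Hypothesis hci : ci * ci = 1 + th * ci.
Hypotheses (hee : e * e' = 1) (he' : e' = e + th).
Local Notation D := (@Dop n t R ci th).

(* Summing over [Orb z] embeds the module attached to G into the functions on all
   fixed-point-free involutions, compatibly with the inverses of the [H_s]. *)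
Definition psi z y : R := if `[< Orb z y >] then e ^+ ((len y - len z)./2) else 0.

Lemma psi_in z y : Orb z y -> psi z y = e ^+ ((len y - len z)./2).
Proof. by move=> h; rewrite /psi asboolT. Qed.

Lemma psi_out z y : ~ Orb z y -> psi z y = 0.
Proof. by move=> h; rewrite /psi asboolF. Qed.

Lemma expr_half2 k : e ^+ (k.+2)./2 = e * e ^+ k./2.
Proof. by rewrite -exprS. Qed.

Lemma psi_id z : psi z z = 1.
Proof. by rewrite psi_in ?subnn //; exact: Orb_id. Qed.

Lemma simple_N p q : simple n p q -> simple N p q.
Proof. by apply: simpleW; rewrite -addnn leq_addr. Qed.

(* The orbit splits into pairs [{y, cj p q y}], each carrying a multiple of the
   eigenvector [(1, e)]. *)
Lemma psi_scalar z p q : Gp z -> simple N p q ->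
  (forall y, Orb z y -> Orb z (cj p q y) /\ ~~ fx p q y) ->
  D p q (psi z) = (fun y => e' * psi z y).
Proof.
move=> Gz S H; have Dq := simple_neq S; apply: funext => y.
case: (pselect (Orb z y)) => [O|O]; last first.
  have O' : ~ Orb z (cj p q y) by move=> /H [h _]; apply: O; move: h; rewrite cjK.
  rewrite (psi_out O) mulr0; have [Hy|Hy] := boolP (Fz y); last by rewrite /Dop (negPf Hy).
  have [F|F] := boolP (fx p q y); first by rewrite Dop_fx // psi_out // mulr0.
  have [h|h] := boolP (posr (y p) (y q)); first by rewrite Dop_up // !psi_out // mulr0 addr0.
  by rewrite Dop_dn // psi_out.
have Hy := Orb_F Gz O; have [O' F] := H _ O.
have [l1 l2] := Orb_len hn Gz O; have [l3 l4] := Orb_len hn Gz O'.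
have [h|h] := boolP (posr (y p) (y q)).
  rewrite Dop_up // !psi_in // (len_cj_up hn Hy S F h) (_ : _.+2 - _ = (len y - len z).+2)%N.
    by rewrite expr_half2 he' mulrDl addrC.
  by clear -l1; lia.
rewrite Dop_dn // !psi_in // (len_cj_dn hn Hy S F h).
rewrite (_ : _.+2 - _ = (len (cj p q y) - len z).+2)%N; last by clear -l3; lia.
by rewrite expr_half2 mulrA [e' * e]mulrC hee mul1r.
Qed.

Lemma psi_block z p q : Gp z -> block z p q -> D p q (psi z) = (fun y => e' * psi z y).
Proof.
by move=> Gz B; apply: psi_scalar (block_simple t B) _ => // y O; apply: Orb_block Gz O _ _ B.
Qed.

Lemma psi_aeq z p q : Gp z -> simple n p q -> aeq p q z -> D p q (psi z) = (fun y => e' * psi z y).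
Proof.
by move=> Gz S A; apply: psi_scalar (simple_N S) _ => // y O; apply: Orb_aeq Gz O _ _ S A.
Qed.

Lemma psi_fx z p q : Gp z -> simple n p q -> fx p q z -> D p q (psi z) = (fun y => ci * psi z y).
Proof.
move=> Gz S Fzz; have SN := simple_N S; have Dq := simple_neq S; apply: funext => y.
case: (pselect (Orb z y)) => [O|O].
  by rewrite Dop_fx ?(Orb_fx hn O S) //; exact: Orb_F O.
have O' : ~ Orb z (cj p q y).
  move=> /(Orb_cj hn)/(_ _ _ S); rewrite cjK fx_cj_id // ?(Fz_BC (Gp_F Gz)) //.
rewrite (psi_out O) mulr0; have [Hy|Hy] := boolP (Fz y); last by rewrite /Dop (negPf Hy).
have [F|F] := boolP (fx p q y); first by rewrite Dop_fx // psi_out // mulr0.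
have [h|h] := boolP (posr (y p) (y q)); first by rewrite Dop_up // !psi_out // mulr0 addr0.
by rewrite Dop_dn // psi_out.
Qed.

Lemma Orb_cjE z y p q : simple n p q -> Orb (cj p q z) y -> Orb z (cj p q y).
Proof. by move=> S /(Orb_cj hn)/(_ _ _ S); rewrite cjK. Qed.

Lemma psi_asc z p q : Gp z -> simple n p q -> ~~ fx p q z -> ~ aeq p q z ->
  posr (z p) (z q) -> D p q (psi z) = (fun y => psi (cj p q z) y + th * psi z y).
Proof.
move=> Gz S Fzz A h0; have SN := simple_N S; apply: funext => y.
have Hz := Gp_F Gz; have lz := len_cj_up hn Hz SN Fzz h0.
case: (pselect (Orb z y)) => [O|O].
  have Hy := Orb_F Gz O.
  have F : ~~ fx p q y by rewrite (Orb_fx hn O S).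
  have h : posr (y p) (y q) by rewrite (Orb_posr hn Gz O S A).
  have O' : ~ Orb z (cj p q y).
    by move=> O'; have := Orb_posr hn Gz O' S A; rewrite (posr_cj Hy SN F) h h0.
  rewrite Dop_up // (psi_out O') [psi (cj p q z) y]psi_out // => O2.
  by apply: O'; apply: Orb_cjE S O2.
rewrite (psi_out O) mulr0 addr0.
case: (pselect (Orb z (cj p q y))) => [O'|O'].
  have Hc := Orb_F Gz O'; have Hy : Fz y by rewrite -[y](cjK p q); apply: Fz_cj.
  have F' : ~~ fx p q (cj p q y) by rewrite (Orb_fx hn O' S).
  have h' : posr (cj p q y p) (cj p q y q) by rewrite (Orb_posr hn Gz O' S A).
  have F : ~~ fx p q y by move: F'; rewrite fx_cj ?(Fz_BC Hy) // (simple_neq S).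
  have h : ~~ posr (y p) (y q) by rewrite -(posr_cj Hy SN F).
  rewrite Dop_dn // !psi_in //; last by rewrite -[y](cjK p q); apply: Orb_cj O' _ _ S.
  by rewrite (len_cj_dn hn Hy SN F h) lz !subSS.
rewrite psi_out; last by move/(Orb_cjE S).
have [Hy|Hy] := boolP (Fz y); last by rewrite /Dop (negPf Hy).
have [F|F] := boolP (fx p q y); first by rewrite Dop_fx // psi_out // mulr0.
have [h|h] := boolP (posr (y p) (y q)); first by rewrite Dop_up // !psi_out // mulr0 addr0.
by rewrite Dop_dn // psi_out.
Qed.

Lemma aeq_cj z p q : Fz z -> simple n p q -> aeq p q (cj p q z) -> aeq p q z.
Proof.
move=> Hz S [p' [q' [h1 h2 E]]]; exists p', q'; split=> //; move: E.
have Dq := simple_neq S; have S' := simple_N S.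
have lp : refl p q p' = p' by apply: (refl_low hn S); clear -h1; lia.
have lq : refl p q q' = q' by apply: (refl_low hn S); rewrite h2; clear -h1; lia.
rewrite -{1}lp -{1}lq !cjE same_rootM ?isBC_refl // refl_p // refl_q //.
rewrite !(Fz_neg Hz) /same_root !(can2_eq (@negK n) (@negK n)) !negK.
by case/or4P => /andP[-> ->]; rewrite ?orbT.
Qed.

Lemma psi_des z p q : Gp z -> simple n p q -> ~~ fx p q z -> ~ aeq p q z ->
  ~~ posr (z p) (z q) -> forall y, Fz y -> D p q (psi z) y = psi (cj p q z) y.
Proof.
move=> Gz S F A h y Hy; have SN := simple_N S; have Hz := Gp_F Gz.
have A' : ~ aeq p q (cj p q z) by move/(aeq_cj Hz S).
have Gc := Gp_cj hn Gz S A.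
have E : D p q (psi (cj p q z)) = (fun y => psi z y + th * psi (cj p q z) y).
  rewrite (psi_asc Gc S) ?cjK // ?(posr_cj Hz SN) // fx_cj ?(Fz_BC Hz) //; exact: simple_neq S.
(* The descent formula is the ascent formula at [cj p q z], solved by means of the quadratic
   relation. *)
have Q := Dop_quad hci (psi (cj p q z)) Hy SN.
apply: (addIr (th * D p q (psi (cj p q z)) y)).
by rewrite -Q E Dop_lin E.
Qed.

End Psi.

(** * Minimal elements of G *)

Section MinUnique.
Variables (n : nat) (t : ctype).
Hypothesis hn : (1 < n)%N.
Local Notation N := (n.*2).
Local Notation P := {perm pt N}.
Local Notation neg := (negp n).
Local Notation simple := (@simple_root n t).
Local Notation Fz := (@fpf_inv n t).
Local Notation Gp := (@inG n t).
Implicit Types (p q x y u v : pt N) (w z s : P).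

Section Shape.
Variable z : P.
Hypotheses (Gz : Gp z)
  (Hmin : forall p q, simple n p q -> posr (z p) (z q) \/ z p = neg q).
Let Hz : Fz z := Gp_F Gz.

(** The form of all minimal elements: the lowest and the highest [2k] positive points are matched
    with their neighbours, and the other points up to [n] are shifted by [n - 2k]. Only [k] is free,
    and [XX z] determines it. *)
Definition shape k := [/\ (k.*2 <= n)%N, paired z 0 k,
  (forall x, k.*2%:Z < sval x -> sval x <= n%:Z -> sval (z x) = sval x - k.*2%:Z + n%:Z),
  (forall y, n%:Z < sval y -> (y \in XX z) = (sval y <= (N - k.*2)%:Z)) &
  paired z (N - k.*2) k].

Let hK : (2 <= n <= N)%N. Proof. by clear -hn; lia. Qed.
Let Hhigh x : n%:Z < sval x -> 0 < sval x + sval (z x).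
Proof. by move=> h; have [] := Gz.2 x h. Qed.
Let Hpos := min_pos Hz hK Hmin Hhigh.
Let Hasc := min_asc Hz Hmin.

Lemma shape_low : exists k, [/\ (k.*2 <= n)%N, paired z 0 k &
  forall x, sval x = k.*2.+1%:Z -> sval x <= n%:Z -> n%:Z < sval (z x)].
Proof.
apply: contrapT => H.
suff : forall j, paired z 0 j /\ (j.*2 <= n)%N by move=> /(_ n) []; clear -hn; lia.
elim=> [|j [H1 H2]]; first by split; [move=> j x | lia].
case: (pselect (forall x, sval x = j.*2.+1%:Z -> sval x <= n%:Z -> n%:Z < sval (z x))) => H3.
  by case: H; exists j.
move/existsNP: H3 => [x /not_implyP[hx /not_implyP[h1 /negP h2]]].
rewrite -leNgt in h2; have Hj := min_paired Hz hK Hmin Hhigh H1 hx h1 h2.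
split=> //; move: h2; rewrite (Hj j x) //; clear; lia.
Qed.

Lemma min_shape : exists k, shape k.
Proof.
have [k [k1 k2 k3]] := shape_low; exists k.
have A x : k.*2%:Z < sval x -> sval x <= n%:Z -> n%:Z < sval (z x).
  have [m] := ubnP (absz (sval x)); elim: m x => // m IH x hm h1 h2.
  have [e|e] : sval x = k.*2.+1%:Z \/ k.*2.+1%:Z < sval x by clear -h1; lia.
    exact: k3.
  have [u hu] : exists u : pt N, sval u = sval x - 1.
    by apply: sval_ex; have := sval_bnd x; clear -e; lia.
  have hzu : n%:Z < sval (z u) by apply: IH; rewrite hu; clear -hm e h2; lia.
  have hx : sval x = sval u + 1 by rewrite hu; clear; lia.
  case: (Hasc (x := u) (y := x)) => // [|h|[h _]]; first by rewrite hu; clear -e; lia.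
    by clear -h hzu; lia.
  by clear -h hzu h2; lia.
have C y : n%:Z < sval y -> y \in XX z -> k.*2%:Z < sval (z y) /\ sval (z y) <= n%:Z.
  move=> h1; rewrite XXE => /andP[_ h2].
  have b := sval_bnd (z y).
  have h3 : 0 < sval (z y).
    rewrite ltNge le_eqVlt; apply/negP => /orP[/eqP h|h]; first by move: b; rewrite h; clear; lia.
    have := Hpos (x0 := neg (z y)); rewrite (Fz_neg Hz) (Fz_K Hz) !sval_neg; clear -h1 h2 h; lia.
  split; last by clear -h2; lia.
  rewrite ltNge; apply/negP => h4; have := paired_closed Hz k2 (x := y) h3.
  by rewrite add0n => /(_ h4); clear -h1 k1; lia.
have B x : k.*2%:Z < sval x -> sval x <= n%:Z -> sval (z x) = sval x - k.*2%:Z + n%:Z.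
  have [m] := ubnP (absz (sval x)); elim: m x => // m IH x hm h1 h2.
  have zx := A x h1 h2.
  have Xzx : z x \in XX z by rewrite XXE (Fz_K Hz); clear -h1 h2 zx; lia.
  have lo : sval x - k.*2%:Z + n%:Z <= sval (z x).
    have [e|e] : sval x = k.*2.+1%:Z \/ k.*2.+1%:Z < sval x by clear -h1; lia.
      by clear -e zx; lia.
    have [u hu] : exists u : pt N, sval u = sval x - 1.
      by apply: sval_ex; have := sval_bnd x; clear -e; lia.
    have hzu : sval (z u) = sval u - k.*2%:Z + n%:Z by apply: IH; rewrite hu; clear -hm e h2; lia.
    have hx : sval x = sval u + 1 by rewrite hu; clear; lia.
    case: (Hasc (x := u) (y := x)) => // [|h|[h _]]; first by rewrite hu; clear -e; lia.
      by clear -h hzu hu; lia.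
    by clear -h hzu hu h2 e; lia.
  (* A value skipped just below [z x] would belong to [XX z] and be matched, by monotonicity,
     strictly between [x - 1] and [x], or below the first available point. *)
  apply/eqP; rewrite eq_le lo andbT leNgt; apply/negP => hi.
  have [y hy] : exists y : pt N, sval y = sval (z x) - 1.
    by apply: sval_ex; have := sval_bnd (z x); clear -zx; lia.
  have Xy : y \in XX z by apply: (XX_down Gz Xzx); rewrite hy; clear -hi h1; lia.
  have [hy1 hy2] := C y ltac:(rewrite hy; clear -hi h1; lia) Xy.
  have hyx : sval (z y) < sval x.
    by rewrite -[x](Fz_K Hz); apply: (XX_mono Gz Xy Xzx); rewrite hy; clear -zx hi h1; lia.
  have e : k.*2.+1%:Z < sval x by clear -hyx hy1; lia.
  have [u hu] : exists u : pt N, sval u = sval x - 1.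
    by apply: sval_ex; have := sval_bnd x; clear -e; lia.
  have hzu : sval (z u) = sval u - k.*2%:Z + n%:Z by apply: IH; rewrite hu; clear -hm e h2; lia.
  have Xzu : z u \in XX z by rewrite XXE (Fz_K Hz) hzu hu; clear -e h2; lia.
  have : sval (z (z u)) < sval (z y).
    by apply: (XX_mono Gz Xzu Xy); rewrite hzu hu ?hy; clear -hi e; lia.
  by rewrite (Fz_K Hz) hu; clear -hyx; lia.
have E y : n%:Z < sval y -> (y \in XX z) = (sval y <= (N - k.*2)%:Z).
  move=> h1; apply/idP/idP => h2.
    have [h3 h4] := C y h1 h2; have := B (z y) h3 h4; rewrite (Fz_K Hz) => ->.
    by clear -h4 k1; lia.
  have [u hu] : exists u : pt N, sval u = sval y - n%:Z + k.*2%:Z.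
    by apply: sval_ex; have := sval_bnd y; clear -h1 h2 k1; lia.
  have zu : z u = y.
    by apply: sval_inj; rewrite B hu; clear -h1 h2 k1; lia.
  by rewrite -zu XXE (Fz_K Hz) zu hu; clear -h1 h2 k1; lia.
split=> //.
have L x : (N - k.*2)%:Z < sval x -> (N - k.*2)%:Z < sval (z x).
  move=> h; have hx : n%:Z < sval x by clear -h k1; lia.
  have := E x hx; rewrite leNgt h XXE; have := high_pos Gz hx => h3 h4.
  have hzx : n%:Z < sval (z x) by clear -h3 h4 hx; lia.
  rewrite ltNge -E // XXE (Fz_K Hz); clear -hx; lia.
have Hp m : (m <= k)%N -> paired z (N - k.*2) m.
  elim: m => [|m IH] hm; first by move=> j x.
  have [x hx] : exists x : pt N, sval x = (N - k.*2 + m.*2).+1%:Z by apply: sval_ex; clear -hm k1; lia.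
  apply: (paired_step (b := N) Hz _ _ (IH (ltnW hm)) hx).
  - by move=> u hu _; apply: L.
  - move=> u v h1 h2 _; have [_ /(_ v h2)] := Gz.2 u ltac:(clear -h1 k1; lia).
    by case; [right | left].
  - by have := sval_bnd x; clear; lia.
  - by have := sval_bnd (z x); clear; lia.
exact: Hp.
Qed.
End Shape.

Lemma paired_eq z z' a m : Fz z -> Fz z' -> paired z a m -> paired z' a m ->
  forall x, a%:Z < sval x -> sval x <= (a + m.*2)%:Z -> z x = z' x.
Proof.
move=> Hz Hz' A A' x h1 h2; pose j := (absz (sval x) - a).-1./2.
have hj : (j < m)%N by rewrite /j; clear -h1 h2; lia.
have [E|E] : sval x = (a + j.*2).+1%:Z \/ sval x = (a + j.*2).+2%:Z.
  by rewrite /j; clear -h1 h2; lia.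
  by apply: sval_inj; rewrite (A j x hj E) (A' j x hj E).
have [u hu] : exists u : pt N, sval u = (a + j.*2).+1%:Z.
  by apply: sval_ex; have := sval_bnd x; clear -E; lia.
have /sval_inj e : sval (z u) = sval x by rewrite (A j u hj hu).
have /sval_inj e' : sval (z' u) = sval x by rewrite (A' j u hj hu).
by rewrite -{1}e (Fz_K Hz) -e' (Fz_K Hz').
Qed.

Lemma shape_le z z' k k' : shape z k -> shape z' k' -> XX z =1 XX z' -> (k <= k')%N.
Proof.
move=> [a1 _ _ a4 _] [b1 _ _ b4 _] E; rewrite leqNgt; apply/negP => h.
have [y hy] : exists y : pt N, sval y = (N - k'.*2)%:Z by apply: sval_ex; clear -h a1 hn; lia.
have hy1 : n%:Z < sval y by rewrite hy; clear -h a1; lia.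
have := a4 y hy1; rewrite -[_ \in _]/(XX z y) E; have := b4 y hy1; rewrite -[_ \in _]/(XX z' y) => ->.
by rewrite hy; clear -h a1; lia.
Qed.

Lemma min_unique z z' : Gp z -> Gp z' ->
  (forall p q, simple n p q -> posr (z p) (z q) \/ z p = neg q) ->
  (forall p q, simple n p q -> posr (z' p) (z' q) \/ z' p = neg q) ->
  XX z =1 XX z' -> z = z'.
Proof.
move=> Gz Gz' M M' E; have [k S] := min_shape Gz M; have [k' S'] := min_shape Gz' M'.
have Ek : k = k'.
  by apply/eqP; rewrite eqn_leq (shape_le S S' E) (shape_le S' S) // => x; rewrite E.
rewrite -{}Ek in S'; move: S S' => [a1 a2 a3 a4 a5] [_ b2 b3 b4 b5].
have Hz := Gp_F Gz; have Hz' := Gp_F Gz'.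
have pos x : 0 < sval x -> z x = z' x.
  move=> h; have b := sval_bnd x.
  have [h1|h1] : sval x <= k.*2%:Z \/ k.*2%:Z < sval x by clear; lia.
    by apply: (paired_eq Hz Hz' a2 b2).
  have [h2|h2] : sval x <= n%:Z \/ n%:Z < sval x by clear; lia.
    by apply: sval_inj; rewrite a3 // b3.
  have [h3|h3] : sval x <= (N - k.*2)%:Z \/ (N - k.*2)%:Z < sval x by clear; lia.
    have [u hu] : exists u : pt N, sval u = sval x - n%:Z + k.*2%:Z.
      by apply: sval_ex; clear -h1 h2 h3 a1; lia.
    have e : z u = x by apply: sval_inj; rewrite a3 hu; clear -h2 h3 a1; lia.
    have e' : z' u = x by apply: sval_inj; rewrite b3 hu; clear -h2 h3 a1; lia.
    by rewrite -{1}e (Fz_K Hz) -e' (Fz_K Hz').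
  by apply: (paired_eq Hz Hz' a5 b5) => //; clear -b a1; lia.
apply/permP => x; have b := sval_bnd x.
have [h|h] : 0 < sval x \/ 0 < sval (neg x) by rewrite sval_neg; clear -b; lia.
  exact: pos.
by apply: (inv_inj (@negK n)); rewrite -(Fz_neg Hz) -(Fz_neg Hz') pos.
Qed.

End MinUnique.

(** * The bar operator *)

Section BarCoef.
Variables (n : nat) (t : ctype).
Hypothesis hn : (1 < n)%N.
Local Notation N := (n.*2).
Local Notation P := {perm pt N}.
Local Notation neg := (negp n).
Local Notation simple := (@simple_root n t).
Local Notation len := (lenG t n).
Local Notation Fz := (@fpf_inv n t).
Local Notation Gp := (@inG n t).
Implicit Types (p q x u v : pt N) (w y z s : P).
Variables (R : comNzRingType) (c ci th e e' : R).
Hypotheses (hcc : c * ci = 1) (hci' : ci = c + th).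
Hypotheses (hee : e * e' = 1) (he' : e' = e + th).
Local Notation D := (@Dop n t R ci th).
Local Notation T := (@Tw n t R ci th).
Local Notation Psi := (@psi n t R e).

Let hci : ci * ci = 1 + th * ci.
Proof. by rewrite {1}hci' mulrDl hcc. Qed.

Lemma T_lin w f g (k : R) : T w (fun y => f y + k * g y) = (fun y => T w f y + k * T w g y).
Proof.
rewrite /Tw; move: (len w) => m; elim: m w f g => //= m IH w f g.
by case: pickP => // a _; rewrite Dop_lin IH.
Qed.

Lemma T_scale w g (k : R) : T w (fun y => k * g y) = (fun y => k * T w g y).
Proof.
rewrite /Tw; move: (len w) => m; elim: m w g => //= m IH w g.
case: pickP => // a _; rewrite -IH; congr (Tk _ _ _ _ _); apply: funext => z; rewrite /Dop.
case: ifP => _; last by rewrite mulr0.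
by case: ifP => _; [ring | case: ifP => _; ring].
Qed.

Definition XXb z z' := [forall x, (x \in XX z) == (x \in XX z')].

Lemma XXbP z z' : reflect (XX z =1 XX z') (XXb z z').
Proof. by apply: (iffP forallP) => H x; [exact: (eqP (H x)) | exact: (introT eqP (H x))]. Qed.

(* The matrix of the bar operator; [T z] plays the role of the inverse of [H_z]. *)
Definition Bc z z' : R := if XXb z z' then c ^+ n * T z (Psi z') z else 0.

(** [T_triangular] yields the scalar [ci ^+ n]; the factor [c ^+ n] in [Bc] is there to cancel
    it. *)
Lemma hcn : c ^+ n * ci ^+ n = 1.
Proof. by rewrite -exprMn hcc expr1n. Qed.

Lemma Bc_triangular z z' : Gp z -> Gp z' -> (len z <= len z')%N -> Bc z z' = (z == z')%:R.
Proof.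
move=> Gz Gz' h; rewrite /Bc.
rewrite (T_triangular hn hci (Gp_F Gz)) => [|y Hy hy]; last first.
  by rewrite psi_out // => O; have [] := Orb_len hn Gz' O; clear -h hy; lia.
rewrite mulrA hcn mul1r; have [E|NE] := eqVneq z z'.
  rewrite -E psi_id; case: XXbP => // -[].
rewrite psi_out; first by case: ifP.
by move=> O; move/eqP: NE; apply; exact: (Orb_G Gz' Gz O).
Qed.

Section Inter.
Variables (z z' : P) (p q : pt N).
Hypotheses (Gz : Gp z) (Gz' : Gp z') (S : simple n p q).
Let Hz : Fz z := Gp_F Gz.
Let SN : simple N p q := simple_N S.
Let Dq : q != neg p := simple_neq S.

Lemma TD_asc f : ~~ fx p q z -> posr (z p) (z q) ->
  T (cj p q z) f (cj p q z) = T z (D p q f) z.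
Proof.
move=> F h; rewrite (T_conj hn hci f Hz SN F h) Dop_dn ?cjK //; first exact: Fz_cj.
  by rewrite fx_cj ?(Fz_BC Hz).
by rewrite (posr_cj Hz SN) // h.
Qed.

Lemma TD_fx f : fx p q z -> T z (D p q f) z = ci * T z f z.
Proof. by move=> F; rewrite (T_fx hn hci f Hz SN F) Dop_fx. Qed.

(** Let [s_i] be the generator exchanged with [s] by [z]. Passing through [T z] turns [D] of [s]
    into [D] of [s_i]; at [z] the two agree, since both ascend to the same element; passing back
    gives [D] of [s_i] acting on [psi z']. As [XX] agrees for [z] and [z'], this is the scalar [e'].
    Hence the test [XXb] in [Bc]. *)
Lemma TD_aeq : aeq p q z -> XX z =1 XX z' -> T z (D p q (Psi z')) z = e' * T z (Psi z') z.
Proof.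
move=> A EX; have [p' [q' [h1 h2 E]]] := A; have h := aeq_posr hn Gz S A.
have [|| Xp Xq] := same_root_XX hn Gz S E; [by clear -h1; lia | by rewrite h2; clear -h1; lia |].
have S' := aeq_simple t h1 h2; have Dq' := simple_neq S'; have Bz := Fz_BC Hz.
have B : block z p' q' by [].
have B' : block z' p' q'.
  by split=> //; [exact: (etrans (esym (EX p')) Xp) | exact: (etrans (esym (EX q')) Xq)].
have [_ F'] := Orb_block hn Gz (Orb_id z) B.
have [_ F] := Orb_aeq hn Gz (Orb_id z) S A.
have /eqP C : (refl p q * z == z * refl p' q')%g by rewrite conj_refl.
have C' : (z * refl p q = refl p' q' * z)%g.
  by apply: (@invg_inj _); rewrite !invMg !reflV (Fz_inv Hz).
have cE : cj p q z = cj p' q' z.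
  have Cr : (refl p q * refl p' q' = refl p' q' * refl p q)%g.
    by rewrite refl_conj ?isBC_refl // !(Qg_low (Qg_refl hn Xp Xq h1 h2 Hz)) //; case/andP: (simple_low hn S).
  by rewrite /cj C -mulgA -Cr mulgA C'.
have E' : same_root (z p') (z q') p q.
  by rewrite -conj_refl // C'.
have h' : posr (z p') (z q').
  have hx : n%:Z < sval (neg p') by rewrite sval_neg; clear -h1; lia.
  have hy : sval q' = sval (neg p') + 1 by rewrite sval_neg h2; clear; lia.
  have [_ /(_ _ hy)] := Gz.2 _ hx; rewrite /posr (Fz_neg Hz) sval_neg.
  by move: Xq; rewrite XXE sval_neg; clear -h1; lia.
have E1 := T_swap hn hci (Psi z') Hz S' SN E' h'.
have E2 := T_swap hn hci (Psi z') Hz SN S' E h.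
have E3 g : D p' q' g z = D p q g z by rewrite !Dop_up // cE.
by rewrite E2 E3 -E1 (psi_block hn _ hee he' Gz' B') T_scale.
Qed.

(** This and [Bc_right] express the action of a generator on the first and on the second index by
    the same quantity, with [D] inserted between [T z] and [psi z']. Their equality gives the
    compatibility of the bar operator with [H_s]. *)
Lemma Bc_left (b : bool := XXb z z') :
  (if fx p q z then ci * Bc z z' else if `[< aeq p q z >] then e' * Bc z z'
   else if posr (z p) (z q) then Bc (cj p q z) z' else Bc (cj p q z) z' + th * Bc z z')
  = if b then c ^+ n * T z (D p q (Psi z')) z else 0.
Proof.
have XC : XXb (cj p q z) z' = XXb z z'.
  by apply: eq_forallb => x; rewrite -[x \in XX (cj _ _ _)]/(XX (cj p q z) x) (XX_cj hn z S).
rewrite /Bc XC /b; case: (XXbP z z') => EX; last first.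
  by do 3?[case: ifP => _]; rewrite ?mulr0 ?addr0.
have [F|F] := boolP (fx p q z); first by rewrite TD_fx //; ring.
have [/asboolP A|/asboolPn A] := boolP `[< aeq p q z >]; first by rewrite TD_aeq //; ring.
have [h|h] := boolP (posr (z p) (z q)); first by rewrite TD_asc.
have G1 : Gp (cj p q z) := Gp_cj hn Gz S A; have H1 := Gp_F G1.
have F1 : ~~ fx p q (cj p q z) by rewrite fx_cj ?(Fz_BC Hz).
have h1 : posr (cj p q z p) (cj p q z q) by rewrite (posr_cj Hz SN).
have E1 f : T z f z = T (cj p q z) (D p q f) (cj p q z).
  have := T_conj hn hci f H1 SN F1 h1; rewrite cjK => ->.
  by rewrite Dop_dn.
have Q : D p q (D p q (Psi z')) = (fun y => Psi z' y + th * D p q (Psi z') y).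
  apply: funext => y; have [Hy|Hy] := boolP (Fz y); first exact: Dop_quad.
  rewrite psi_out => [|O]; last by rewrite (Orb_F Gz' O) in Hy.
  by rewrite /Dop (negPf Hy) mulr0 addr0.
by rewrite (E1 (D p q (Psi z'))) Q T_lin -E1; ring.
Qed.

Lemma Bc_right (b : bool := XXb z z') :
  (if fx p q z' then ci * Bc z z' else if `[< aeq p q z' >] then e' * Bc z z'
   else if posr (z' p) (z' q) then Bc z (cj p q z') + th * Bc z z' else Bc z (cj p q z'))
  = if b then c ^+ n * T z (D p q (Psi z')) z else 0.
Proof.
have Hz' := Gp_F Gz'.
have XC : XXb z (cj p q z') = XXb z z'.
  by apply: eq_forallb => x; rewrite -[x \in XX (cj _ _ _)]/(XX (cj p q z') x) (XX_cj hn z' S).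
rewrite /Bc XC /b; case: (XXbP z z') => EX; last first.
  by do 3?[case: ifP => _]; rewrite ?mulr0 ?addr0.
have [F|F] := boolP (fx p q z'); first by rewrite (psi_fx hn) // T_scale; ring.
have [/asboolP A|/asboolPn A] := boolP `[< aeq p q z' >].
  by rewrite (psi_aeq hn _ hee he' Gz' S A) T_scale; ring.
have [h|h] := boolP (posr (z' p) (z' q)).
  by rewrite (psi_asc hn) // T_lin; ring.
have G1 : Gp (cj p q z') := Gp_cj hn Gz' S A.
congr (_ * T _ _ _); apply: funext => y; have [Hy|Hy] := boolP (Fz y).
  by rewrite (psi_des hn _ hci).
rewrite psi_out => [|O]; last by rewrite (Orb_F G1 O) in Hy.
by rewrite /Dop (negPf Hy).
Qed.
End Inter.

Definition minimal z := forall p q, simple n p q -> posr (z p) (z q) \/ z p = neg q.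

Definition dsc p q z := [&& ~~ fx p q z, ~~ `[< aeq p q z >] & ~~ posr (z p) (z q)].

Lemma no_dsc_min z : Gp z -> (forall p q, simple n p q -> ~~ dsc p q z) -> minimal z.
Proof.
move=> Gz H p q S; have [h|h] := boolP (posr (z p) (z q)); first by left.
right; have := H p q S; rewrite /dsc h andbT negb_and !negbK => /orP[F|/asboolP A]; last first.
  by rewrite (aeq_posr hn Gz S A) in h.
case: (fx_cases (Gp_F Gz) F) => [[e1 e2]|[] //].
by move: h; rewrite e1 e2 posrC (simple_posr S).
Qed.

Lemma descend z : Gp z -> exists w, [/\ Gp w, minimal w, XX w =1 XX z & (len w <= len z)%N].
Proof.
have [k] := ubnP (len z); elim: k z => // k IH z hk Gz.
case: (pselect (exists p q, simple n p q /\ dsc p q z)) => [[p [q [S]]]|H]; last first.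
  exists z; split=> //; apply: no_dsc_min => // p q S; apply/negP => d; apply: H.
  by exists p, q.
case/and3P => F /asboolPn A h; have G1 := Gp_cj hn Gz S A.
have l := len_cj_dn hn (Gp_F Gz) (simple_N S) F h.
have [|w [w1 w2 w3 w4]] := IH _ _ G1; first by clear -hk l; lia.
exists w; split=> //; first by move=> x; rewrite w3 (XX_cj hn z S).
by clear -w4 l; lia.
Qed.

(** If the sets [XX] agree, descending from [z'] ends at a minimal element with that set, which is
    [z] by [min_unique]. So [z] is not longer than [z'] and triangularity applies. *)
Lemma Bc_min z z' : Gp z -> minimal z -> Gp z' -> Bc z z' = (z == z')%:R.
Proof.
move=> Gz M Gz'; case: (XXbP z z') => [EX|EX]; last first.
  rewrite /Bc; case: XXbP => // _; have [E|//] := eqVneq z z'.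
  by rewrite E in EX.
have [w [Gw Mw Xw lw]] := descend Gz'.
apply: Bc_triangular => //.
by rewrite (min_unique hn Gz Gw M Mw) // => x; rewrite EX Xw.
Qed.
End BarCoef.

Lemma lnpos_bar_fixed f : lnpos f -> lb f = f -> f = (lc f 0)%:~R.
Proof.
move=> H E; apply: lc_ext => j; rewrite lc_int; have [->//|h] := eqVneq j 0.
have [h'|h'] : 0 < j \/ 0 < - j by clear -h; lia.
  exact: H.
by rewrite -E lc_lbar H.
Qed.

(* How a generator acts on a basis vector: strict ascent, strict descent, eigenvalue
   [- x^-1], eigenvalue [x]. This treats the two modules at once. *)
Inductive kd := KA | KD | KM | KP.

(** * Canonical bases *)

Section KL.
Variables (G : finType) (Sg : Type) (SS : Sg -> Prop).
Local Notation V := {ffun G -> laurent^o}.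
Variables (kind : Sg -> G -> kd) (mv : Sg -> G -> G) (ln : G -> nat).
Hypothesis kA : forall s z, SS s -> kind s z = KA ->
  [/\ kind s (mv s z) = KD, mv s (mv s z) = z & ln (mv s z) = (ln z).+2].
Hypothesis kD : forall s z, SS s -> kind s z = KD ->
  [/\ kind s (mv s z) = KA, mv s (mv s z) = z & ln z = (ln (mv s z)).+2].
Variable A : Sg -> V -> V.
Hypothesis HA : forall s (v : V) z, SS s -> A s v z = match kind s z with
  | KA => v (mv s z)
  | KD => v (mv s z) + (xL - xLi) * v z
  | KM => - xLi * v z
  | KP => xL * v z end :> laurent.
Implicit Types (s : Sg) (u w y z : G) (v b : V) (a : laurent).

Definition ebas y : V := [ffun z => ((z == y)%:R : laurent)].

Lemma EE y z : ebas y z = (z == y)%:R :> laurent. Proof. by rewrite ffunE. Qed.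
Lemma vD v v' z : (v + v') z = v z + v' z :> laurent. Proof. by rewrite ffunE. Qed.
Lemma vN v z : (- v) z = - v z :> laurent. Proof. by rewrite ffunE. Qed.
Lemma vZ a v z : (a *: v) z = a * v z :> laurent. Proof. by rewrite ffunE. Qed.
Lemma v0 z : (0 : V) z = 0 :> laurent. Proof. by rewrite ffunE. Qed.
Lemma vS (I : Type) (r : seq I) (Q : pred I) (F : I -> V) z :
  (\sum_(i <- r | Q i) F i) z = \sum_(i <- r | Q i) (F i z : laurent) :> laurent.
Proof. by rewrite sum_ffunE. Qed.
Lemma v_ext v v' : (forall z, v z = v' z :> laurent) -> v = v'.
Proof. by move=> H; apply/ffunP. Qed.

Lemma vE v : v = \sum_z (v z : laurent) *: ebas z.
Proof.
apply: v_ext => z; rewrite vS (bigD1 z) //= vZ EE eqxx mulr1 big1 ?addr0 // => y ny.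
by rewrite vZ EE eq_sym (negPf ny) mulr0.
Qed.

Lemma A_add s v v' : SS s -> A s (v + v') = A s v + A s v'.
Proof.
by move=> S; apply: v_ext => z; rewrite vD !HA // !vD; case: (kind s z); ring.
Qed.

Lemma A_scale s a v : SS s -> A s (a *: v) = a *: A s v.
Proof.
by move=> S; apply: v_ext => z; rewrite vZ !HA // !vZ; case: (kind s z); ring.
Qed.

Lemma A_quad s v : SS s -> A s (A s v) = (xL - xLi) *: A s v + v.
Proof.
move=> S; apply: v_ext => z; rewrite vD vZ !HA //; case K: (kind s z).
- by have [-> -> _] := kA S K; ring.
- have [K' -> _] := kD S K; rewrite K'; ring.
- by ring: xLxLi.
- by ring: xLxLi.
Qed.

Variable beta : V -> V.
Hypothesis b_add : forall v v', beta (v + v') = beta v + beta v'.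
Hypothesis b_scale : forall a v, beta (a *: v) = lb a *: beta v.
Hypothesis b_A : forall s v, SS s -> beta (A s v) = A s (beta v) - (xL - xLi) *: beta v.
Hypothesis b_min : forall z, (forall s, SS s -> kind s z <> KD) -> beta (ebas z) = ebas z.

Lemma b_0 : beta 0 = 0.
Proof. by rewrite -(scale0r 0) b_scale lbar0 !scale0r. Qed.

Lemma b_N v : beta (- v) = - beta v.
Proof. by rewrite -scaleN1r b_scale lbarN lbar1 scaleN1r. Qed.

Lemma b_sum (I : Type) (r : seq I) (Q : pred I) (F : I -> V) :
  beta (\sum_(i <- r | Q i) F i) = \sum_(i <- r | Q i) beta (F i).
Proof. by apply: (big_morph beta b_add b_0). Qed.

Lemma lb_xd : lb (xL - xLi) = - (xL - xLi).
Proof. by rewrite lbarD lbarN lbar_xL lbar_xLi; ring. Qed.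

Lemma E_des s z : SS s -> kind s z = KD -> ebas z = A s (ebas (mv s z)).
Proof.
move=> S K; have [K' M _] := kD S K; apply: v_ext => y; rewrite HA // !EE.
case Ky: (kind s y).
- have [Ky' My _] := kA S Ky; have [e|_] := eqVneq y z; first by rewrite e K in Ky.
  by have [e|//] := eqVneq (mv s y) (mv s z); rewrite e K' in Ky'.
- have [Ky' My _] := kD S Ky; have [e|/eqP e] := eqVneq y (mv s z).
    by rewrite e K' in Ky.
  have [->|D] := eqVneq y z; first by rewrite eqxx mulr0 addr0.
  have [h|_] := eqVneq (mv s y) (mv s z); last by rewrite mulr0 addr0.
  by move: My; rewrite h M => /esym/eqP; rewrite (negPf D).
- have [e|/eqP e] := eqVneq y (mv s z); first by rewrite e K' in Ky.
  by have [h|_] := eqVneq y z; [rewrite h K in Ky | rewrite mulr0].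
- have [e|/eqP e] := eqVneq y (mv s z); first by rewrite e K' in Ky.
  by have [h|_] := eqVneq y z; [rewrite h K in Ky | rewrite mulr0].
Qed.

Lemma des_ind (Q : G -> Prop) :
  (forall z, (forall s, SS s -> kind s z <> KD) -> Q z) ->
  (forall s z, SS s -> kind s z = KD -> (forall y, (ln y < ln z)%N -> Q y) -> Q z) ->
  forall z, Q z.
Proof.
move=> H1 H2 z; have [k] := ubnP (ln z); elim: k z => // k IH z hk.
case: (pselect (exists s, SS s /\ kind s z = KD)) => [[s [S K]]|H]; last first.
  by apply: H1 => s S K; apply: H; exists s.
by apply: (H2 s) => // y hy; apply: IH; apply: leq_trans hy _.
Qed.

Lemma mvK s z : SS s -> kind s z = KA \/ kind s z = KD -> mv s (mv s z) = z.
Proof. by move=> S [K|K]; [have [] := kA S K | have [] := kD S K]. Qed.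

Lemma b_triangular z y : (ln z <= ln y)%N -> beta (ebas z) y = (y == z)%:R :> laurent.
Proof.
elim/des_ind: z y => [z Hz|s z S K IH] y hy; first by rewrite b_min // EE.
have [K' M L] := kD S K; rewrite (E_des S K) b_A //; set w := mv s z in K' M L *.
have hw : (ln w < ln z)%N by rewrite L; exact: leqnSn.
have IHw u : (ln w <= ln u)%N -> beta (ebas w) u = (u == w)%:R :> laurent by exact: IH.
have wy : (ln w <= ln y)%N by clear -hw hy; lia.
have ny : (y == w) = false by apply/eqP => e; rewrite e in hy; clear -hw hy; lia.
have E2 : A s (beta (ebas w)) y = (y == z)%:R :> laurent.
  rewrite HA // (IHw y) // ny !mulr0; case Ky: (kind s y).
  - have [Ky' My Ly] := kA S Ky.
    have [e|e] := eqVneq y z; first by rewrite e K in Ky.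
    rewrite IHw; last by rewrite Ly; clear -wy; lia.
    have [h|//] := eqVneq (mv s y) w.
    by move: My e; rewrite h M => ->; rewrite eqxx.
  - have [Ky' My Ly] := kD S Ky; rewrite addr0.
    rewrite IHw; last by move: hy; rewrite L Ly; clear; lia.
    have [e|e] := eqVneq y z; first by rewrite e eqxx.
    have [h|//] := eqVneq (mv s y) w.
    by move: My e; rewrite h M => ->; rewrite eqxx.
  - by have [e|//] := eqVneq y z; rewrite e K in Ky.
  - by have [e|//] := eqVneq y z; rewrite e K in Ky.
by rewrite vD vN vZ E2 (IHw y) // ny mulr0 subr0.
Qed.

Lemma b_top v u : (forall z, (ln u < ln z)%N -> v z = 0 :> laurent) ->
  beta v u = lb (v u) :> laurent.
Proof.
move=> H; rewrite {1}(vE v) b_sum vS (bigD1 u) //= b_scale vZ b_triangular // eqxx mulr1.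
rewrite big1 ?addr0 // => z nz; rewrite b_scale vZ.
have [h|h] := leqP (ln z) (ln u); last by rewrite H // lbar0 mul0r.
by rewrite b_triangular // eq_sym (negPf nz) mulr0.
Qed.

Lemma max_support v : v <> 0 -> exists u, v u <> 0 :> laurent /\
  forall z, (ln u < ln z)%N -> v z = 0 :> laurent.
Proof.
move=> nv; have [u0 hu0] : exists u, (v u : laurent) != 0.
  apply: contrapT => H; apply: nv; apply: v_ext => z; rewrite v0.
  by apply/eqP/negPn/negP => h; apply: H; exists z.
case: (@arg_maxnP _ u0 (fun u => (v u : laurent) != 0) ln hu0) => u hu M; exists u.
split; first exact/eqP.
by move=> z hz; apply/eqP/negPn/negP => h; have := M z h; clear -hz; lia.
Qed.

(* A bar invariant element vanishes as soon as the top coefficients of its support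
   cannot be bar invariant. *)
Lemma b_fixed0 v : beta v = v ->
  (forall u, (forall z, (ln u < ln z)%N -> v z = 0 :> laurent) ->
     lb (v u) = v u :> laurent -> v u = 0 :> laurent) -> v = 0.
Proof.
move=> B H; apply: contrapT => /max_support [u [h1 h2]]; apply: h1; apply: H => //.
by rewrite -b_top // B.
Qed.

Lemma b_fixed_lneg v : beta v = v -> (forall u, lneg (v u)) -> v = 0.
Proof. by move=> B H; apply: b_fixed0 => // u _; apply: lneg_bar_fixed. Qed.

Definition canonical_family (c : G -> V) := forall z, [/\ beta (c z) = c z, c z z = 1 :> laurent &
  forall y, y != z -> ((c z y : laurent) != 0 -> (ln y < ln z)%N) /\ lneg (c z y)].

Lemma canonical_uniq c c' : canonical_family c -> canonical_family c' -> c = c'.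
Proof.
move=> H H'; apply: funext => z; apply/eqP; rewrite -subr_eq0; apply/eqP.
have [b1 b2 b3] := H z; have [d1 d2 d3] := H' z.
apply: b_fixed_lneg; first by rewrite b_add b_N b1 d1.
move=> u j hj; rewrite vD vN lcB; have [->|nu] := eqVneq u z; first by rewrite b2 d2 subrr.
by rewrite (b3 u nu).2 // (d3 u nu).2 // subrr.
Qed.

(** Each move changes the length by two, so the parity of half the length alternates along moves; it
    is the bipartition. *)
Definition color z := odd (ln z)./2.

Lemma col_mv s z : SS s -> kind s z = KA \/ kind s z = KD -> color (mv s z) = ~~ color z.
Proof.
rewrite /color => S [K|K]; first by have [_ _ ->] := kA S K.
by have [_ _ ->] := kD S K; rewrite /= negbK.
Qed.

Definition good z (b : V) := [/\ beta b = b, b z = 1 :> laurent,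
  (forall y, y != z -> ((b y : laurent) != 0 -> (ln y < ln z)%N) /\ lneg (b y)) &
  forall y, lpar (color z (+) color y) (b y)].

Lemma good_min z : (forall s, SS s -> kind s z <> KD) -> good z (ebas z).
Proof.
move=> H; split; [exact: b_min | by rewrite EE eqxx | |].
  move=> y ny; rewrite EE (negPf ny); split; last exact: lneg0.
  by rewrite eqxx.
move=> y; rewrite EE; have [->|_] := eqVneq y z; last exact: lpar0.
by rewrite addbb; exact: (@lpar_int 1).
Qed.

(** The element [H_s + x^-1] is bar invariant. Applied to the basis element of [mv s z] it gives
    everything wanted at [z], except that constant terms may appear. *)
Lemma good_step s z (b : V) (w := mv s z) : SS s -> kind s z = KD -> good w b ->
  let b' := A s b + xLi *: b in
  [/\ beta b' = b', b' z = 1 :> laurent,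
  (forall y, y != z -> ((b' y : laurent) != 0 -> (ln y < ln z)%N) /\ lnpos (b' y)) &
  forall y, lpar (color z (+) color y) (b' y)].
Proof.
move=> S K [b1 b2 b3 b4] b'; have [K' M L] := kD S K; rewrite -/w in K' M L.
have hw : (ln w < ln z)%N by rewrite L; exact: leqnSn.
have cw : color z = ~~ color w by rewrite /w (col_mv S) ?negbK //; right.
have np y : lnpos (b y).
  by have [->|ny] := eqVneq y w; [rewrite b2; exact: (@lnpos_int 1) | apply: lnegW; exact: (b3 y ny).2].
have np1 y : lnpos (xLi * b y) by apply: lnegW; apply: lnpos_xLi.
have bz : b z = 0 :> laurent.
  apply/eqP/negPn/negP => h; have nz : z != w by apply/eqP => e; move: hw; rewrite {1}e ltnn.
  by have := (b3 z nz).1 h; clear -hw; lia.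
have bE y : b' y = match kind s y with
    | KA => b (mv s y) + xLi * b y | KD => b (mv s y) + xL * b y
    | KM => 0 | KP => (xL + xLi) * b y end :> laurent.
  by rewrite vD vZ HA //; case: (kind s y); ring.
split.
- rewrite b_add b_A // b_scale b1 lbar_xLi -addrA -scaleNr -scalerDl.
  by congr (_ + _ *: _); ring.
- by rewrite bE K bz mulr0 addr0 b2.
- have lt y : y != z -> (b y : laurent) != 0 -> (ln y < ln z)%N.
    move=> _ h; have [e|ny] := eqVneq y w; first by rewrite e.
    by have := (b3 y ny).1 h; clear -hw; lia.
  have ltm y : y != z -> kind s y = KA \/ kind s y = KD -> (b (mv s y) : laurent) != 0 -> (ln y < ln z)%N.
    move=> ny Ky h; have My := mvK S Ky.
    have nw : mv s y != w by apply: contra_neq ny => e; rewrite -My e M.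
    have := (b3 _ nw).1 h; rewrite L.
    by case: Ky => [/(kA S)[_ _ ->]|/(kD S)[_ _ ->]]; clear; lia.
  have lp y : y != z -> kind s y = KA \/ kind s y = KD -> lneg (b (mv s y)).
    move=> ny Ky; have My := mvK S Ky.
    by apply: (b3 _ _).2; apply: contra_neq ny => e; rewrite -My e M.
  have nx y : y != z -> kind s y <> KA -> lnpos (xL * b y).
    move=> ny ky; apply: lneg_xL; apply: (b3 y _).2; apply/eqP => e; apply: ky.
    by rewrite e.
  have nz0 (a a' : laurent) : a + a' != 0 -> a != 0 \/ a' != 0.
    by have [->|] := eqVneq a 0; [rewrite add0r; right | left].
  have nzM (a a' : laurent) : a * a' != 0 -> a' != 0.
    by apply: contra_neq => ->; rewrite mulr0.
  move=> y ny; rewrite bE; case Ky: (kind s y).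
  + split; last by apply: lnposD => //; apply: lnegW; apply: lp => //; left.
    by case/nz0 => [|/nzM]; [apply: ltm => //; left | apply: lt].
  + split; last by apply: lnposD; [apply: lnegW; apply: lp => //; right | apply: nx => //; rewrite Ky].
    by case/nz0 => [|/nzM]; [apply: ltm => //; right | apply: lt].
  + by rewrite eqxx; split=> //; apply: lnegW; exact: lneg0.
  + split; first by move/nzM; apply: lt.
    by rewrite mulrDl; apply: lnposD => //; apply: nx => //; rewrite Ky.
- move=> y; rewrite cw addNb.
  have xp : lpar (~~ (color w (+) color y)) (xL * b y) by apply: lpar_xL; apply: b4.
  have xip : lpar (~~ (color w (+) color y)) (xLi * b y) by apply: lpar_xLi; apply: b4.
  have mp : kind s y = KA \/ kind s y = KD -> lpar (~~ (color w (+) color y)) (b (mv s y)).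
    by move=> Ky; have := b4 (mv s y); rewrite (col_mv S Ky) addbN.
  rewrite bE; case Ky: (kind s y).
  + by apply: lparD => //; apply: mp; left.
  + by apply: lparD => //; apply: mp; right.
  + exact: lpar0.
  + by rewrite mulrDl; apply: lparD.
Qed.

Lemma good_ex z : exists b, good z b.
Proof.
elim/des_ind: z => [z Hz|s z S K IH]; first by exists (ebas z); apply: good_min.
have [K' M L] := kD S K.
have hw : (ln (mv s z) < ln z)%N by rewrite L; exact: leqnSn.
have [b Hb] := IH _ hw; have [] := good_step S K Hb; set b' := _ + _ => b1 b2 b3 b4.
have /choice [c Hc] y : exists b, (ln y < ln z)%N -> good y b.
  have [h|h] := ltnP (ln y) (ln z); last by exists 0.
  by have [d Hd] := IH _ h; exists d.
(* All constant terms can be removed at once, because [c y] has a constant term only at [y]. The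
   multiples are integers, so bar invariance is kept. *)
pose k y := lc (b' y) 0.
exists (b' - \sum_(y | (ln y < ln z)%N) (k y)%:~R *: c y).
have pE u : (b' - \sum_(y | (ln y < ln z)%N) (k y)%:~R *: c y) u =
    b' u - \sum_(y | (ln y < ln z)%N) (k y)%:~R * c y u :> laurent.
  by rewrite vD vN vS; congr (_ - _); apply: eq_bigr => y _; rewrite vZ.
have c0 y u : (ln y < ln z)%N -> (ln z <= ln u)%N -> c y u = 0 :> laurent.
  move=> h1 h2; apply/eqP/negPn/negP => h; have [_ _ h3 _] := Hc y h1.
  have nu : u != y by apply/eqP => e; move: h2; rewrite e leqNgt h1.
  by have := (h3 u nu).1 h; clear -h1 h2; lia.
split.
- rewrite b_add b_N b_sum b1; congr (_ - _); apply: eq_bigr => y h.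
  by rewrite b_scale lbar_int; have [-> _ _ _] := Hc y h.
- by rewrite pE b2 big1 ?subr0 // => y h; rewrite c0 // mulr0.
- move=> u nu; have [bu1 bu2] := b3 u nu; rewrite pE.
  have [h|h] := ltnP (ln u) (ln z); last first.
    have -> : b' u = 0 :> laurent.
      by apply/eqP/negPn/negP => /bu1; rewrite ltnNge h.
    rewrite big1 => [|y hy]; last by rewrite c0 // mulr0.
    by rewrite subr0 eqxx; split=> //; exact: lneg0.
  split; first by move=> _.
  have [_ cu _ _] := Hc u h.
  rewrite (bigD1 u) //= cu mulr1 opprD addrA.
  have N2 : lneg (\sum_(y | (ln y < ln z)%N && (y != u)) (k y)%:~R * c y u).
    move=> j hj; rewrite lc_sum big1 // => y /andP[hy ny]; rewrite lc_intM.
    have [_ _ h3 _] := Hc y hy; rewrite eq_sym in ny.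
    by rewrite (h3 u ny).2 // mulr0.
  apply: lneg_lnpos; last by rewrite !lcB lc_int eqxx subrr N2 // subr0.
  apply: lnposD; last by apply: lnposN; apply: lnegW.
  by apply: lnposD => //; apply: lnposN; apply: lnpos_int.
- move=> u; rewrite pE; apply: lparD; first exact: b4.
  apply: lparN; apply: lpar_sum => y h; have [_ _ _ h4] := Hc y h.
  have [->|nk] := eqVneq (k y) 0; first by rewrite mul0r; exact: lpar0.
  (* A constant term has exponent 0, which is even, so it occurs only between elements of the same
     colour and the parity survives. *)
  have /esym := b4 y 0 nk; rewrite /= => /eqP; rewrite -[_ == _]negb_add addbF => /negPf e.
  have -> : color z = color y by move: e; case: (color z); case: (color y).
  by apply: lpar_intM; apply: h4.
Qed.

Lemma canonical_ex : exists c, canonical_family c /\ forall z y, lpar (color z (+) color y) (c z y).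
Proof.
have /choice [c Hc] := good_ex; exists c; split=> [z|z y]; have [] := Hc z => //.
Qed.

Section Canon.
Variable c : G -> V.
Hypothesis Hc : canonical_family c.

Lemma c_fix z : beta (c z) = c z. Proof. by have [] := Hc z. Qed.
Lemma c_diag z : c z z = 1 :> laurent. Proof. by have [] := Hc z. Qed.
Lemma c_lneg z y : y != z -> lneg (c z y). Proof. by have [_ _ H] := Hc z => /H[]. Qed.
Lemma c_out z y : (ln z <= ln y)%N -> y != z -> c z y = 0 :> laurent.
Proof.
move=> h ny; have [_ _ H] := Hc z; apply/eqP/negPn/negP => h'.
by have := (H y ny).1 h'; rewrite ltnNge h.
Qed.
Lemma c_lnpos z y : lnpos (c z y).
Proof.
have [->|ny] := eqVneq y z; last by apply: lnegW; exact: c_lneg.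
by rewrite c_diag; exact: (@lnpos_int 1).
Qed.

Definition inI s u := match kind s u with KA | KM => true | _ => false end.

(** The difference is bar invariant, so it suffices to look at top points of its support. At an
    eigenvalue [- x^-1], the coefficient is an integer by bar invariance, and no nonzero integer is
    [x + x^-1] times an element of [x^-1 Z[x^-1]]. *)
Lemma c_des s w : SS s -> ~~ inI s w -> A s (c w) = xL *: c w.
Proof.
move=> S Iw; apply/eqP; rewrite -subr_eq0; apply/eqP; set d := _ - _.
have dE u : d u = match kind s u with
    | KA => c w (mv s u) - xL * c w u | KD => c w (mv s u) - xLi * c w u
    | KM => - ((xL + xLi) * c w u) | KP => 0 end :> laurent.
  by rewrite vD vN vZ HA //; case: (kind s u); ring.
apply: b_fixed0 => [|u top].
  rewrite b_add b_N b_A // b_scale c_fix lbar_xL scalerBl opprB.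
  by rewrite [_ *: _ - _]addrC addrA addrK.
case Ku: (kind s u).
- have [K' M L] := kA S Ku; have := top (mv s u); rewrite L => /(_ (leqnSn _)).
  rewrite !dE K' M Ku => E _; have -> : c w u = xLi * c w (mv s u) :> laurent.
    by apply/eqP; rewrite -subr_eq0 E.
  by ring: xLxLi.
- have [K' M L] := kD S Ku; apply: lneg_bar_fixed; rewrite dE Ku => j hj.
  rewrite lcB c_lneg // ?lnpos_xLi ?subrr //; first exact: c_lnpos.
  by apply/eqP => e; move: Iw; rewrite -e /inI K'.
- have nw : u != w by apply/eqP => e; move: Iw; rewrite -e /inI Ku.
  rewrite dE Ku => B; have np : lnpos (- ((xL + xLi) * c w u)).
    rewrite mulrDl; apply: lnposN; apply: lnposD; first by apply: lneg_xL; apply: c_lneg.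
    by apply: lnegW; apply: lnpos_xLi; apply: c_lnpos.
  have E := lnpos_bar_fixed np B; rewrite E.
  have E' : (xL + xLi) * c w u = (- lc (- ((xL + xLi) * c w u)) 0)%:~R :> laurent.
    by rewrite mulrNz -E opprK.
  have /eqP := lneg_mul_xDxi (c_lneg nw) E'; rewrite oppr_eq0 => /eqP ->.
  by rewrite mulr0z.
- by rewrite dE Ku.
Qed.

Definition mucoef y z := lc (c z y) (-1).

Definition cover s y u : bool := if kind s y is KA then mv s y == u else false.

(** Compares coefficients at [y] in [c_des]. One of the two summands of [omega] is thereby 0 or 1,
    and accounts for the leading term [mv s y] of [A s (c y)]. *)
Lemma mu_up s y u : SS s -> inI s y -> ~~ inI s u ->
  mucoef y u = (cover s y u)%:R.
Proof.
move=> S Iy Iu; have := congr1 (fun v : V => (v y : laurent)) (c_des S Iu).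
rewrite /mucoef /cover HA // vZ; move: Iy; rewrite /inI; case Ky: (kind s y) => // _ E.
  have [K' M L] := kA S Ky.
  have -> : lc (c u y) (-1) = lc (c u (mv s y)) 0 by rewrite E lc_xL.
  have [->|ne] := eqVneq (mv s y) u; first by rewrite c_diag lc1.
  by rewrite c_lneg.
have ny : y != u by apply/eqP => e; move: Iu; rewrite -e /inI Ky.
have := congr1 (fun f => lc f 0) E; rewrite /= lc_xL mulNr lcN lc_xLi => <-.
by rewrite c_lneg ?oppr0.
Qed.

Lemma c_asc s y : SS s -> inI s y -> A s (c y) = - xLi *: c y +
  \sum_(w | ~~ inI s w) (mucoef y w + mucoef w y)%:~R *: c w.
Proof.
move=> S Iy; pose k w := mucoef y w + mucoef w y.
suff : A s (c y) + xLi *: c y - \sum_(w | ~~ inI s w) (k w)%:~R *: c w = 0.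
  move/eqP; rewrite subr_eq0 => /eqP E.
  by rewrite scaleNr addrC; apply/eqP; rewrite -subr_eq opprK; apply/eqP.
apply: b_fixed_lneg.
  rewrite !b_add b_N b_A // b_scale c_fix b_sum lbar_xLi; congr (_ - _).
    by rewrite -addrA -scaleNr -scalerDl; congr (_ + _ *: _); ring.
  by apply: eq_bigr => v _; rewrite b_scale c_fix lbar_int.
move=> u; pose d := A s (c y) + xLi *: c y.
have dE : d u = match kind s u with
    | KA => c y (mv s u) + xLi * c y u | KD => c y (mv s u) + xL * c y u
    | KM => 0 | KP => (xL + xLi) * c y u end :> laurent.
  by rewrite vD vZ HA //; case: (kind s u); ring.
(* At [u] only the summand of index [u] can have a constant term, so everything reduces to the
   single coefficient [d u]. *)
have part (Q : pred G) : (forall w, Q w -> w != u) ->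
    lneg (\sum_(w | ~~ inI s w && Q w) (k w)%:~R * c w u).
  move=> HQ j hj; rewrite lc_sum big1 // => v /andP[_ /HQ h].
  by rewrite lc_intM c_lneg ?mulr0 // eq_sym.
suff Hd : lneg (d u - (if inI s u then 0 else k u)%:~R).
  move=> j hj; rewrite vD vN vS (eq_bigr (fun w => (k w)%:~R * c w u : laurent)); last first.
    by move=> v _; rewrite vZ.
  rewrite -/d; have := Hd j hj; case: ifPn => Iu.
    rewrite subr0 lcB => ->; rewrite (eq_bigl (fun w => ~~ inI s w && (w != u))); last first.
      by move=> w; have [->|] := eqVneq w u; [rewrite Iu | rewrite andbT].
    by rewrite part // subr0.
  by move=> h; rewrite (bigD1 u) //= c_diag mulr1 opprD addrA lcB h part // subrr.
have nI w : ~~ inI s w -> w != y by move=> h; apply: contraNneq h => ->.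
rewrite /inI; case Ku: (kind s u).
- have [K' M L] := kA S Ku; rewrite dE Ku subr0 => j hj.
  rewrite lcD c_lneg ?lnpos_xLi ?addr0 //; first exact: c_lnpos.
  by apply: nI; rewrite /inI K'.
- have [K' M L] := kD S Ku; have Iu : ~~ inI s u by rewrite /inI Ku.
  have ny := nI _ Iu; rewrite dE Ku /k (mu_up S Iy Iu).
  have [e|e] := eqVneq (mv s u) y.
    have -> : c y u = 0 :> laurent by apply: c_out => //; rewrite L e; apply: leqW.
    rewrite /cover -e K' M eqxx /mucoef e c_diag c_out //; last by rewrite L e; apply: leqW.
    by rewrite lc0 addr0 mulr0 addr0 subrr; exact: lneg0.
  have -> : cover s y u = false.
      rewrite /cover.
    by case Ky: (kind s y) => //; apply: contra_neqF e => /eqP <-; have [_ -> _] := kA S Ky.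
  rewrite add0r; apply: lneg_lnpos.
    apply: lnposD; last by apply: lnposN; apply: lnpos_int.
    by apply: lnposD; [apply: lnegW; apply: c_lneg | apply: lneg_xL; apply: c_lneg].
  by rewrite lcB lcD lc_xL lc_int eqxx c_lneg // add0r subrr.
- by rewrite dE Ku subrr; exact: lneg0.
- have Iu : ~~ inI s u by rewrite /inI Ku.
  have ny := nI _ Iu; rewrite dE Ku /k (mu_up S Iy Iu).
  have -> : cover s y u = false.
      rewrite /cover.
    case Ky: (kind s y) => //; have [K' _ _] := kA S Ky.
    by apply/eqP => e; rewrite e Ku in K'.
  rewrite add0r mulrDl; apply: lneg_lnpos.
    apply: lnposD; last by apply: lnposN; apply: lnpos_int.
    apply: lnposD; first by apply: lneg_xL; apply: c_lneg.
    by apply: lnegW; apply: lnpos_xLi; apply: c_lnpos.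
  by rewrite lcB lcD lc_xL lc_xLi lc_int eqxx (c_lneg ny (_ : 0 <= 0 + 1)) // addr0 sub0r subrr.
Qed.

Definition phi v : V := \sum_z (v z : laurent) *: c z.

Lemma phi_add v v' : phi (v + v') = phi v + phi v'.
Proof.
rewrite /phi -big_split; apply: eq_bigr => z _.
by rewrite vD scalerDl.
Qed.

Lemma phi_scale a v : phi (a *: v) = a *: phi v.
Proof.
rewrite /phi scaler_sumr; apply: eq_bigr => z _.
by rewrite vZ scalerA.
Qed.

Lemma phi_0 : phi 0 = 0.
Proof. by rewrite -(scale0r 0) phi_scale !scale0r. Qed.

Lemma phi_sum (I : Type) (r : seq I) (Q : pred I) (F : I -> V) :
  phi (\sum_(i <- r | Q i) F i) = \sum_(i <- r | Q i) phi (F i).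
Proof. by apply: (big_morph phi phi_add phi_0). Qed.

Lemma phi_E z : phi (ebas z) = c z.
Proof.
rewrite /phi (bigD1 z) //= EE eqxx scale1r big1 ?addr0 // => y ny.
by rewrite EE (negPf ny) scale0r.
Qed.

Lemma phi_inj v : phi v = 0 -> v = 0.
Proof.
move=> H; apply: contrapT => /max_support [u [h1 h2]]; apply: h1.
have := congr1 (fun v : V => (v u : laurent)) H; rewrite /= v0 /phi vS (bigD1 u) //= vZ c_diag mulr1.
rewrite big1 ?addr0 // => z nz; rewrite vZ.
have [h|h] := leqP (ln z) (ln u); last by rewrite h2 // mul0r.
by rewrite c_out ?mulr0 // eq_sym.
Qed.

Lemma phi_surj v : exists v', phi v' = v.
Proof.
have H z : exists v', phi v' = ebas z.
  have [k] := ubnP (ln z); elim: k z => // k IH z hk.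
  have /choice [g Hg] y : exists v', (ln y < ln z)%N -> phi v' = ebas y.
    have [h|h] := ltnP (ln y) (ln z); last by exists 0.
    by have [|v' Hv] := IH y; [apply: leq_trans h _ | exists v'].
  exists (ebas z - \sum_(y | (ln y < ln z)%N) (c z y : laurent) *: g y).
  rewrite phi_add -scaleN1r phi_scale phi_sum phi_E.
  rewrite (eq_bigr (fun y => (c z y : laurent) *: ebas y)); last first.
    by move=> y h; rewrite phi_scale Hg.
  apply: v_ext => u; rewrite vD vZ vS (eq_bigr (fun y => (c z y * (u == y)%:R : laurent))); last first.
    by move=> y _; rewrite vZ EE.
  have [h|h] := ltnP (ln u) (ln z).
    rewrite (bigD1 u) //= eqxx mulr1 big1 => [|y /andP[_ ny]]; last by rewrite eq_sym (negPf ny) mulr0.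
    rewrite EE; have [e|_] := eqVneq u z; first by rewrite e ltnn in h.
    by rewrite addr0 mulN1r subrr.
  rewrite big1 => [|y hy]; last first.
    by have [e|_] := eqVneq u y; [move: h; rewrite e leqNgt hy | rewrite mulr0].
  rewrite mulr0 addr0 EE; have [->|ne] := eqVneq u z; first exact: c_diag.
  exact: c_out.
have /choice [g Hg] := H; exists (\sum_z (v z : laurent) *: g z).
by rewrite phi_sum [RHS]vE; apply: eq_bigr => z _; rewrite phi_scale Hg.
Qed.

Lemma phi_bij : bijective phi.
Proof.
have /choice [g Hg] := phi_surj; exists g => // v.
apply/eqP; rewrite -subr_eq0; apply/eqP; apply: phi_inj.
by rewrite phi_add -scaleN1r phi_scale Hg scaleN1r subrr.
Qed.

Lemma phi_inter s (Yb : G -> V) (om : G -> G -> laurent) v : SS s ->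
  (forall u, Yb u = if ~~ inI s u then xL *: ebas u
     else - xLi *: ebas u + \sum_(w | ~~ inI s w) om u w *: ebas w) ->
  (forall u w, inI s u -> ~~ inI s w -> om u w = (mucoef u w + mucoef w u)%:~R) ->
  phi (\sum_u (v u : laurent) *: Yb u) = A s (phi v).
Proof.
move=> S HY Hom; have A0 : A s 0 = 0 by rewrite -(scale0r 0) A_scale // !scale0r.
rewrite phi_sum {2}/phi (big_morph (A s) (fun f g => A_add f g S) A0).
apply: eq_bigr => u _; rewrite phi_scale A_scale //; congr (_ *: _); rewrite HY.
case: ifPn => Iu; first by rewrite phi_scale phi_E c_des.
rewrite negbK in Iu; rewrite phi_add phi_scale phi_sum phi_E c_asc //.
by congr (_ + _); apply: eq_bigr => w Iw; rewrite phi_scale phi_E Hom.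
Qed.
End Canon.
End KL.

(** * The modules M and N *)

Section Kinds.
Variables (n : nat) (t : ctype).
Hypothesis hn : (1 < n)%N.
Local Notation N := (n.*2).
Local Notation P := {perm pt N}.
Local Notation neg := (negp n).
Local Notation simple := (@simple_root n t).
Local Notation len := (lenG t n).
Local Notation Gp := (@inG n t).
Local Notation Gt := (Gty t n).
Local Notation V := {ffun Gt -> laurent^o}.
Local Notation SS := (fun s : P => is_true (s \in Sset t n)).
Implicit Types (p q x : pt N) (w s : P) (y z : Gt) (v : V) (b : bool).

Lemma Gt_Gp z : Gp (val z). Proof. exact/Gset_Gp/(valP z). Qed.

Lemma SsetP s : SS s <-> exists p q, simple n p q /\ s = refl p q.
Proof.
have -> : SS s = (s \in gens t N n) by rewrite inE.
by apply: gens_simple; clear -hn; lia.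
Qed.

Lemma DesEqE p q z : simple n p q -> (refl p q \in DesEq t n (val z)) = fx p q (val z).
Proof.
move=> S; rewrite inE; have -> : refl p q \in Sset t n by apply/SsetP; exists p, q.
rewrite -fxE ?(Fz_BC (Gp_F (Gt_Gp z))) ?(simple_neq S) //.
by rewrite /lmul /= eq_sym.
Qed.

Lemma AscEqE p q z : simple n p q -> (refl p q \in AscEq t n (val z)) = `[< aeq p q (val z) >].
Proof.
move=> S; rewrite inE; have -> : refl p q \in Sset t n by apply/SsetP; exists p, q.
have Hz := Gp_F (Gt_Gp z); have Dq := simple_neq S; have Bz := Fz_BC Hz.
rewrite /lmul /=; set w := val z in Hz Bz *.
have ww : (w * w = 1)%g by rewrite -{1}(Fz_inv Hz) mulVg.
have E p' q' : q' != neg p' -> ((w * refl p q) * w == refl p' q')%g = same_root (w p) (w q) p' q'.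
  move=> D'; rewrite -conj_refl //; apply/eqP/eqP => [<-|E].
    by rewrite !mulgA ww mul1g.
  by rewrite -mulgA E mulgA ww mul1g.
rewrite !inE; apply/mapP/asboolP => [[i Hi Ei]|[p' [q' [h1 h2 H]]]].
  rewrite mem_iota in Hi.
  have [p' hp] : exists x : pt N, sval x = - i%:Z by apply: sval_ex; clear -Hi hn; lia.
  have [q' hq] : exists x : pt N, sval x = i.+1%:Z by apply: sval_ex; clear -Hi hn; lia.
  exists p', q'; split; [rewrite hp; clear -Hi; lia | rewrite hp hq; clear; lia |].
  rewrite -E; last by rewrite sval_eq sval_neg hp hq; clear; lia.
  by rewrite Ei (sgen_refl hp hq).
exists (absz (sval p')).
  by rewrite mem_iota; have := sval_bnd q'; clear -h1 h2 hn; lia.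
rewrite (@sgen_refl n _ p' q'); [|by clear -h1; lia | by rewrite h2; clear -h1; lia].
apply/eqP; rewrite E // sval_eq sval_neg h2; clear; lia.
Qed.

Lemma len_lmul p q z : simple n p q ->
  if posr (val z p) (val z q) then len (lmul (refl p q) (val z)) = (len (val z)).+1
  else len (val z) = (len (lmul (refl p q) (val z))).+1.
Proof.
move=> S; have SN := simple_N S; have Hz := Gp_F (Gt_Gp z); have W := Fz_WG Hz.
case: ifPn => h; [apply: len_upl | apply: len_dnl] => //; rewrite (Fz_inv Hz) //.
Qed.

Lemma AscLtE p q z : simple n p q -> (refl p q \in AscLt t n (val z)) =
  [&& ~~ fx p q (val z), ~~ `[< aeq p q (val z) >] & posr (val z p) (val z q)].
Proof.
move=> S; rewrite !in_setD in_setU DesEqE // AscEqE // inE.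
have -> : refl p q \in Sset t n by apply/SsetP; exists p, q.
rewrite negb_or -andbA; congr [&& _, _ & _]; have := len_lmul z S.
by case: ifP => _ E; rewrite E /= ?ltnSn //; apply/negbTE; rewrite -leqNgt.
Qed.

Lemma DesLtE p q z : simple n p q -> (refl p q \in DesLt t n (val z)) = dsc p q (val z).
Proof.
move=> S; rewrite !in_setD in_setU DesEqE // AscEqE // inE.
have -> : refl p q \in Sset t n by apply/SsetP; exists p, q.
rewrite /dsc negb_or -andbA; congr [&& _, _ & _]; have := len_lmul z S.
by case: ifP => _ E; rewrite E /= ?ltnSn //; apply/negbTE; rewrite -leqNgt.
Qed.

Lemma fx_aeq p q z : simple n p q -> aeq p q (val z) -> ~~ fx p q (val z).
Proof. by move=> S A; have [] := Orb_aeq hn (Gt_Gp z) (Orb_id _) S A. Qed.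

Definition kind_of b s z := if s \in AscLt t n (val z) then KA else if s \in DesLt t n (val z) then KD
  else if s \in AscEq t n (val z) then (if b then KM else KP) else (if b then KP else KM).

Lemma kindE b p q z : simple n p q -> kind_of b (refl p q) z =
  if fx p q (val z) then (if b then KP else KM)
  else if `[< aeq p q (val z) >] then (if b then KM else KP)
  else if posr (val z p) (val z q) then KA else KD.
Proof.
move=> S; rewrite /kind_of AscLtE // DesLtE // AscEqE // /dsc.
have := @fx_aeq p q z S; case: asboolP => [A|A]; last by case: (fx _ _ _); case: (posr _ _).
by move/(_ A)/negPf ->.
Qed.

(* The default value is used only for equality ascents, where conjugation leaves G. *)
Definition mvG s z : Gt := insubd z (conjs n s (val z)).

Lemma mvG_val p q z : simple n p q -> ~ aeq p q (val z) -> val (mvG (refl p q) z) = cj p q (val z).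
Proof.
move=> S A; rewrite /mvG val_insubd -[conjs _ _ _]/(cj p q (val z)).
have /(Gset_Gp t hn) -> // := Gp_cj hn (Gt_Gp z) S A.
Qed.

Definition lnG z := len (val z).

Lemma kindG_A b s z : SS s -> kind_of b s z = KA ->
  [/\ kind_of b s (mvG s z) = KD, mvG s (mvG s z) = z & lnG (mvG s z) = (lnG z).+2].
Proof.
move=> /SsetP [p [q [S ->]]]; have SN := simple_N S; have Dq := simple_neq S.
have Hz := Gp_F (Gt_Gp z); rewrite kindE //; have [F|F] := boolP (fx _ _ _); first by case: b.
case: asboolP => A; first by case: b.
have [h|//] := boolP (posr _ _) => _; have A' : ~ aeq p q (cj p q (val z)) by move/(aeq_cj hn Hz S).
have M := mvG_val S A; split.
- rewrite kindE // M fx_cj ?(Fz_BC Hz) // (negPf F) asboolF //.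
  by rewrite (posr_cj Hz SN F) h.
- by apply: val_inj; rewrite mvG_val // M ?cjK.
- by rewrite /lnG M (len_cj_up hn Hz SN F h).
Qed.

Lemma kindG_D b s z : SS s -> kind_of b s z = KD ->
  [/\ kind_of b s (mvG s z) = KA, mvG s (mvG s z) = z & lnG z = (lnG (mvG s z)).+2].
Proof.
move=> /SsetP [p [q [S ->]]]; have SN := simple_N S; have Dq := simple_neq S.
have Hz := Gp_F (Gt_Gp z); rewrite kindE //; have [F|F] := boolP (fx _ _ _); first by case: b.
case: asboolP => A; first by case: b.
have [//|h] := boolP (posr _ _) => _; have A' : ~ aeq p q (cj p q (val z)) by move/(aeq_cj hn Hz S).
have M := mvG_val S A; split.
- rewrite kindE // M fx_cj ?(Fz_BC Hz) // (negPf F) asboolF //.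
  by rewrite (posr_cj Hz SN F) h.
- by apply: val_inj; rewrite mvG_val // M ?cjK.
- by rewrite /lnG M (len_cj_dn hn Hz SN F h).
Qed.

Definition dgA (k : kd) : laurent := match k with KA => 0 | KD => xL - xLi | KM => - xLi | KP => xL end.
Definition isAD k := match k with KA | KD => true | _ => false end.

Lemma mvGK b s z : SS s -> isAD (kind_of b s z) -> isAD (kind_of b s (mvG s z)) /\ mvG s (mvG s z) = z.
Proof.
by move=> S; case K: (kind_of b s z) => // _; [have [-> ->] := kindG_A S K | have [-> ->] := kindG_D S K].
Qed.

Lemma evecE y z : evec t n y z = (z == y)%:R :> laurent.
Proof. by rewrite /evec /bvec ffunE (inj_eq val_inj). Qed.

Lemma actB_E b s y z : SS s -> actB t n b s y z =
  dgA (kind_of b s y) * (z == y)%:R + (isAD (kind_of b s y) && (z == mvG s y))%:R :> laurent.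
Proof.
move=> /SsetP [p [q [S Es]]].
have E : kind_of b s y = KA \/ kind_of b s y = KD -> bvec t n (conjs n s (val y)) z = (z == mvG s y)%:R :> laurent.
  rewrite Es kindE // => K; have A : ~ aeq p q (val y).
    by move=> A; move: K; rewrite (negPf (fx_aeq S A)) asboolT //; case: b => -[].
  by rewrite ffunE -[z == mvG _ _](inj_eq val_inj) mvG_val.
rewrite /actB /kind_of in E *; case: ifP => hA.
  by rewrite hA in E; rewrite E ?mul0r ?add0r //; left.
rewrite hA in E; case: ifP => hD.
  by rewrite hD in E; rewrite vD vZ evecE E; [rewrite addrC | right].
case: ifP => hE; first by rewrite vZ evecE; case: (b); rewrite addr0.
case: ifP => hF; first by rewrite vZ evecE; case: (b); rewrite addr0.
move: hA hD hE hF; rewrite Es AscLtE // DesLtE // AscEqE // DesEqE // /dsc => h1 h2 h3 h4.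
by move: h1 h2; rewrite h3 h4 /=; case: (posr _ _).
Qed.

(** The definition gives images of basis vectors, while coefficients of [A s v] are needed. Since
    [mvG s] is an involution on the strict ascents and descents of [s], the matrix is symmetric and
    the same rule applies. *)
Lemma actMN_E b s v z : SS s -> actMN t n b s v z = match kind_of b s z with
  | KA => v (mvG s z) | KD => v (mvG s z) + (xL - xLi) * v z
  | KM => - xLi * v z | KP => xL * v z end :> laurent.
Proof.
move=> S; rewrite /actMN vS.
have E y : v y *: actB t n b s y = (v y : laurent) *: actB t n b s y by [].
rewrite (eq_bigr (fun y => (if y == z then dgA (kind_of b s z) * v z else 0) +
  (if (y == mvG s z) && isAD (kind_of b s z) then v y else 0 : laurent))); last first.
  move=> y _; rewrite vZ actB_E // mulrDr; congr (_ + _).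
    rewrite [z == y]eq_sym; have [->|_] := eqVneq y z; last by rewrite !mulr0.
    by rewrite mulr1 mulrC.
  have -> : (isAD (kind_of b s y) && (z == mvG s y)) = ((y == mvG s z) && isAD (kind_of b s z)).
    apply/andP/andP => [[K /eqP ->]|[/eqP -> K]].
      by have [-> ->] := mvGK S K; rewrite eqxx.
    by have [-> ->] := mvGK S K; rewrite eqxx.
  by case: ifP => _; rewrite ?mulr1 ?mulr0.
rewrite big_split /= -!big_mkcond big_pred1_eq /=.
have -> : \sum_(y | (y == mvG s z) && isAD (kind_of b s z)) (v y : laurent) =
    if isAD (kind_of b s z) then v (mvG s z) : laurent else 0.
  case: (isAD _); last by rewrite big1 // => y; rewrite andbF.
  by rewrite (eq_bigl (pred1 (mvG s z))) ?big_pred1_eq // => y; rewrite andbT.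
case: (kind_of b s z); rewrite /=.
- by rewrite mul0r add0r.
- by rewrite addrC.
- by rewrite addr0.
- by rewrite addr0.
Qed.
End Kinds.

(** * Orders of products of two generators, and transfer of braid relations *)

Lemma order_comm (gT : finGroupType) (s u : gT) : s != u -> (s * s = 1)%g -> (u * u = 1)%g ->
  (s * u = u * s)%g -> #[(s * u)%g]%g = 2%N.
Proof.
move=> D hs hu C; apply: nt_prime_order => //.
  by rewrite expgS expg1 mulgA -[(s * u * s)%g]mulgA -C mulgA hs mul1g hu.
apply: contraNneq D => E; apply/eqP; apply: (mulIg u); by rewrite E hu.
Qed.

Lemma order_braid (gT : finGroupType) (s u : gT) : s != u -> (s * s = 1)%g -> (u * u = 1)%g ->
  (s * u * s = u * s * u)%g -> #[(s * u)%g]%g = 3%N.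
Proof.
move=> D hs hu C; apply: nt_prime_order => //.
  by rewrite !expgS expg0 mulg1 !mulgA C -[(u * s * u * u)%g]mulgA hu mulg1 -[(u * s * s)%g]mulgA hs mulg1 hu.
apply: contraNneq D => E; apply/eqP; apply: (mulIg u); by rewrite E hu.
Qed.

Lemma order_quad (gT : finGroupType) (s u r : gT) : (s * s = 1)%g -> (r * r = 1)%g -> s != r ->
  (u * s * u = r)%g -> (s * r = r * s)%g -> #[(s * u)%g]%g = 4%N.
Proof.
move=> hs hr D E C; have E2 : ((s * u) ^+ 2 = s * r)%g by rewrite expgS expg1 -E !mulgA.
have N2 : ~~ (#[(s * u)%g]%g %| 2)%N.
  rewrite order_dvdn E2; apply: contraNneq D => E1; apply/eqP; apply: (mulIg r); by rewrite E1 hr.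
have D4 : (#[(s * u)%g]%g %| 4)%N.
  by rewrite order_dvdn (expgM _ 2 2) E2 expgS expg1 mulgA -[(s * r * s)%g]mulgA -C mulgA hs mul1g hr.
by move: N2 D4; move: #[_]%g => [|[|[|[|[|k]]]]] //= _ /dvdn_leq => /(_ isT).
Qed.

Section Transfer.
Variables (V W : Type) (F : V -> W) (a b a' b' : V -> V) (Da Db : W -> W).
Hypotheses (Finj : injective F) (Fa : forall v, F (a' v) = Da (F v))
  (Fb : forall v, F (b' v) = Db (F v)).
Hypotheses (aK : cancel a a') (aK' : cancel a' a) (bK : cancel b b') (bK' : cancel b' b).

(** The operators on functions realise the inverses [a'] and [b']. A braid relation between
    inverses, itself inverted, is the one between [a] and [b]. *)
Lemma eq_from_inverse (f g f' g' : V -> V) : cancel f f' -> cancel f' f -> cancel g g' ->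
  f' =1 g' -> f =1 g.
Proof. by move=> h1 h2 h3 E v; rewrite -[RHS]h2 E h3. Qed.

Lemma transfer_braid2 : (forall f, Da (Db f) = Db (Da f)) -> a \o b =1 b \o a.
Proof.
move=> H; apply: (eq_from_inverse (f' := b' \o a') (g' := a' \o b')).
- exact: can_comp aK bK.
- exact: can_comp bK' aK'.
- exact: can_comp bK aK.
by move=> v; apply: Finj; rewrite /= Fb !Fa Fb H.
Qed.

Lemma transfer_braid3 : (forall f, Da (Db (Da f)) = Db (Da (Db f))) ->
  a \o (b \o a) =1 b \o (a \o b).
Proof.
move=> H; apply: (eq_from_inverse (f' := (a' \o b') \o a') (g' := (b' \o a') \o b')).
- exact: can_comp aK (can_comp bK aK).
- exact: can_comp (can_comp aK' bK') aK'.
- exact: can_comp bK (can_comp aK bK).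
by move=> v; apply: Finj; rewrite /= Fa !Fb !Fa !Fb H.
Qed.

Lemma transfer_braid4 : (forall f, Da (Db (Da (Db f))) = Db (Da (Db (Da f)))) ->
  a \o (b \o (a \o b)) =1 b \o (a \o (b \o a)).
Proof.
move=> H; apply: (eq_from_inverse (f' := ((b' \o a') \o b') \o a') (g' := ((a' \o b') \o a') \o b')).
- exact: can_comp aK (can_comp bK (can_comp aK bK)).
- exact: can_comp (can_comp (can_comp bK' aK') bK') aK'.
- exact: can_comp bK (can_comp aK (can_comp bK aK)).
by move=> v; apply: Finj; rewrite /= Fb Fa Fb !Fa Fb Fa Fb H.
Qed.
End Transfer.

(** * The bar operator and the Hecke relations on M and N *)

Section Bar.
Variables (n : nat) (t : ctype).
Hypothesis hn : (1 < n)%N.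
Local Notation N := (n.*2).
Local Notation P := {perm pt N}.
Local Notation neg := (negp n).
Local Notation simple := (@simple_root n t).
Local Notation Fz := (@fpf_inv n t).
Local Notation Gt := (Gty t n).
Local Notation V := {ffun Gt -> laurent^o}.
Local Notation SS := (fun s : P => is_true (s \in Sset t n)).
Variable b : bool.
Local Notation kind := (@kind_of n t b).
Local Notation A := (actMN t n b).
Local Notation alt := (Defs.alt t n).
Implicit Types (p q x : pt N) (w s u : P) (y z : Gt) (v : V).

(** The inverse of [H_s] is [H_s + th]. The scalars [c] and [e] are the eigenvalues of [H_s] at
    [Des^=] and [Asc^=], in M or N according to [b]; [ci] and [e'] are their inverses. *)
Let th : laurent := - (xL - xLi).
Let c : laurent := if b then xL else - xLi.
Let ci : laurent := if b then xLi else - xL.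
Let e : laurent := if b then - xLi else xL.
Let e' : laurent := if b then - xL else xLi.

Let hcc : c * ci = 1. Proof. by rewrite /c /ci; case: (b); ring: xLxLi. Qed.
Let hci' : ci = c + th. Proof. by rewrite /c /ci /th; case: (b); ring. Qed.
Let hee : e * e' = 1. Proof. by rewrite /e /e'; case: (b); ring: xLxLi. Qed.
Let he' : e' = e + th. Proof. by rewrite /e /e' /th; case: (b); ring. Qed.
Let hci : ci * ci = 1 + th * ci.
Proof. by rewrite {1}hci' mulrDl hcc. Qed.

Definition symop (k : kd -> laurent) s (f : Gt -> laurent) z : laurent :=
  (if isAD (kind s z) then f (mvG s z) else 0) + k (kind s z) * f z.

(** [mvG s] is an involution of the strict ascents and descents, so the off-diagonal part is
    self-adjoint. *)
Lemma op_sym k s f g : SS s -> \sum_z symop k s f z * g z = \sum_z f z * symop k s g z.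
Proof.
move=> S; pose h (f g : Gt -> laurent) := \sum_(z | isAD (kind s z)) f (mvG s z) * g z.
have E f' g' : \sum_z symop k s f' z * g' z = h f' g' + \sum_z k (kind s z) * f' z * g' z.
  rewrite /h [X in _ = X + _]big_mkcond -big_split; apply: eq_bigr => z _; rewrite mulrDl; congr (_ + _).
  by case: ifP => _; rewrite ?mul0r.
rewrite E [RHS](eq_bigr (fun z => symop k s g z * f z)) => [|z _]; last exact: mulrC.
rewrite E; congr (_ + _); last by apply: eq_bigr => z _; ring.
rewrite /h (reindex_onto (mvG s) (mvG s)) => [|z K]; last by have [] := mvGK hn S K.
apply: eq_big => [z|z K].
  apply/andP/idP => [[K /eqP E2]|K].
    by have [] := mvGK hn S K; rewrite E2.
  by have [-> ->] := mvGK hn S K; rewrite eqxx.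
by case/andP: K => _ /eqP ->; rewrite mulrC.
Qed.

(** Diagonal entries of the inverse of [H_s] and, in [kbar], of [H_s] with barred coefficients. They
    differ by exchanging strict ascents and descents. *)
Definition kinv (k : kd) : laurent := match k with KA => th | KD => 0 | KM => - xL | KP => xLi end.
Definition kbar (k : kd) : laurent := match k with KA => 0 | KD => th | KM => - xL | KP => xLi end.

Lemma op_sum k s (a : Gt -> laurent) (f : Gt -> Gt -> laurent) z :
  symop k s (fun z' => \sum_y a y * f y z') z = \sum_y a y * symop k s (f y) z.
Proof.
rewrite /symop mulr_sumr; case: (isAD _).
  by rewrite -big_split; apply: eq_bigr => y _ /=; ring.
by rewrite add0r; apply: eq_bigr => y _; ring.
Qed.

Lemma A_op s v z : SS s -> (A s v - (xL - xLi) *: v) z = symop kinv s (fun z => v z) z :> laurent.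
Proof.
move=> S; rewrite vD vN vZ actMN_E // /symop; case: (kind s z); rewrite /= /th; ring.
Qed.

Lemma lb_A s v z : SS s -> lb (A s v z) = symop kbar s (fun z => lb (v z)) z.
Proof.
move=> S; rewrite actMN_E // /symop; case: (kind s z); rewrite /= /th.
- by ring.
- by rewrite lbarD lbarM lb_xd.
- by rewrite lbarM lbarN lbar_xLi; ring.
- by rewrite lbarM lbar_xL; ring.
Qed.

Definition Bz z z' : laurent := Bc t c ci th e (val z) (val z').

Lemma Bz_op s z z' : SS s -> symop kbar s (fun z => Bz z z') z = symop kinv s (Bz z) z'.
Proof.
move=> /(SsetP t hn) [p [q [S ->]]]; have Gz := Gt_Gp hn z; have Gz' := Gt_Gp hn z'.
have L := Bc_left hn hcc hci' hee he' Gz Gz' S.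
have R := Bc_right hn hcc hci' hee he' (val z) Gz' S.
have L' : symop kbar (refl p q) (fun z => Bz z z') z = (if XXb (val z) (val z')
   then c ^+ n * Tw t ci th (val z) (Dop t ci th p q (psi t e (val z'))) (val z) else 0).
  rewrite -L /symop kindE //; have [F|F] := boolP (fx p q (val z)).
    by rewrite /Bz /ci; case: (b); rewrite /=; ring.
  case: asboolP => A; first by rewrite /Bz /e'; case: (b); rewrite /=; ring.
  by have [h|h] := boolP (posr _ _); rewrite /Bz /= mvG_val //; ring.
rewrite {}L' -R /symop kindE //; have [F|F] := boolP (fx p q (val z')).
  by rewrite /Bz /ci; case: (b); rewrite /=; ring.
case: asboolP => A; first by rewrite /Bz /e'; case: (b); rewrite /=; ring.
by have [h|h] := boolP (posr _ _); rewrite /Bz /= mvG_val //; ring.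
Qed.

Definition bar v : V := [ffun z' => (\sum_z lb (v z) * Bz z z' : laurent)].

Lemma barE v z' : bar v z' = \sum_z lb (v z) * Bz z z' :> laurent.
Proof. by rewrite ffunE. Qed.

Lemma bar_isBar : isBar t n A bar.
Proof.
split.
- move=> u v; apply: v_ext => z; rewrite vD !barE -big_split; apply: eq_bigr => y _.
  by rewrite vD lbarD mulrDl.
- move=> a v; apply: v_ext => z; rewrite -lbE vZ !barE mulr_sumr; apply: eq_bigr => y _.
  by rewrite vZ lbarM mulrA.
- move=> s S v; apply: v_ext => z; rewrite A_op // barE.
  rewrite (eq_bigr (fun y => symop kbar s (fun z => lb (v z)) y * Bz y z)) => [|y _]; last by rewrite lb_A.
  (* The barred generator moves from the vector to the first index of [Bz]; by [Bz_op] it then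
     becomes the inverse generator on the second index. *)
  rewrite op_sym //.
  rewrite (_ : (fun z => _) = fun z' => \sum_y lb (v y) * Bz y z'); last by apply: funext => z'; exact: barE.
  by rewrite op_sum; apply: eq_bigr => y _; rewrite Bz_op.
- move=> y H; apply: v_ext => z; rewrite barE (bigD1 y) //= evecE eqxx lbar1 mul1r.
  rewrite big1 ?addr0 => [|z' nz]; last by rewrite evecE (negPf nz) lbar0 mul0r.
  rewrite /Bz (Bc_min hn e hcc hci' (Gt_Gp hn y)) ?(Gt_Gp hn z) //.
    by rewrite evecE (inj_eq val_inj) eq_sym.
  apply: no_dsc_min => // [|p q S]; first exact: Gt_Gp.
  by rewrite -DesLtE // H inE.
exact: Gt_Gp.
Qed.

Definition Psi v w : laurent := \sum_z (v z : laurent) * psi t e (val z) w.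
Definition Ainv s v : V := A s v - (xL - xLi) *: v.

Lemma D_Psi p q v : simple n p q -> Dop t ci th p q (Psi v) = Psi (Ainv (refl p q) v).
Proof.
move=> S; have SSr : SS (refl p q) by apply/(SsetP t hn); exists p, q.
have Dpsi z w : Dop t ci th p q (psi t e (val z)) w = symop kinv (refl p q) (fun y => psi t e (val y) w) z.
  have Gz := Gt_Gp hn z; rewrite /symop kindE //; have [F|F] := boolP (fx p q (val z)).
    by rewrite (psi_fx hn) // /ci; case: (b); rewrite /=; ring.
  case: asboolP => Aq; first by rewrite (psi_aeq hn _ hee he' Gz S Aq) /e'; case: (b); rewrite /=; ring.
  have [h|h] := boolP (posr _ _); rewrite /= mvG_val //.
    by rewrite (psi_asc hn).
  have G1 := Gp_cj hn Gz S Aq; rewrite mul0r addr0.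
  have [Hw|Hw] := boolP (Fz w); first by rewrite (psi_des hn _ hci).
  rewrite psi_out => [|O]; last by rewrite (Orb_F G1 O) in Hw.
  by rewrite /Dop (negPf Hw).
apply: funext => w; rewrite /Psi.
have -> : Dop t ci th p q (fun w => \sum_z (v z : laurent) * psi t e (val z) w) w =
    \sum_z (v z : laurent) * Dop t ci th p q (psi t e (val z)) w.
  rewrite /Dop; case: ifP => _; last by rewrite big1 // => z _; rewrite mulr0.
  case: ifP => _; first by rewrite mulr_sumr; apply: eq_bigr => z _; ring.
  case: ifP => _ //; rewrite mulr_sumr -big_split; apply: eq_bigr => z _ /=; ring.
rewrite (eq_bigr _ (fun z _ => congr1 _ (Dpsi z w))) -op_sym //.
by apply: eq_bigr => z _; rewrite -A_op.
Qed.

(** Distinct elements of G lie in distinct orbits, so the values of [Psi v] on G are the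
    coefficients of [v]. *)
Lemma Psi_inj v v' : Psi v = Psi v' -> v = v'.
Proof.
have E (u : V) z : Psi u (val z) = u z.
  rewrite /Psi (bigD1 z) //= psi_id mulr1 big1 ?addr0 // => y ny.
  rewrite psi_out ?mulr0 // => O; move/eqP: ny; apply; apply: val_inj.
  exact: (esym (Orb_G (Gt_Gp hn y) (Gt_Gp hn z) O)).
by move=> H; apply: v_ext => z; rewrite -!E H.
Qed.

Let kA := @kindG_A n t hn b.
Let kD := @kindG_D n t hn b.
Let HA := @actMN_E n t hn b.

Lemma AinvK s v : SS s -> A s (Ainv s v) = v.
Proof.
move=> S; rewrite /Ainv -scaleNr (A_add HA) // (A_scale HA) // (A_quad kA kD HA) //.
by rewrite scaleNr addrAC subrr add0r.
Qed.

Lemma AKinv s v : SS s -> Ainv s (A s v) = v.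
Proof. by move=> S; rewrite /Ainv (A_quad kA kD HA) // addrAC subrr add0r. Qed.

Section Braid.
Variables (p q p' q' : pt N) (s u : P).
Hypotheses (S : simple n p q) (S' : simple n p' q') (Es : s = refl p q) (Eu : u = refl p' q').
Hypothesis NE : s != u.
Let Ss : SS s. Proof. by apply/(SsetP t hn); exists p, q. Qed.
Let Su : SS u. Proof. by apply/(SsetP t hn); exists p', q'. Qed.
Let s2 : (s * s = 1)%g. Proof. by rewrite Es refl2. Qed.
Let u2 : (u * u = 1)%g. Proof. by rewrite Eu refl2. Qed.
Let Ps v : Psi (Ainv s v) = Dop t ci th p q (Psi v). Proof. by rewrite (D_Psi v S) Es. Qed.
Let Pu v : Psi (Ainv u v) = Dop t ci th p' q' (Psi v). Proof. by rewrite (D_Psi v S') Eu. Qed.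
Let cs : cancel (A s) (Ainv s). Proof. by move=> v; apply: AKinv. Qed.
Let cu : cancel (A u) (Ainv u). Proof. by move=> v; apply: AKinv. Qed.
Let cs' : cancel (Ainv s) (A s). Proof. by move=> v; apply: AinvK. Qed.
Let cu' : cancel (Ainv u) (A u). Proof. by move=> v; apply: AinvK. Qed.
Let SN := simple_N S.
Let SN' := simple_N S'.

Lemma alt2 : comm_roots p q p' q' && comm_roots p' q' p q ->
  #[(s * u)%g]%g = 2%N /\ alt A s u 2 =1 alt A u s 2.
Proof.
case/andP => C C'; split; first by apply: order_comm; rewrite // Es Eu; exact: comm_refl.
exact: (transfer_braid2 Psi_inj Ps Pu cs cs' cu cu' (fun f => braid2 hn hci f SN SN' C C')).
Qed.

Lemma alt3 : p' = neg q -> link3 p q q' -> #[(s * u)%g]%g = 3%N /\ alt A s u 3 =1 alt A u s 3.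
Proof.
move=> E L; split.
  by apply: order_braid; rewrite // Es Eu E; have [_ []] := link3_refl L.
apply: (transfer_braid3 Psi_inj Ps Pu cs cs' cu cu') => f.
by rewrite E; apply: (braid3 hn hci) => //; rewrite -E.
Qed.

Lemma alt4 : q = p -> p' = neg p -> link4 p q' -> #[(s * u)%g]%g = 4%N /\ alt A s u 4 =1 alt A u s 4.
Proof.
move=> Eq E L; split.
  have Dp := simple_neq S; have Dp' := simple_neq S'.
  have up : refl p' q' p = q'.
    by rewrite -[p]negK -E refl_np.
  have /andP[/eqP vp /eqP vq] := L.
  have dq : q' != neg q' by rewrite sval_eq sval_neg vq.
  have C : comm_roots p p q' q'.
    by rewrite /comm_roots !refl_id ?eqxx // ?vp ?vq.
  apply: (@order_quad _ s u (refl q' q')); rewrite ?refl2 //.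
  - have dp : p != neg p by rewrite sval_eq sval_neg vp.
    rewrite Es Eq refl_same_root //.
    by rewrite /same_root !sval_eq !sval_neg vp vq.
  - by rewrite Es Eu Eq -mulgA (refl_conj p p (isBC_refl p' q')) up mulgA refl2 mul1g.
  - by rewrite Es Eq; apply: comm_refl.
apply: (transfer_braid4 Psi_inj Ps Pu cs cs' cu cu') => f.
rewrite E Eq; apply: (braid4 hn hci) => //; first by rewrite -{2}Eq.
by rewrite -E.
Qed.
End Braid.

Lemma A_Hecke : HeckeRel t n A.
Proof.
split=> [s S v|s u Ss Su]; first exact: (A_quad kA kD HA).
case/(SsetP t hn): (Ss) => p [q [S Es]]; case/(SsetP t hn): (Su) => p' [q' [S' Eu]] NE.
have NE' : (p, q) <> (p', q') by move=> [E1 E2]; rewrite Es Eu E1 E2 eqxx in NE.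
have NEs : u != s by rewrite eq_sym.
(* [HeckeRel] takes the order of [s * u] as the length of the braid relation. When the two roots
   come in the reverse order, it is the order of [u * s] that has been computed. *)
have oC : #[(u * s)%g]%g = #[(s * u)%g]%g by rewrite -orderV invMg Es Eu !reflV.
case: (simple_cases hn (simple_N S) (simple_N S') NE').
- by move=> C; have [-> H] := alt2 S S' Es Eu NE C.
- by move=> [E L]; have [-> H] := alt3 S S' Es Eu NE E L.
- by move=> [E L]; have [o H] := alt3 S' S Eu Es NEs E L; rewrite -oC o => v; rewrite H.
case=> -[E1 E2 L]; first by have [-> H] := alt4 S S' Es Eu E1 E2 L.
by have [o H] := alt4 S' S Eu Es E1 E2 L; rewrite -oC o => v; rewrite H.
Qed.
End Bar.

(** * Canonical bases of M and N and their W-graphs *)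

Section Main.
Variables (n : nat) (t : ctype).
Hypothesis hn : (1 < n)%N.
Local Notation N := (n.*2).
Local Notation P := {perm pt N}.
Local Notation Gt := (Gty t n).
Local Notation V := {ffun Gt -> laurent^o}.
Local Notation SS := (fun s : P => is_true (s \in Sset t n)).
Variable b : bool.
Local Notation kind := (@kind_of n t b).
Local Notation A := (actMN t n b).
Local Notation beta := (barOp t n A).
Local Notation can := (Defs.canon t n A).
Implicit Types (s : P) (u w y z : Gt) (v : V).

Let kA := @kindG_A n t hn b.
Let kD := @kindG_D n t hn b.
Let HA := @actMN_E n t hn b.

(** [barOp] is selected by [epsilon], so it is used only through the properties collected in
    [isBar]; the explicit [bar] shows that they can be satisfied. *)
Lemma barOp_isBar : isBar t n A beta.
Proof. by apply: epsilon_spec; exists (bar b); exact: bar_isBar. Qed.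

Let b_add : forall v v', beta (v + v') = beta v + beta v'.
Proof. by have [] := barOp_isBar. Qed.
Let b_scale : forall (a : laurent) v, beta (a *: v) = lb a *: beta v.
Proof. by rewrite lbE; have [] := barOp_isBar. Qed.
Let b_A : forall s v, SS s -> beta (A s v) = A s (beta v) - (xL - xLi) *: beta v.
Proof. by have [_ _ H _] := barOp_isBar => s v S; apply: H. Qed.

Lemma evec_E z : evec t n z = ebas z.
Proof. by apply: v_ext => y; exact: etrans (evecE z y) (esym (EE z y)). Qed.

Let b_min : forall z, (forall s, SS s -> kind s z <> KD) -> beta (ebas z) = ebas z.
Proof.
have [_ _ _ H] := barOp_isBar => z Hz; rewrite -evec_E; apply: H.
apply/setP => s; rewrite in_set0; apply/negbTE/negP => h.
have S : SS s by move: h; rewrite in_setD inE => /andP[_ /andP[]].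
apply: (Hz s S); rewrite /kind_of h.
case/(SsetP t hn): (S) => p [q [Sp Es]]; move: h; rewrite Es AscLtE // DesLtE // /dsc.
by case/and3P => _ _ /negPf ->; rewrite !andbF.
Qed.

Lemma isCanonE c : isCanon t n A c <-> canonical_family (@lnG n t) beta c.
Proof.
by rewrite /isCanon /canonical_family /lneg lcE.
Qed.

Lemma canon_canonical : canonical_family (@lnG n t) beta can.
Proof.
apply/isCanonE; apply: epsilon_spec.
have [c [Hc _]] := canonical_ex kA kD HA b_add b_scale b_A b_min.
by exists c; apply/isCanonE.
Qed.

(** [canon] is also selected by [epsilon]; uniqueness identifies it with the constructed family, for
    which the parity is known. *)
Lemma canon_parity z y : lpar (color (@lnG n t) z (+) color (@lnG n t) y) (can z y).
Proof.
have [c [Hc Hp]] := canonical_ex kA kD HA b_add b_scale b_A b_min.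
have -> : can = c by apply: (canonical_uniq kA kD HA b_add b_scale b_A b_min) Hc; exact: canon_canonical.
exact: Hp.
Qed.

Lemma muE y z : Defs.mu t n A y z = mucoef can y z.
Proof. by rewrite /Defs.mu /mucoef lcE. Qed.

Definition Ib : P -> {set P} := if b then AscM t n else AscN t n.
Local Notation om := (omega t n A Ib).
Local Notation IV := (fun u : Gt => Ib (val u)).

Lemma Ib_inI s z : SS s -> (s \in Ib (val z)) = inI kind s z.
Proof.
move=> S; have [p [q [Sp Es]]] := (SsetP t hn s).1 S.
rewrite /inI Es kindE // /Ib.
have F := @fx_aeq n t hn p q z Sp.
have -> : (refl p q \in (if b then AscM t n else AscN t n) (val z)) =
   (refl p q \in AscLt t n (val z)) || (if b then `[< aeq p q (val z) >] else fx p q (val z)).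
  by case: (b); rewrite in_setU ?AscEqE ?DesEqE.
rewrite AscLtE //; case: asboolP F => [Aq /(_ Aq) /negPf -> |_ _].
  by rewrite andbF; case: (b).
by case: (b); case: (fx p q (val z)); case: (posr (val z p) (val z q)).
Qed.

Lemma om_E y z s : SS s -> inI kind s y -> ~~ inI kind s z -> om y z = (mucoef can y z + mucoef can z y)%:~R.
Proof.
move=> S h1 h2; rewrite /omega ifT ?muE //; apply/negP => /subsetP /(_ s).
by rewrite !Ib_inI // h1 (negPf h2) => /(_ isT).
Qed.

Lemma actYb_E s u : SS s -> actYb t n om IV s u =
  if ~~ inI kind s u then xL *: ebas u
  else - xLi *: ebas u + \sum_(w | ~~ inI kind s w) om u w *: ebas w.
Proof.
move=> S; have I_E w : (s \notin Ib (val w)) = ~~ inI kind s w by rewrite Ib_inI.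
rewrite /actYb I_E; case: (~~ _); first exact: (congr1 (fun v : V => xL *: v) (evec_E u)).
rewrite (evec_E u); congr (_ + _).
by apply: eq_big => [w|w _]; [exact: I_E | rewrite evec_E].
Qed.

Lemma intertwine s v : SS s -> phi can (actY t n om IV s v) = A s (phi can v).
Proof.
move=> S; have H := phi_inter kA kD HA b_add b_scale b_A b_min canon_canonical v S
  (fun u => actYb_E u S) (fun u w => @om_E u w s S).
exact: H.
Qed.

Lemma isoCanon_b : isoCanon t n om IV A.
Proof.
split; first exact: (phi_bij canon_canonical).
by move=> s S v; exact: intertwine.
Qed.

(** The Hecke relations hold on the module and are pulled back along [phi], which is injective and
    intertwines the two actions. *)
Lemma isWgraph_b : isWgraph t n om IV.
Proof.
have inj : injective (phi can) := bij_inj (phi_bij canon_canonical).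
have [Hq Hb] := A_Hecke t hn b; split=> [s S v|s s2 S S' D v].
  by apply: inj; rewrite !intertwine // Hq // phi_add phi_scale intertwine.
have H k s' (u' : P) (w : V) : SS s' -> SS u' ->
    phi can (alt t n (actY t n om IV) s' u' k w) = alt t n A s' u' k (phi can w).
  by elim: k s' u' => //= k IH s' u' S1 S2; rewrite intertwine // IH.
by apply: inj; rewrite !H // Hb.
Qed.

(** The exponent -1 is odd, so a nonzero coefficient there forces different colours. *)
Lemma mu_col y z : mucoef can y z != 0 -> color (@lnG n t) y != color (@lnG n t) z.
Proof.
move=> h; have := @canon_parity z y (-1) h.
by rewrite /=; case: (color _ z); case: (color _ y).
Qed.

Lemma quasiAdmissible_b : quasiAdmissible t n om IV.
Proof.
split.
- exists (color (@lnG n t)) => u v; rewrite /omega; case: ifP => _; last by rewrite eqxx.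
  rewrite !muE; have [e1|/mu_col //] := eqVneq (mucoef can u v) 0.
  have [e2|/mu_col] := eqVneq (mucoef can v u) 0; last by rewrite eq_sym.
  by rewrite e1 e2 eqxx.
- move=> u v; rewrite /omega; case: ifP => _; first by eexists.
  by exists 0.
- by move=> u v h; rewrite /omega h.
- move=> u v h1 h2; rewrite /omega.
  rewrite h1.
  rewrite h2.
  exact: (congr1 (fun k : int => k%:~R : laurent) (addrC _ _)).
Qed.
End Main.

Theorem mainTheorem4 (t : ctype) (n : nat) : (2 <= n)%N ->
  let Am := actMN t n true in
  let An := actMN t n false in
  let omM := omega t n Am (AscM t n) in
  let omN := omega t n An (AscN t n) in
  let IM := fun u : Gty t n => AscM t n (val u) in
  let IN := fun u : Gty t n => AscN t n (val u) in
  [/\ isWgraph t n omM IM /\ quasiAdmissible t n omM IM,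
      isWgraph t n omN IN /\ quasiAdmissible t n omN IN,
      isoCanon t n omM IM Am
    & isoCanon t n omN IN An].
Proof.
move=> hn Am An omM omN IM IN; split.
- by split; [exact: (isWgraph_b t hn true) | exact: (quasiAdmissible_b t hn true)].
- by split; [exact: (isWgraph_b t hn false) | exact: (quasiAdmissible_b t hn false)].
- exact: (isoCanon_b t hn true).
- exact: (isoCanon_b t hn false).
Qed.
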